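(* Every analytic flat surface in $\mathbb{S}^3$ (complete or not) is orientable.
   Context: An analytic flat surface in $\mathbb{S}^3$ is a real-analytic immersion $F:\Sigma\to\mathbb{S}^3$ of a connected surface $\Sigma$ into the unit $3$-sphere whose induced metric is flat; the statement asserts that $\Sigma$ is orientable. *)

(* Defs.v *)
From HB Require Import structures.
From mathcomp Require Export all_boot all_order all_algebra.
From mathcomp Require Export all_classical all_reals all_analysis.

Set Implicit Arguments.
Unset Strict Implicit.
Unset Printing Implicit Defensive.

Import Order.TTheory GRing.Theory Num.Theory.
Import numFieldNormedType.Exports.

Local Open Scope classical_set_scope.
Local Open Scope ring_scope.

Section Analytic.
Variable R : realType.

(* Convergence of a double power series at h means absolute convergence; the
   order of summation is then irrelevant and square partial sums are used. *)
Definition power_series2_sum (c : nat -> nat -> R) (h : 'rV[R]_2) (s : R) :=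
  cvgn (fun N : nat =>
    \sum_(i < N) \sum_(j < N) `|c i j * h 0 0 ^+ i * h 0 1 ^+ j|) /\
  (fun N : nat =>
    \sum_(i < N) \sum_(j < N) c i j * h 0 0 ^+ i * h 0 1 ^+ j) @ \oo --> s.

Definition analytic_at (m : nat) (f : 'rV[R]_2 -> 'rV[R]_m) (p : 'rV[R]_2) :=
  forall k : 'I_m, exists c : nat -> nat -> R,
    \forall q \near p, power_series2_sum c (q - p) (f q 0 k).

Definition analytic_on (m : nat) (f : 'rV[R]_2 -> 'rV[R]_m)
    (U : set 'rV[R]_2) :=
  forall p, U p -> analytic_at f p.

End Analytic.

Section Surface.
Variables (R : realType) (T : topologicalType).

(* A chart is a homeomorphism from the open set [cdom] onto an open subset of
   the plane.  [cmap] and [cinv] are total functions whose values outside [cdom]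
   and [cimg] are irrelevant. *)
Record chart := Chart {
  cdom : set T;
  cmap : T -> 'rV[R]_2;
  cinv : 'rV[R]_2 -> T;
  open_cdom : open cdom;
  open_cimg : open (cmap @` cdom);
  cmapK : forall x, cdom x -> cinv (cmap x) = x;
  cmap_continuous : {within cdom, continuous cmap};
  cinv_continuous : {within cmap @` cdom, continuous cinv} }.

Definition cimg (c : chart) : set 'rV[R]_2 := cmap c @` cdom c.

Definition transition (c d : chart) : 'rV[R]_2 -> 'rV[R]_2 :=
  cmap d \o cinv c.

Definition transition_dom (c d : chart) : set 'rV[R]_2 :=
  cmap c @` (cdom c `&` cdom d).

Definition analytically_compatible (c d : chart) :=
  analytic_on (transition c d) (transition_dom c d) /\
  analytic_on (transition d c) (transition_dom d c).

Definition analytic_atlas (A : set chart) :=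
  (forall x : T, exists2 c, A c & cdom c x) /\
  (forall c d, A c -> A d -> analytically_compatible c d).

Definition analytic_surface (A : set chart) :=
  [/\ hausdorff_space T, @second_countable T & analytic_atlas A].

(* The analytic structure defined by the atlas A (i.e. the maximal atlas
   containing A) contains an atlas with orientation-preserving transitions. *)
Definition orientable (A : set chart) :=
  exists B : set chart,
    [/\ analytic_atlas B,
        forall b c, B b -> A c -> analytically_compatible b c &
        forall b c, B b -> B c -> forall p, transition_dom b c p ->
          0 < \det ('J (transition b c) p)].

End Surface.

Section Curvature.
Variable R : realType.

Definition partial (i : 'I_2) (f : 'rV[R]_2 -> R) (p : 'rV[R]_2) : R :=
  'D_(delta_mx 0 i) f p.

(* g p is the Gram matrix of a metric at p in the coordinates (x_0, x_1):
   G^k_ij = 1/2 sum_l g^kl (d_i g_jl + d_j g_il - d_l g_ij). *)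
Definition christoffel (g : 'rV[R]_2 -> 'M[R]_2) (k i j : 'I_2)
    (p : 'rV[R]_2) : R :=
  2^-1 * \sum_(l < 2) invmx (g p) k l *
    (partial i (fun q => g q j l) p + partial j (fun q => g q i l) p
     - partial l (fun q => g q i j) p).

(* The d_l-component of R(d_i, d_j) d_k. *)
Definition riemann (g : 'rV[R]_2 -> 'M[R]_2) (l k i j : 'I_2)
    (p : 'rV[R]_2) : R :=
  partial i (christoffel g l j k) p - partial j (christoffel g l i k) p
  + \sum_(m < 2) (christoffel g l i m p * christoffel g m j k p
                  - christoffel g l j m p * christoffel g m i k p).

Definition flat_metric_on (g : 'rV[R]_2 -> 'M[R]_2) (U : set 'rV[R]_2) :=
  forall p, U p -> forall l k i j, riemann g l k i j p = 0.

(* Row i of 'J X p is the i-th partial derivative of X at p, so the (i, j) entry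
   is the Euclidean inner product of the i-th and j-th partial derivatives. *)
Definition induced_metric (n : nat) (X : 'rV[R]_2 -> 'rV[R]_n)
    (p : 'rV[R]_2) : 'M[R]_2 :=
  'J X p *m ('J X p)^T.

End Curvature.

Section Immersion.
Variables (R : realType) (T : topologicalType).

(* The norm of 'rV[R]_4 in the library is the sup norm, hence the explicit
   sum of squares. *)
Definition sphere3 : set 'rV[R]_4 :=
  [set v | \sum_(i < 4) v 0 i ^+ 2 = 1].

(* As S^3 is an embedded analytic submanifold of R^4, a map into S^3 is an
   analytic immersion iff it is one as a map into R^4, and the metric induced
   from S^3 is the one induced from R^4. *)
Definition analytic_immersion_S3 (A : set (chart R T)) (F : T -> 'rV[R]_4) :=
  (forall x, sphere3 (F x)) /\
  forall c, A c ->
    analytic_on (F \o cinv c) (cimg c) /\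
    forall p, cimg c p -> injective ('d (F \o cinv c) p).

Definition flat_immersion (A : set (chart R T)) (F : T -> 'rV[R]_4) :=
  forall c, A c -> flat_metric_on (induced_metric (F \o cinv c)) (cimg c).

End Immersion.

(* Main.v *)
From HB Require Import structures.
Require Import Defs.
From mathcomp Require Import ring lra.

(** Why the surface is orientable.

    Near each point there is a unit normal N of the surface in the 3-sphere, unique
    up to sign; the surface is orientable once a normal can be chosen continuously
    everywhere. With R^4 as the quaternions, N gives two Gauss maps N conj(F) and
    conj(F) N into the unit sphere of imaginary quaternions; both change sign with N.

    Flatness and the Gauss equation say that the shape operator has determinant -1
    (gauss_normal). Composed with the rotation by a right angle it becomes an
    involution P of the tangent plane, and the derivatives of the two Gauss maps are,
    up to multiplication by N, P - 1 and - P - 1. So each Gauss map has rank exactly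
    one (flat_split, chart_split), and locally it is c(u) for a curve c in the sphere,
    analytic and of unit speed, and a real function u on the surface
    (rank_one_factor). The velocities of the two curves come from independent
    directions of the surface, so, given N, they have an order that is positive or
    negative (sigma), and parameters are chosen to make it positive.

    Analyticity enters through continuation: a curve is determined by its germ. Fix
    the germs of both curves at a base point, and call a normal n at x admissible if
    some local factorisation at x with this normal has curves that continue these
    germs. Two factorisations over the same region have curves that differ by
    isometries of the parameter line and by a common sign (split_transition). Hence
    admissibility spreads from a point to the whole domain of any factorisation
    (admissible_spread), and by connectedness there is an admissible normal at every
    point. It is unique: if n and - n were both admissible at x, comparing the two
    factorisations would show that each of the curves is carried to its antipode by an
    isometry of the parameter, and the positivity of sigma forces this isometry to be
    a reflection for one of the two curves. At the fixed point of the reflection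
    c = - c, which is absurd for a unit vector (no_antipodal_reflection,
    admissible_not_opp). So the admissible normal is a continuous global normal
    (global_normal), and reversing the charts that disagree with it gives an oriented
    atlas (orientable_of_normal).

    The analysis is done with two descriptions of analytic functions. In two variables
    they are local limits of polynomials of bounded majorant norm (majorized), a class
    stable under derivatives by Cauchy estimates and under inverse square roots, hence
    containing the normal. In one variable they are functions whose derivatives grow at
    most factorially (tame), which suffices for unique continuation. The passage from
    the first to the second is the estimate of the iterates of an analytic vector field
    (iter_field_bound), applied to the field that parametrises by arc length. *)

Set Implicit Arguments.
Unset Strict Implicit.
Unset Printing Implicit Defensive.
Import Order.TTheory GRing.Theory Num.Theory.
Import numFieldNormedType.Exports.
Local Open Scope classical_set_scope.
Local Open Scope ring_scope.

(** * Polynomials in two variables *)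

Section Monomials.
Variable R : realType.
Implicit Types (p h k : 'rV[R]_2) (r rho : R) (f g : 'rV[R]_2 -> R).

(** Bernoulli-type bound: a derivative of the monomial costs a factor
    1 / (rho - r) when the radius shrinks from rho to r. It is the one-variable
    Cauchy estimate, with the division cleared. *)
Lemma pow_deriv_le (r rho : R) n : 0 <= r -> r <= rho ->
  n%:R * r ^+ n.-1 * (rho - r) <= rho ^+ n.
Proof.
move=> r0 rrho; elim: n => [|n IH]; first by rewrite !mul0r expr0 ler01.
have rho0 : 0 <= rho := le_trans r0 rrho.
have h : r ^+ n <= rho ^+ n by rewrite lerXn2r ?nnegrE.
have E : n%:R * r ^+ n = r * (n%:R * r ^+ n.-1).
  by case: n {IH h} => [|n] /=; [rewrite !mul0r mulr0 | rewrite exprS; ring].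
rewrite /= -natr1 mulrDl mul1r E mulrDl -mulrA exprS.
have -> : rho * rho ^+ n = r * rho ^+ n + rho ^+ n * (rho - r) by ring.
by apply: lerD; rewrite (ler_wpM2l r0, ler_wpM2r _) ?subr_ge0.
Qed.

Lemma pow_lip (r rho x y : R) n : `|x| <= r -> `|y| <= r -> r <= rho ->
  `|y ^+ n - x ^+ n| * (rho - r) <= `|y - x| * rho ^+ n.
Proof.
move=> xr yr rrho; have r0 : 0 <= r := le_trans (normr_ge0 _) xr.
have rho0 : 0 <= rho := le_trans r0 rrho.
elim: n => [|n IH]; first by rewrite !expr0 subrr normr0 mul0r mulr1.
have -> : y ^+ n.+1 - x ^+ n.+1 = y * (y ^+ n - x ^+ n) + x ^+ n * (y - x).
  by rewrite !exprS; ring.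
apply: (@le_trans _ _ ((`|y| * `|y ^+ n - x ^+ n| + `|x| ^+ n * `|y - x|) * (rho - r))).
  apply: ler_wpM2r; first by rewrite subr_ge0.
  by apply: (le_trans (ler_normD _ _)); rewrite !normrM normrX.
have h : `|x| ^+ n <= rho ^+ n.
  by rewrite lerXn2r ?nnegrE // (le_trans xr).
rewrite mulrDl exprS.
have -> : `|y - x| * (rho * rho ^+ n) =
  r * (`|y - x| * rho ^+ n) + rho ^+ n * `|y - x| * (rho - r) by ring.
apply: lerD.
  rewrite -mulrA; apply: ler_pM => //.
  by rewrite mulr_ge0 // subr_ge0.
by apply: ler_wpM2r; [rewrite subr_ge0|apply: ler_wpM2r].
Qed.

(** Second order remainder of a monomial, bounded uniformly in the degree; the
    uniformity is what lets the expansion survive passing to limits of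
    polynomials. *)
Lemma pow_taylor (r rho x y : R) n : `|x| <= r -> `|y| <= r -> r <= rho ->
  `|y ^+ n - x ^+ n - n%:R * x ^+ n.-1 * (y - x)| * (rho - r) ^+ 2
    <= `|y - x| ^+ 2 * rho ^+ n.
Proof.
move=> xr yr rrho; have r0 : 0 <= r := le_trans (normr_ge0 _) xr.
have rho0 : 0 <= rho := le_trans r0 rrho.
have d0 : 0 <= rho - r by rewrite subr_ge0.
elim: n => [|n IH].
  by rewrite !expr0 subrr !mul0r subr0 normr0 mul0r mulr1 sqr_ge0.
have E : n%:R * x ^+ n = x * (n%:R * x ^+ n.-1).
  by case: n {IH} => [|n] /=; [rewrite !mul0r mulr0 | rewrite exprS; ring].
have -> : y ^+ n.+1 - x ^+ n.+1 - n.+1%:R * x ^+ n.+1.-1 * (y - x) =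
   y * (y ^+ n - x ^+ n - n%:R * x ^+ n.-1 * (y - x))
   + n%:R * x ^+ n.-1 * (y - x) ^+ 2.
  by rewrite /= -natr1 mulrDl mul1r E !exprS; ring.
set B := (_ - _ - _ : R) in IH *.
apply: (@le_trans _ _ ((r * `|B| + n%:R * r ^+ n.-1 * `|y - x| ^+ 2) * (rho - r) ^+ 2)).
  apply: ler_wpM2r; first exact: sqr_ge0.
  apply: (le_trans (ler_normD _ _)); rewrite !normrM !normrX normr_nat.
  apply: lerD; first exact: ler_wpM2r.
  apply: ler_wpM2r; first exact: sqr_ge0.
  by apply: ler_wpM2l => //; rewrite lerXn2r ?nnegrE.
rewrite mulrDl -mulrA.
have -> : `|y - x| ^+ 2 * rho ^+ n.+1 = r * (`|y - x| ^+ 2 * rho ^+ n)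
   + `|y - x| ^+ 2 * (rho - r) * rho ^+ n by rewrite (exprS rho); ring.
apply: lerD; first exact: ler_wpM2l.
have -> : n%:R * r ^+ n.-1 * `|y - x| ^+ 2 * (rho - r) ^+ 2 =
  `|y - x| ^+ 2 * (rho - r) * (n%:R * r ^+ n.-1 * (rho - r)) by ring.
by apply: ler_wpM2l; [rewrite mulr_ge0 ?sqr_ge0|exact: pow_deriv_le].
Qed.

(** A list of pairs (coefficient, (exponent of x, exponent of y)). Repeated
    exponents are allowed, so addition is concatenation and the product is the
    list of all pairwise products. *)
Definition bipoly := seq (R * (nat * nat)).
Implicit Types P Q : bipoly.

Definition bieval P h : R :=
  \sum_(m <- P) m.1 * (h 0 0 ^+ m.2.1 * h 0 1 ^+ m.2.2).

(** The majorant norm: the sum of absolute values of the terms at (rho, rho). *)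
Definition binorm P rho : R :=
  \sum_(m <- P) `|m.1| * (rho ^+ m.2.1 * rho ^+ m.2.2).

Definition bideriv (i : 'I_2) P : bipoly :=
  [seq if i == 0 then (m.1 * m.2.1%:R, (m.2.1.-1, m.2.2))
       else (m.1 * m.2.2%:R, (m.2.1, m.2.2.-1)) | m <- P].

Definition bimul P Q : bipoly :=
  [seq (m.1 * l.1, ((m.2.1 + l.2.1)%N, (m.2.2 + l.2.2)%N)) | m <- P, l <- Q].

Lemma bieval_cat P Q h : bieval (P ++ Q) h = bieval P h + bieval Q h.
Proof. by rewrite /bieval big_cat. Qed.

Lemma binorm_cat P Q r : binorm (P ++ Q) r = binorm P r + binorm Q r.
Proof. by rewrite /binorm big_cat. Qed.

Lemma bieval_mul P Q h : bieval (bimul P Q) h = bieval P h * bieval Q h.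
Proof.
rewrite /bieval /bimul big_allpairs_dep /= big_distrl; apply: eq_bigr => m _ /=.
by rewrite big_distrr; apply: eq_bigr => l _ /=; rewrite !exprD; ring.
Qed.

Lemma binorm_mul P Q r : binorm (bimul P Q) r = binorm P r * binorm Q r.
Proof.
rewrite /binorm /bimul big_allpairs_dep /= big_distrl; apply: eq_bigr => m _ /=.
by rewrite big_distrr; apply: eq_bigr => l _ /=; rewrite !exprD normrM; ring.
Qed.

Lemma binorm_ge0 P r : 0 <= r -> 0 <= binorm P r.
Proof. by move=> r0; apply: sumr_ge0 => m _; rewrite !mulr_ge0 ?exprn_ge0. Qed.

Lemma binorm_le P r rho : 0 <= r -> r <= rho -> binorm P r <= binorm P rho.
Proof.
move=> r0 rrho; have rho0 := le_trans r0 rrho.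
apply: ler_sum => m _; apply: ler_wpM2l => //.
by apply: ler_pM; rewrite ?exprn_ge0 // lerXn2r ?nnegrE.
Qed.

Lemma coord_le h i : `|h 0 i| <= `|h|.
Proof.
rewrite /Num.norm /= mx_normrE.
exact: (@le_bigmax _ _ _ _ (fun ij : 'I_1 * 'I_2 => `|h ij.1 ij.2|) (0, i)).
Qed.

Lemma bieval_le P h r : `|h| <= r -> `|bieval P h| <= binorm P r.
Proof.
move=> hr; apply: (le_trans (ler_norm_sum _ _ _)).
apply: ler_sum => m _; rewrite !normrM !normrX; apply: ler_wpM2l => //.
have r0 : 0 <= r := le_trans (normr_ge0 _) hr.
by apply: ler_pM; rewrite ?exprn_ge0 // lerXn2r ?nnegrE //; apply: (le_trans (coord_le _ _)).
Qed.

Lemma binorm_deriv i P r rho : 0 <= r -> r < rho ->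
  binorm (bideriv i P) r <= binorm P rho / (rho - r).
Proof.
move=> r0 rrho; have rho0 : 0 <= rho by apply: le_trans r0 (ltW rrho).
have d0 : 0 < rho - r by rewrite subr_gt0.
rewrite ler_pdivlMr // /binorm big_map big_distrl /=; apply: ler_sum => -[c [a b]] _ /=.
have X n := pow_deriv_le n r0 (ltW rrho).
have Y n : r ^+ n <= rho ^+ n by rewrite lerXn2r ?nnegrE // ltW.
case: ifP => _ /=; rewrite normrM normr_nat -!mulrA; apply: ler_wpM2l => //.
  have -> : a%:R * (r ^+ a.-1 * (r ^+ b * (rho - r))) = a%:R * r ^+ a.-1 * (rho - r) * r ^+ b by ring.
  by apply: ler_pM; rewrite ?exprn_ge0 // !mulr_ge0 ?exprn_ge0 // ltW.
have -> : b%:R * (r ^+ a * (r ^+ b.-1 * (rho - r))) = r ^+ a * (b%:R * r ^+ b.-1 * (rho - r)) by ring.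
by apply: ler_pM; rewrite ?exprn_ge0 // !mulr_ge0 ?exprn_ge0 // ltW.
Qed.

Lemma bideriv_comm i j P h :
  bieval (bideriv i (bideriv j P)) h = bieval (bideriv j (bideriv i P)) h.
Proof.
rewrite /bieval !big_map; apply: eq_bigr => -[c [a b]] _ /=.
by case: ifP => hi; case: ifP => hj /=; rewrite ?hi ?hj /=; ring.
Qed.

(** With A and B the remainders of the two factors and C the increment of the
    second one, the remainder of the product is
    A y2^b + x1^a B + a x1^(a-1) (y1 - x1) C. *)
Lemma mono_taylor (a b : nat) (x1 y1 x2 y2 r rho K : R) :
  `|x1| <= r -> `|y1| <= r -> `|x2| <= r -> `|y2| <= r -> r < rho ->
  `|y1 - x1| <= K -> `|y2 - x2| <= K ->
  `|y1 ^+ a * y2 ^+ b - x1 ^+ a * x2 ^+ b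
    - (a%:R * x1 ^+ a.-1 * x2 ^+ b * (y1 - x1)
       + b%:R * x1 ^+ a * x2 ^+ b.-1 * (y2 - x2))|
  <= 3 * K ^+ 2 / (rho - r) ^+ 2 * (rho ^+ a * rho ^+ b).
Proof.
move=> hx1 hy1 hx2 hy2 rrho k1 k2.
have r0 : 0 <= r := le_trans (normr_ge0 _) hx1.
have rho0 : 0 <= rho by apply: le_trans r0 (ltW rrho).
have d0 : 0 < rho - r by rewrite subr_gt0.
have K0 : 0 <= K := le_trans (normr_ge0 _) k1.
have T1 := pow_taylor a hx1 hy1 (ltW rrho).
have T2 := pow_taylor b hx2 hy2 (ltW rrho).
have L2 := pow_lip b hx2 hy2 (ltW rrho).
have D1 := pow_deriv_le a r0 (ltW rrho).
set A := (_ - _ - _ : R) in T1; set B := (_ - _ - _ : R) in T2.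
set C := (_ - _ : R) in L2.
have -> : y1 ^+ a * y2 ^+ b - x1 ^+ a * x2 ^+ b
    - (a%:R * x1 ^+ a.-1 * x2 ^+ b * (y1 - x1)
       + b%:R * x1 ^+ a * x2 ^+ b.-1 * (y2 - x2)) =
   A * y2 ^+ b + x1 ^+ a * B + a%:R * x1 ^+ a.-1 * (y1 - x1) * C.
  by rewrite /A /B /C; ring.
have Y n x : `|x| <= r -> `|x| ^+ n <= rho ^+ n.
  by move=> hx; rewrite lerXn2r ?nnegrE // (le_trans hx) // ltW.
have rn n : 0 <= rho ^+ n by exact: exprn_ge0.
have sqK x : `|x| <= K -> `|x| ^+ 2 <= K ^+ 2.
  by move=> hx; rewrite lerXn2r ?nnegrE.
have bA : `|A| <= K ^+ 2 * rho ^+ a / (rho - r) ^+ 2.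
  rewrite ler_pdivlMr ?exprn_gt0 //; apply: (le_trans T1).
  by apply: ler_wpM2r => //; exact: sqK.
have bB : `|B| <= K ^+ 2 * rho ^+ b / (rho - r) ^+ 2.
  rewrite ler_pdivlMr ?exprn_gt0 //; apply: (le_trans T2).
  by apply: ler_wpM2r => //; exact: sqK.
have bC : `|C| <= K * rho ^+ b / (rho - r).
  rewrite ler_pdivlMr //; apply: (le_trans L2); exact: ler_wpM2r.
have bD : a%:R * r ^+ a.-1 <= rho ^+ a / (rho - r) by rewrite ler_pdivlMr.
have -> : 3 * K ^+ 2 / (rho - r) ^+ 2 * (rho ^+ a * rho ^+ b) =
   K ^+ 2 * rho ^+ a / (rho - r) ^+ 2 * rho ^+ b
   + rho ^+ a * (K ^+ 2 * rho ^+ b / (rho - r) ^+ 2)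
   + rho ^+ a / (rho - r) * K * (K * rho ^+ b / (rho - r)).
  by field; rewrite subr_eq0 gt_eqF.
apply: (le_trans (ler_normD _ _)); apply: lerD.
  apply: (le_trans (ler_normD _ _)); rewrite !normrM !normrX; apply: lerD.
    by apply: ler_pM => //; exact: Y.
  by apply: ler_pM => //; exact: Y.
rewrite !normrM normrX normr_nat; apply: ler_pM => //.
apply: ler_pM => //; apply: le_trans bD; apply: ler_wpM2l => //.
by rewrite lerXn2r ?nnegrE.
Qed.

(** The remainder is controlled by the majorant norm alone, hence uniformly over
    a family of polynomials of bounded norm. *)
Lemma bieval_taylor P h k r rho : `|h| <= r -> `|h + k| <= r -> r < rho ->
  `|bieval P (h + k) - bieval P h
    - (k 0 0 * bieval (bideriv 0 P) h + k 0 1 * bieval (bideriv 1 P) h)|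
  <= 3 * `|k| ^+ 2 / (rho - r) ^+ 2 * binorm P rho.
Proof.
move=> hr hkr rrho.
rewrite /bieval !big_map !mulr_sumr /= -big_split /= -!sumrB.
apply: (le_trans (ler_norm_sum _ _ _)).
apply: ler_sum => -[c [a b]] _ /=.
rewrite [leRHS]mulrCA.
have -> : c * ((h + k) 0 0 ^+ a * (h + k) 0 1 ^+ b) -
   c * (h 0 0 ^+ a * h 0 1 ^+ b) -
   (k 0 0 * (c * a%:R * (h 0 0 ^+ a.-1 * h 0 1 ^+ b)) +
    k 0 1 * (c * b%:R * (h 0 0 ^+ a * h 0 1 ^+ b.-1))) =
   c * ((h + k) 0 0 ^+ a * (h + k) 0 1 ^+ b - h 0 0 ^+ a * h 0 1 ^+ b
    - (a%:R * h 0 0 ^+ a.-1 * h 0 1 ^+ b * ((h + k) 0 0 - h 0 0)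
       + b%:R * h 0 0 ^+ a * h 0 1 ^+ b.-1 * ((h + k) 0 1 - h 0 1))).
  by rewrite !mxE; ring.
rewrite normrM; apply: ler_wpM2l => //.
by apply: mono_taylor => //; rewrite ?(le_trans (coord_le _ _)) // !mxE addrAC subrr add0r coord_le.
Qed.

End Monomials.

(** * Analytic functions of two variables *)

Section Calc.
Variable R : realType.

Lemma is_diff_littleo (V W : normedModType R) (f : V -> W) (df : {linear V -> W}) x :
  continuous df ->
  (forall e : R, 0 < e -> \forall k \near (0 : V), `|f (x + k) - f x - df k| <= e * `|k|) ->
  differentiable f x /\ 'd f x = df :> (V -> W).
Proof.
move=> cdf H.
have E : f \o shift x = cst (f x) + df +o_ 0 id.
  apply/eqaddoP => e e0; have := H _ e0.
  apply: filterS => k h; change (`|f (k + x) - (f x + df k)| <= e * `|k|); by rewrite (addrC k) opprD addrA.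
have D := diff_unique cdf E; split=> //.
by apply/diff_locallyP; rewrite D.
Qed.

Lemma differentiable_littleo (V W : normedModType R) (f : V -> W) x (e : R) :
  differentiable f x -> 0 < e ->
  \forall k \near (0 : V), `|f (x + k) - f x - 'd f x k| <= e * `|k|.
Proof.
move=> /diff_locally E e0; move: E => /eqaddoP /(_ e e0).
apply: filterS => k h.
change (is_true (`|f (k + x) - (f x + 'd f x k)| <= e * `|k|)) in h.
by rewrite (addrC x) -addrA -opprD.
Qed.

Lemma cvg_norm_le (u : nat -> R) (l c : R) :
  u @ \oo --> l -> (forall n, `|u n| <= c) -> `|l| <= c.
Proof.
by move=> ul H; apply: (cvgr_to_le (cvg_norm ul)); exact: nearW.
Qed.

(** A uniform limit of convergent sequences is Cauchy. *)
Lemma cvg_approx (u : nat -> R) :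
  (forall e : R, 0 < e -> exists2 v : nat -> R, cvgn v & forall n, `|u n - v n| <= e) ->
  cvgn u.
Proof.
move=> H; apply/cauchy_cvgP/cauchy_exP => e e0.
have e2 : 0 < e / 2 by rewrite divr_gt0.
have [v /cvg_ex[l vl] uv] := H _ e2; exists l.
have {}vl : \forall n \near \oo, `|l - v n| < e / 2.
  by move/cvgrPdist_lt : vl; apply.
suff: \forall n \near \oo, `|l - u n| < e by [].
near=> n.
have -> : l - u n = (l - v n) - (u n - v n) by ring.
apply: (le_lt_trans (ler_normB _ _)); rewrite [ltRHS](splitr e).
by apply: ltr_leD => //; near: n.
Unshelve. all: by end_near. Qed.

End Calc.

Section Majorized.
Variable R : realType.
Implicit Types (p h k : 'rV[R]_2) (r rho M : R) (f g : 'rV[R]_2 -> R).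

(** f is a limit, on the ball of radius rho about p, of polynomials whose majorant
    norms stay below M. This class contains the sums of power series, is stable
    under products and derivatives by inequalities between norms, and never asks
    for a rearrangement of a double series. *)
Definition majorized f p rho M := exists L : nat -> bipoly R,
  (forall n, binorm (L n) rho <= M) /\
  forall h, `|h| < rho -> (fun n => bieval (L n) h) @ \oo --> f (p + h).

Lemma majorized_bound f p rho M h : majorized f p rho M -> `|h| < rho ->
  `|f (p + h)| <= M.
Proof.
move=> [L [LM Lf]] hr; apply: cvg_norm_le (Lf _ hr) _ => n.
by apply: le_trans (LM n); apply: bieval_le; exact: ltW.
Qed.

Lemma majorized_sub f p rho r M K : 0 <= r -> r <= rho -> M <= K ->
  majorized f p rho M -> majorized f p r K.
Proof.
move=> r0 rrho MK [L [LM Lf]]; exists L; split=> [n|h hr].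
  by apply: le_trans MK; apply: le_trans (LM n); exact: binorm_le.
by apply: Lf; exact: lt_le_trans hr rrho.
Qed.

Lemma majorized_eq f g p rho M : (forall h, `|h| < rho -> f (p + h) = g (p + h)) ->
  majorized f p rho M -> majorized g p rho M.
Proof.
by move=> fg [L [LM Lf]]; exists L; split=> // h hr; rewrite -fg //; exact: Lf.
Qed.

Lemma majorized_cst (c : R) p rho : majorized (fun=> c) p rho `|c|.
Proof.
exists (fun=> [:: (c, (0%N, 0%N))]); split=> [n|h _].
  by rewrite /binorm big_seq1 /= !mulr1.
by under eq_fun do rewrite /bieval big_seq1 /= !mulr1; exact: cvg_cst.
Qed.

Lemma majorizedD f g p rho M K : majorized f p rho M -> majorized g p rho K ->
  majorized (fun q => f q + g q) p rho (M + K).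
Proof.
move=> [L [LM Lf]] [L' [LK Lg]]; exists (fun n => L n ++ L' n); split=> [n|h hr].
  by rewrite binorm_cat lerD.
by under eq_fun do rewrite bieval_cat; apply: cvgD; [exact: Lf|exact: Lg].
Qed.

Lemma majorizedM f g p rho M K : 0 <= rho -> majorized f p rho M -> majorized g p rho K ->
  majorized (fun q => f q * g q) p rho (M * K).
Proof.
move=> rho0 [L [LM Lf]] [L' [LK Lg]]; exists (fun n => bimul (L n) (L' n)); split=> [n|h hr].
  by rewrite binorm_mul ler_pM // binorm_ge0.
by under eq_fun do rewrite bieval_mul; apply: cvgM; [exact: Lf|exact: Lg].
Qed.

Lemma majorized_ge0 f p rho M : 0 < rho -> majorized f p rho M -> 0 <= M.
Proof.
move=> rho0 /majorized_bound H; apply: le_trans (H 0 _); rewrite ?normr0 //.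
Qed.

Definition linform (l : 'I_2 -> R) (k : 'rV[R]_2) : R := k 0 0 * l 0 + k 0 1 * l 1.

Lemma linform_linear l : linear (linform l).
Proof. by move=> a u v; rewrite /linform !mxE /GRing.scale /=; ring. Qed.

HB.instance Definition _ l := GRing.isLinear.Build R 'rV[R]_2 R _ (linform l) (linform_linear l).

Lemma linform_continuous l : continuous (linform l).
Proof.
have c (j : 'I_2) (a : R) : continuous (fun k : 'rV[R]_2 => k 0 j * a).
  move=> y; apply: (@continuous_comp _ _ _ (fun k : 'rV[R]_2 => k 0 j) ( *%R^~ a)).
    exact: coord_continuous.
  exact: mulrr_continuous.
move=> x; exact: (@continuousD _ _ _ _ _ _ (c 0 (l 0) x) (c 1 (l 1) x)).
Qed.

Lemma linform_delta l i : linform l (delta_mx 0 i) = l i.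
Proof.
rewrite /linform !mxE !eqxx /=.
by case: i => -[|[|//]] ilt /=; rewrite ?mul1r ?mul0r ?addr0 ?add0r; congr l; apply: val_inj.
Qed.

(** A difference quotient of the polynomials approximates their derivative
    uniformly in the index by the uniform Taylor bound, so the derivatives
    converge; the same bound in the limit makes f differentiable. *)
Lemma majorized_diff f p rho (L : nat -> bipoly R) M :
  (forall n, binorm (L n) rho <= M) ->
  (forall h, `|h| < rho -> (fun n => bieval (L n) h) @ \oo --> f (p + h)) ->
  forall h, `|h| < rho -> differentiable f (p + h) /\
  forall i, (fun n => bieval (bideriv i (L n)) h) @ \oo --> partial i f (p + h).
Proof.
move=> LM Lf h hrho.
pose r : R := (`|h| + rho) / 2.
have hr : `|h| < r by rewrite /r midf_lt.
have rrho : r < rho by rewrite /r midf_lt.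
have d0 : 0 < rho - r by rewrite subr_gt0.
have M0 : 0 <= M.
  by apply: le_trans (LM 0%N); rewrite binorm_ge0 // (le_trans (normr_ge0 h)) // ltW.
pose C := 3 / (rho - r) ^+ 2 * M.
have C0 : 0 <= C by rewrite mulr_ge0 // divr_ge0 // exprn_ge0 // ltW.
have T n k : `|k| < r - `|h| ->
  `|bieval (L n) (h + k) - bieval (L n) h
    - linform (fun i => bieval (bideriv i (L n)) h) k| <= C * `|k| ^+ 2.
  move=> kr; have hkr : `|h + k| <= r.
    by apply: (le_trans (ler_normD _ _)); rewrite addrC -lerBrDr ltW.
  apply: (le_trans (bieval_taylor _ (ltW hr) hkr rrho)).
  have -> : C * `|k| ^+ 2 = 3 * `|k| ^+ 2 / (rho - r) ^+ 2 * M by rewrite /C; ring.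
  apply: ler_wpM2l; last exact: LM. apply: divr_ge0; last exact: sqr_ge0. by apply: mulr_ge0; [exact: ler0n|exact: sqr_ge0].
have ex i : cvgn (fun n => bieval (bideriv i (L n)) h).
  apply: cvg_approx => e e0.
  pose t := Num.min ((r - `|h|) / 2) (e / (C + 1)).
  have C1 : 0 < C + 1 by rewrite ltr_wpDl.
  have t0 : 0 < t by rewrite lt_min !divr_gt0 // subr_gt0.
  have nd : `|delta_mx 0 i : 'rV[R]_2| = 1.
    apply/eqP; rewrite eq_le; apply/andP; split; last first.
      by apply: le_trans (coord_le _ i); rewrite mxE !eqxx normr1.
    rewrite /Num.norm /= mx_normrE; apply: bigmax_le; first exact: ler01. move=> -[a b] _ /=.
    by rewrite mxE; case: (_ && _); rewrite ?normr1 ?normr0 ?ler01.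
  have nt : `|t *: delta_mx 0 i : 'rV[R]_2| = t.
    by rewrite normrZ nd mulr1 gtr0_norm.
  have tr : t < r - `|h|.
    by apply: (@le_lt_trans _ _ ((r - `|h|) / 2)); rewrite ?ge_min ?lexx // ltr_pdivrMr // ltr_pMr ?subr_gt0 // ltr1n.
  exists (fun n => t^-1 * (bieval (L n) (h + t *: delta_mx 0 i) - bieval (L n) h)).
    apply: is_cvgMl_tmp; apply: is_cvgB; apply/cvg_ex; eexists; apply: Lf => //.
    apply: (le_lt_trans (ler_normD _ _)); rewrite nt.
    by apply: lt_trans rrho; rewrite addrC -ltrBrDr.
  move=> n; have := T n (t *: delta_mx 0 i); rewrite nt => /(_ tr).
  rewrite linearZ /= linform_delta => Hn.
  rewrite distrC -(@ler_pM2l _ t) // -{1}(gtr0_norm t0) -normrM mulrBr mulVKf ?gt_eqF //.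
  apply: (le_trans Hn); rewrite expr2 mulrCA ler_pM2l //.
  apply: (@le_trans _ _ (C * (e / (C + 1)))).
    by apply: ler_wpM2l => //; rewrite ge_min lexx orbT.
  by rewrite mulrCA ger_pMr // ler_pdivrMr // mul1r lerDl.
pose l i := lim ((fun n => bieval (bideriv i (L n)) h) @ \oo).
have Q k : `|k| < r - `|h| -> `|f (p + h + k) - f (p + h) - linform l k| <= C * `|k| ^+ 2.
  move=> kr; apply: cvg_norm_le (fun n => T n k kr).
  apply: cvgB; last first.
    by apply: cvgD; apply: cvgMl_tmp; exact: ex.
  apply: cvgB; last exact: Lf.
  rewrite -addrA; apply: Lf; apply: (le_lt_trans (ler_normD _ _)).
  by apply: lt_trans rrho; rewrite addrC -ltrBrDr.
have [D E] : differentiable f (p + h) /\ 'd f (p + h) = linform l :> (_ -> _).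
  apply: is_diff_littleo; first exact: linform_continuous.
  move=> e e0; have C1 : 0 < C + 1 by rewrite ltr_wpDl.
  have H1 : 0 < e / (C + 1) by exact: divr_gt0.
  have H0 : (0 : R) < r - `|h| by rewrite subr_gt0.
  near=> k; apply: (le_trans (Q k _)).
    by near: k; exact: (@nbhs0_lt R 'rV[R]_2 _ H0).
  rewrite expr2 mulrA; apply: ler_wpM2r => //.
  apply: (@le_trans _ _ (C * (e / (C + 1)))).
    apply: ler_wpM2l => //; near: k; exact: (@nbhs0_le R 'rV[R]_2 _ H1).
  by rewrite mulrCA ger_pMr // ler_pdivrMr // mul1r lerDl.
split=> // i; rewrite /partial deriveE // E linform_delta; exact: ex.
Unshelve. all: by end_near. Qed.

End Majorized.

Section Analytic.
Variable R : realType.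
Implicit Types (p h k : 'rV[R]_2) (r rho M : R) (f g : 'rV[R]_2 -> R).

Lemma majorized_deriv f p rho r M i : 0 <= r -> r < rho ->
  majorized f p rho M -> majorized (partial i f) p r (M / (rho - r)).
Proof.
move=> r0 rrho [L [LM Lf]]; exists (fun n => bideriv i (L n)); split=> [n|h hr].
  apply: (le_trans (binorm_deriv i _ r0 rrho)).
  by rewrite ler_pM2r // invr_gt0 subr_gt0.
exact: (majorized_diff LM Lf (lt_trans hr rrho)).2.
Qed.

Lemma majorized_differentiable f p rho M h : majorized f p rho M -> `|h| < rho ->
  differentiable f (p + h).
Proof. by move=> [L [LM Lf]] hr; exact: (majorized_diff LM Lf hr).1. Qed.

Definition analytic f p := exists rho M, 0 < rho /\ majorized f p rho M.

Lemma analytic_partial f p i : analytic f p -> analytic (partial i f) p.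
Proof.
move=> [rho [M [rho0 fM]]]; exists (rho / 2), (M / (rho - rho / 2)); split.
  exact: divr_gt0.
by apply: majorized_deriv fM; lra.
Qed.

Lemma analytic_differentiable f p : analytic f p -> differentiable f p.
Proof.
move=> [rho [M [rho0 fM]]]; rewrite -[p]addr0.
by apply: majorized_differentiable fM _; rewrite normr0.
Qed.

Lemma analytic_continuous f p : analytic f p -> {for p, continuous f}.
Proof. by move=> /analytic_differentiable/differentiable_continuous. Qed.

(** Mixed partials commute for polynomials, and both orders are limits of the
    corresponding polynomial derivatives. *)
Lemma partialC f p i j : analytic f p ->
  partial i (partial j f) p = partial j (partial i f) p.
Proof.
move=> [rho [M [rho0 [L [LM Lf]]]]].
have D (a b : 'I_2) :
  (fun n => bieval (bideriv a (bideriv b (L n))) 0) @ \oo --> partial a (partial b f) p.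
  rewrite -[p]addr0; apply: (majorized_diff (rho := rho / 2)
      (L := fun n => bideriv b (L n)) (M := M / (rho - rho / 2)) _ _ _).2.
  - move=> n; have h0 : 0 <= rho / 2 by lra.
    have h1 : rho / 2 < rho by lra.
    apply: (le_trans (binorm_deriv b (L n) h0 h1)).
    by rewrite ler_pM2r // invr_gt0 subr_gt0.
  - move=> h hr; apply: (majorized_diff LM Lf _).2.
    by apply: lt_trans hr _; lra.
  - by rewrite normr0 divr_gt0.
have : (fun n => bieval (bideriv i (bideriv j (L n))) 0) @ \oo --> partial j (partial i f) p.
  by under eq_fun do rewrite bideriv_comm; exact: D.
exact: cvg_unique (D i j).
Qed.

Lemma analytic_cst (c : R) p : analytic (fun=> c) p.
Proof. by exists 1, `|c|; split; [exact: ltr01|exact: majorized_cst]. Qed.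

Lemma analyticD f g p : analytic f p -> analytic g p -> analytic (fun q => f q + g q) p.
Proof.
move=> [r [M [r0 fM]]] [s [K [s0 gK]]].
have m0 : 0 < Num.min r s by rewrite lt_min r0.
have mr : Num.min r s <= r by rewrite ge_min lexx.
have ms : Num.min r s <= s by rewrite ge_min lexx orbT.
exists (Num.min r s), (M + K); split => //.
by apply: majorizedD; [exact: majorized_sub (ltW m0) mr _ fM|exact: majorized_sub (ltW m0) ms _ gK].
Qed.

Lemma analyticM f g p : analytic f p -> analytic g p -> analytic (fun q => f q * g q) p.
Proof.
move=> [r [M [r0 fM]]] [s [K [s0 gK]]].
have m0 : 0 < Num.min r s by rewrite lt_min r0.
have mr : Num.min r s <= r by rewrite ge_min lexx.
have ms : Num.min r s <= s by rewrite ge_min lexx orbT.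
exists (Num.min r s), (M * K); split => //.
by apply: majorizedM (ltW m0) _ _;
  [exact: majorized_sub (ltW m0) mr _ fM|exact: majorized_sub (ltW m0) ms _ gK].
Qed.

Lemma analyticN f p : analytic f p -> analytic (fun q => - f q) p.
Proof.
move=> fa; have := analyticM (analytic_cst (-1) p) fa.
by under eq_fun do rewrite mulN1r.
Qed.

Lemma analyticB f g p : analytic f p -> analytic g p -> analytic (fun q => f q - g q) p.
Proof. by move=> fa /analyticN; exact: analyticD. Qed.

Lemma analytic_sum n (f : 'I_n -> 'rV[R]_2 -> R) p :
  (forall i, analytic (f i) p) -> analytic (fun q => \sum_(i < n) f i q) p.
Proof.
elim: n f => [|n IH] f H.
  by under eq_fun do rewrite big_ord0; exact: analytic_cst.
by under eq_fun do rewrite big_ord_recl; apply: analyticD; [exact: H|apply: IH].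
Qed.

(** The square partial sums have majorant norm at most the sum of the absolute
    series at the point (rho, rho), which converges for small rho. *)
Lemma analytic_atP m (f : 'rV[R]_2 -> 'rV[R]_m) p :
  analytic_at f p -> forall k : 'I_m, analytic (fun q => f q 0 k) p.
Proof.
move=> H k; have [c Hc] := H k.
have [e /= e0 He] : exists2 e : R, 0 < e & forall h : 'rV[R]_2, `|h| < e ->
    power_series2_sum c h (f (p + h) 0 k).
  move/nbhs_ballP : Hc => [e e0 He]; exists e => // h hr.
  have := He (p + h); rewrite /= addrAC subrr add0r; apply.
  by rewrite -ball_normE /= opprD addrA subrr sub0r normrN.
pose rho := e / 2.
pose hh : 'rV[R]_2 := const_mx rho.
have nh : `|hh| < e.
  rewrite /Num.norm /= mx_normrE; apply: (@le_lt_trans _ _ rho); last by rewrite /rho; lra.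
  apply: bigmax_le; first by rewrite /rho; lra.
  by move=> ij _; rewrite mxE ger0_norm // /rho; lra.
have iotaE n : iota 0 n = index_iota 0 n by rewrite /index_iota subn0.
pose L n : bipoly R := [seq (c i j, (i, j)) | i <- iota 0 n, j <- iota 0 n].
have LE n h : bieval (L n) h =
    \sum_(i < n) \sum_(j < n) c i j * h 0 0 ^+ i * h 0 1 ^+ j.
  rewrite /bieval /L big_allpairs_dep /= iotaE big_mkord.
  apply: eq_bigr => i _; rewrite big_mkord.
  by apply: eq_bigr => j _; rewrite mulrA.
have [cv _] := He _ nh.
exists rho, (lim ((fun n => \sum_(i < n) \sum_(j < n) `|c i j * hh 0 0 ^+ i * hh 0 1 ^+ j|) @ \oo)).
split; first by rewrite /rho; lra.
exists L; split=> [n|h hr]; last first.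
  by under eq_fun do rewrite LE; apply: (He h _).2; apply: lt_trans hr _; rewrite /rho; lra.
set u := (u in lim (u @ \oo)) in cv *.
have -> : binorm (L n) rho = u n.
  rewrite /binorm /L big_allpairs_dep /= iotaE big_mkord.
  apply: eq_bigr => i _; rewrite big_mkord.
  have r0 : 0 <= rho by rewrite /rho; lra.
  by apply: eq_bigr => j _; rewrite !mxE !normrM !normrX (ger0_norm r0) mulrA.
apply: nondecreasing_cvgn_le => // a b ab; rewrite /u.
rewrite -!(big_mkord xpredT (fun i => \sum_(j < _) `|c i j * hh 0 0 ^+ i * hh 0 1 ^+ j|)).
rewrite (@big_cat_nat _ _ _ a 0 b) //= -[leLHS]addr0.
apply: lerD; last by apply: sumr_ge0 => i _; exact: sumr_ge0.
apply: ler_sum => i _.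
rewrite -!(big_mkord xpredT (fun j => `|c i j * hh 0 0 ^+ i * hh 0 1 ^+ j|)).
by rewrite (@big_cat_nat _ _ _ a 0 b) //= lerDl sumr_ge0.
Qed.

(** Up to errors tending to 0, each step halves the distance to l. *)
Lemma cvg_contraction (u d : nat -> R) (l : R) :
  d @ \oo --> 0 -> (forall n, `|u n.+1 - l| <= d n + 2^-1 * `|u n - l|) ->
  u @ \oo --> l.
Proof.
move=> d0 H; apply/cvgrPdist_le => e e0.
have e4 : 0 < e / 4 by rewrite divr_gt0.
have [N _ HN] : \forall n \near \oo, `|d n| <= e / 4.
  by move/cvgr0_norm_le : d0; apply.
have K j : `|u (N + j)%N - l| <= e / 2 + 2^-1 ^+ j * `|u N - l|.
  elim: j => [|j IH]; first by rewrite addn0 expr0 mul1r lerDr; lra.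
  rewrite addnS; apply: (le_trans (H _)).
  have := HN (N + j)%N (leq_addr _ _); rewrite ler_norml => /andP[_ dN].
  rewrite exprS -mulrA; set A := _ ^+ j * _ in IH *; lra.
have : (fun j => 2^-1 ^+ j * `|u N - l|) @ \oo --> (0 * `|u N - l| : R).
  apply: cvgMr_tmp; apply: cvg_expr; rewrite ger0_norm; lra.
rewrite mul0r => /cvgr0_norm_le /(_ _ (divr_gt0 e0 (ltr0Sn _ 1))) [k0 _ Hk].
exists (N + k0)%N => // n /= Nn.
have E : n = (N + (n - N))%N by rewrite subnKC // (leq_trans (leq_addr _ _) Nn).
have := K (n - N)%N; rewrite -E distrC => /le_trans; apply.
have := Hk (n - N)%N; rewrite /= leq_subRL; last exact: leq_trans (leq_addr _ _) Nn.
move=> /(_ Nn); rewrite ler_norml => /andP[_]; lra.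
Qed.

(** Removing the constant term gains a factor r / rho in the majorant norm when
    the radius shrinks; this makes a function close to 1 small in norm. *)
Definition bistrip (P : bipoly R) : bipoly R := [seq m <- P | (0 < m.2.1 + m.2.2)%N].

Lemma bistripE (P : bipoly R) h : bieval P h = bieval P 0 + bieval (bistrip P) h.
Proof.
rewrite /bieval /bistrip big_filter [X in _ + X]big_mkcond -big_split /=.
apply: eq_bigr => -[c [a b]] _ /=; rewrite !mxE.
case: a b => [|a] [|b] /=; rewrite ?addn0 ?addnS ?exprS ?expr0 ?mul0r ?mulr0 ?add0r ?addr0 //.
Qed.

Lemma binorm_strip (P : bipoly R) r rho : 0 <= r -> r <= rho -> 0 < rho ->
  binorm (bistrip P) r <= r / rho * binorm P rho.
Proof.
move=> r0 rrho rho0; rewrite /binorm /bistrip big_filter big_mkcond mulr_sumr.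
apply: ler_sum => -[c [a b]] _ /=.
have rho0' := ltW rho0.
have P0 : 0 <= r / rho * (`|c| * (rho ^+ a * rho ^+ b)).
  by rewrite mulr_ge0 ?divr_ge0 // mulr_ge0 // mulr_ge0 // exprn_ge0.
have X n : r ^+ n <= rho ^+ n by rewrite lerXn2r ?nnegrE.
case: ifP => // ab; rewrite [leRHS]mulrCA; apply: ler_wpM2l => //.
rewrite -!exprD; case: (a + b)%N ab => // n _.
rewrite !exprS mulrA divfK ?gt_eqF //; exact: ler_wpM2l.
Qed.

(** After scaling f to be 1 - x with x small, w = (1 - x)^(-1/2) - 1 is the fixed
    point of w |-> (x (1 + w)^2 - w^2) / 2, a contraction by a factor one half
    on the ball of radius 1/4. Iterating the same map on the approximating
    polynomials, with the n-th approximation of x at step n, keeps the majorant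
    norm below 1/4 and converges pointwise to w. *)
Lemma analytic_invsqrt f p : analytic f p -> 0 < f p ->
  analytic (fun q => (Num.sqrt (f q))^-1) p.
Proof.
move=> [rho [M [rho0 fM]]] f0.
have M0 := majorized_ge0 rho0 fM.
case: fM => L [LM Lf].
pose s : R := (f p)^-1.
have s0 : 0 < s by rewrite invr_gt0.
(* small enough for s times the nonconstant part of f to have norm at most 1/16 *)
pose r := Num.min rho (rho / (16 * (s * M + 1))).
have sM0 : 0 < s * M + 1 by rewrite ltr_wpDl // mulr_ge0 // ltW.
have r0 : 0 < r by rewrite lt_min rho0 divr_gt0 // mulr_gt0.
have rrho : r <= rho by rewrite ge_min lexx.
have r16 : r / rho * M * s <= 16^-1.
  have h1 : r / rho <= (16 * (s * M + 1))^-1.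
    by rewrite ler_pdivrMr // mulrC ge_min lexx orbT.
  apply: (@le_trans _ _ ((16 * (s * M + 1))^-1 * (s * M))).
    by rewrite -mulrA (mulrC M) ler_wpM2r // mulr_ge0 // ltW.
  by rewrite invfM -mulrA ger_pMr // mulrC ler_pdivrMr // mul1r lerDl.
have L0 : (fun n => bieval (L n) 0) @ \oo --> f p.
  by rewrite -[X in f X]addr0; apply: Lf; rewrite normr0.
have [N _ HN] : \forall n \near \oo, `|1 - s * bieval (L n) 0| <= 16^-1.
  have : (fun n => 1 - s * bieval (L n) 0) @ \oo --> 1 - s * f p.
    by apply: cvgB; [exact: cvg_cst|exact: cvgMl_tmp].
  rewrite /s mulVf ?gt_eqF // subrr => /cvgr0_norm_le; apply.
  by rewrite invr_gt0.
pose C (c : R) : bipoly R := [:: (c, (0%N, 0%N))].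
have CE c h : bieval (C c) h = c by rewrite /bieval big_seq1 /= !mulr1.
have CN c t : binorm (C c) t = `|c| by rewrite /binorm big_seq1 /= !mulr1.
(* X n approximates 1 - s f; the shift by N makes its constant term small too *)
pose X n : bipoly R := C (1 - s * bieval (L (N + n)%N) 0) ++ bimul (C (- s)) (bistrip (L (N + n)%N)).
have XE n h : bieval (X n) h = 1 - s * bieval (L (N + n)%N) h.
  rewrite bieval_cat bieval_mul !CE (bistripE (L (N + n)%N) h); ring.
have XN n : binorm (X n) r <= 8^-1.
  rewrite binorm_cat binorm_mul !CN normrN (gtr0_norm s0).
  have h1 := HN (N + n)%N (leq_addr _ _).
  have h2 := binorm_strip (L (N + n)%N) (ltW r0) rrho rho0.
  have h3 : s * binorm (bistrip (L (N + n)%N)) r <= 16^-1.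
    apply: le_trans r16; rewrite mulrC ler_pM2r //; apply: (le_trans h2).
    by apply: ler_wpM2l; [rewrite divr_ge0 // ltW|exact: LM].
  rewrite /= in h1; lra.
pose step (Y W : bipoly R) : bipoly R :=
  bimul (C 2^-1) (bimul Y (bimul (C 1 ++ W) (C 1 ++ W)) ++ bimul (C (-1)) (bimul W W)).
pose W := fix W n : bipoly R := if n is n'.+1 then step (X n') (W n') else [::].
have WN n : binorm (W n) r <= 4^-1.
  elim: n => [|n IH]; first by rewrite /= /binorm big_nil; lra.
  rewrite /=; move: (X n) (XN n) => Y YN.
  rewrite /step !(binorm_mul, binorm_cat) !CN normrN !normr1 mul1r.
  rewrite (ger0_norm (x := 2^-1)); last by lra.
  move: (binorm_ge0 Y (ltW r0)) (binorm_ge0 (W n) (ltW r0)).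
  move: (binorm Y r) (binorm (W n) r) YN IH => x w hx hw x0 w0.
  have a1 : (1 + w) * (1 + w) <= 25 / 16 by nra.
  have a2 : x * ((1 + w) * (1 + w)) <= 8^-1 * (25 / 16) by apply: ler_pM => //; nra.
  have a3 : w * w <= 16^-1 by nra.
  lra.
have key : majorized (fun q => (Num.sqrt (s * f q))^-1 - 1) p r 4^-1.
  exists W; split=> // h hr.
  have hrho := lt_le_trans hr rrho.
  pose x := 1 - s * f (p + h).
  have Xx : (fun n => bieval (X n) h) @ \oo --> x.
    under eq_fun do rewrite XE.
    apply: cvgB; first exact: cvg_cst.
    apply: cvgMl_tmp.
    have := Lf h hrho; rewrite -(cvg_shiftn N).
    by apply: cvg_trans; apply: near_eq_cvg; apply: nearW => n; rewrite addnC.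
  have bX n : `|bieval (X n) h| <= 8^-1.
    by apply: le_trans (XN n); apply: bieval_le; exact: ltW.
  have bW n : `|bieval (W n) h| <= 4^-1.
    by apply: le_trans (WN n); apply: bieval_le; exact: ltW.
  have bx : `|x| <= 8^-1 by exact: cvg_norm_le Xx bX.
  set w := (X in _ --> X).
  have sE : Num.sqrt (s * f (p + h)) ^+ 2 = 1 - x.
    rewrite sqr_sqrtr /x; first by ring.
    by move: bx; rewrite /x ler_norml; lra.
  have sp : 0 < Num.sqrt (s * f (p + h)).
    by rewrite sqrtr_gt0; move: bx; rewrite /x ler_norml; lra.
  have wE : (1 + w) ^+ 2 * (1 - x) = 1.
    by rewrite -sE /w addrC subrK -exprMn mulVf ?gt_eqF // expr1n.
  have w1 : 0 < 1 + w by rewrite /w addrC subrK invr_gt0.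
  have bw : `|w| <= 4^-1.
    by move: bx wE w1; rewrite !ler_norml => /andP[? ?] ? ?; apply/andP; split; nra.
  apply: (@cvg_contraction _ (fun n => `|bieval (X n) h - x|)).
    rewrite -(normr0 R); apply: cvg_norm; rewrite -(subrr x).
    by apply: cvgB => //; exact: cvg_cst.
  move=> n; rewrite /=; move: (bX n) (bW n); move: (X n) (W n) => X' W'.
  rewrite /step !(bieval_mul, bieval_cat) !CE.
  set a := bieval X' h; set b := bieval W' h => ba bb.
  have E : 2^-1 * (a * ((1 + b) * (1 + b)) + -1 * (b * b)) - w =
     (a - x) * (2^-1 * (1 + b) ^+ 2) + (b - w) * (2^-1 * (x * (2 + b + w) - (b + w))).
    have {1}-> : w = 2^-1 * (x * ((1 + w) * (1 + w)) - w * w) by lra.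
    by field.
  have b1 : `|2^-1 * (1 + b) ^+ 2| <= 1.
    by move: bb; rewrite !ler_norml => /andP[? ?]; apply/andP; split; nra.
  have b2 : `|2^-1 * (x * (2 + b + w) - (b + w))| <= 2^-1.
    have b3 : `|x * (2 + b + w)| <= 8^-1 * (5 / 2).
      rewrite normrM; apply: ler_pM => //.
      by move: bb bw; rewrite !ler_norml => /andP[? ?] /andP[? ?]; apply/andP; split; lra.
    move: b3; move: (x * (2 + b + w)) => z b3.
    by move: bb bw b3; rewrite !ler_norml => /andP[? ?] /andP[? ?] /andP[? ?]; apply/andP; split; lra.
  rewrite E; apply: (le_trans (ler_normD _ _)).
  rewrite (normrM (a - x)) (normrM (b - w)); apply: lerD.
    by rewrite -[leRHS]mulr1; apply: ler_wpM2l.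
  by rewrite [leRHS]mulrC; apply: ler_wpM2l.
have : analytic (fun q => (Num.sqrt (s * f q))^-1) p.
  exists r, (4^-1 + `|1|); split => //.
  apply: majorized_eq (majorizedD key (majorized_cst 1 p r)) => h _ /=.
  by rewrite subrK.
move=> /(analyticM (analytic_cst (Num.sqrt s) p)) [r' [M' [r'0 H]]].
exists r', M'; split => //; apply: majorized_eq H => h _.
rewrite sqrtrM ?ltW // invfM mulVKf //.
by rewrite gt_eqF // sqrtr_gt0.
Qed.

Lemma analytic_near f g p : (\forall q \near p, f q = g q) -> analytic f p -> analytic g p.
Proof.
move=> /nbhs_ballP[e /= e0 fg] [rho [M [rho0 fM]]].
have m0 : 0 < Num.min rho e by rewrite lt_min rho0.
have mr : Num.min rho e <= rho by rewrite ge_min lexx.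
exists (Num.min rho e), M; split => //.
apply: majorized_eq (majorized_sub (ltW m0) mr (lexx M) fM) => h.
rewrite lt_min => /andP[_ he]; apply: fg.
by rewrite -ball_normE /= opprD addrA subrr sub0r normrN.
Qed.

End Analytic.

(** * One real variable: monotone inverses and primitives *)

Section OneVariable.
Variable R : realType.
Implicit Types (f g : R -> R) (s t a b : R).

Lemma is_derive1_continuous f t d : is_derive t 1 f d -> {for t, continuous f}.
Proof.
by move=> [df _]; apply: differentiable_continuous; exact/derivable1_diffP.
Qed.

Lemma mean_value f f' a b : (forall t, a < t < b -> is_derive t 1 f (f' t)) ->
  forall x y, a < x -> x < y -> y < b -> exists2 c, x < c < y & f y - f x = f' c * (y - x).
Proof.
move=> H x y ax xy yb.
have [c cxy E] : exists2 c, c \in `]x, y[%R & f y - f x = f' c * (y - x).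
  apply: MVT => // [t|].
    rewrite in_itv /= => /andP[xt ty]; apply: H; rewrite (lt_trans ax xt) /=.
    exact: lt_trans ty yb.
  apply: continuous_in_subspaceT => t; rewrite inE /= in_itv /= => /andP[xt ty].
  apply: (@is_derive1_continuous _ _ (f' t)); apply: H.
  by rewrite (lt_le_trans ax xt) (le_lt_trans ty yb).
by exists c => //; rewrite in_itv in cxy.
Qed.

Lemma deriv0_cst f a b : (forall t, a < t < b -> is_derive t 1 f 0) ->
  forall x y, a < x < b -> a < y < b -> f x = f y.
Proof.
move=> H; have K x y : a < x < b -> a < y < b -> x < y -> f x = f y.
  move=> /andP[ax _] /andP[_ yb] xy.
  have [c _] := mean_value H ax xy yb.
  by rewrite mul0r => /subr0_eq.
move=> x y hx hy; have [xy|yx|->//] := ltgtP x y; first exact: K.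
by symmetry; exact: K.
Qed.

Lemma deriv_gt0_mono f f' a b : (forall t, a < t < b -> is_derive t 1 f (f' t)) ->
  (forall t, a < t < b -> 0 < f' t) ->
  forall x y, a < x -> x < y -> y < b -> f x < f y.
Proof.
move=> H P x y ax xy yb; have [c /andP[xc cy] E] := mean_value H ax xy yb.
rewrite -subr_gt0 E mulr_gt0 ?subr_gt0 // P // (lt_trans ax xc) /=.
exact: lt_trans cy yb.
Qed.

Lemma inverse_function f f' t0 e : 0 < e ->
  (forall t, `|t - t0| < e -> is_derive t 1 f (f' t)) ->
  (forall t, `|t - t0| < e -> 0 < f' t) ->
  exists (g : R -> R) (r : R), [/\ 0 < r, g (f t0) = t0,
   forall s, `|s - f t0| < r -> [/\ `|g s - t0| < e, f (g s) = s & is_derive s 1 g (f' (g s))^-1] &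
   forall t, `|t - t0| < e -> `|f t - f t0| < r -> g (f t) = t].
Proof.
move=> e0 H P.
have H' t : t0 - e < t < t0 + e -> is_derive t 1 f (f' t).
  by move=> /andP[? ?]; apply: H; rewrite ltr_norml; apply/andP; split; lra.
have P' t : t0 - e < t < t0 + e -> 0 < f' t.
  by move=> /andP[? ?]; apply: P; rewrite ltr_norml; apply/andP; split; lra.
have mono := deriv_gt0_mono H' P'.
have inj x y : `|x - t0| < e -> `|y - t0| < e -> f x = f y -> x = y.
  rewrite !ltr_norml => /andP[? ?] /andP[? ?] E.
  have [xy|yx|//] := ltgtP x y.
    have : f x < f y by apply: mono; lra.
    by rewrite E ltxx.
  have : f y < f x by apply: mono; lra.
  by rewrite E ltxx.
pose g s := xget t0 [set t | `|t - t0| < e /\ f t = s].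
have gK t : `|t - t0| < e -> g (f t) = t.
  move=> te; rewrite /g; case: xgetP => [u _ [ue uE]|/(_ t)]; first exact: inj.
  by case.
pose lo := t0 - e / 2; pose hi := t0 + e / 2.
have flo : f lo < f t0 by apply: mono; rewrite /lo; lra.
have fhi : f t0 < f hi by apply: mono; rewrite /hi; lra.
pose r := Num.min (f t0 - f lo) (f hi - f t0).
have r0 : 0 < r by rewrite lt_min !subr_gt0 flo fhi.
exists g, r; split => //.
- by apply: gK; rewrite subrr normr0.
- move=> s sr.
  have sin : s \in `[f lo, f hi].
    have r1 : r <= f t0 - f lo by rewrite /r ge_min lexx.
    have r2 : r <= f hi - f t0 by rewrite /r ge_min lexx orbT.
    move: sr; rewrite ltr_norml => /andP[? ?].
    by rewrite in_itv /=; apply/andP; split; lra.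
  have lohi : lo <= hi by rewrite /lo /hi; lra.
  have cf : {within `[lo, hi], continuous f}.
    apply: continuous_in_subspaceT => t; rewrite inE /= in_itv /= /lo /hi => /andP[? ?].
    by apply: (@is_derive1_continuous _ _ (f' t)); apply: H'; apply/andP; split; lra.
  have [t tin tE] := segment_continuous_le_surjective lohi (ltW (lt_trans flo fhi)) cf sin.
  have te : `|t - t0| < e.
    move: tin; rewrite /= in_itv /= /lo /hi => /andP[? ?].
    by rewrite ltr_norml; apply/andP; split; lra.
  rewrite -tE gK //; split => //.
  have nt : \forall u \near t, `|u - t0| < e.
    apply/nbhs_ballP; exists (e - `|t - t0|) => /=; first by rewrite subr_gt0.
    move=> u; rewrite /ball /= => tu.
    have -> : u - t0 = (t - t0) - (t - u) by ring.
    by apply: (le_lt_trans (ler_normB _ _)); rewrite addrC -ltrBrDr.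
  apply: is_derive_inverse.
  + by apply: filterS nt => u; exact: gK.
  + apply: filterS nt => u ue; exact: is_derive1_continuous (H u ue).
  + exact: H.
  + by rewrite gt_eqF // P.
- by move=> t te _; exact: gK.
Qed.

Lemma antiderivative f e : 0 < e -> (forall t, `|t| < e -> {for t, continuous f}) ->
  exists g, forall t, `|t| < e / 2 -> is_derive t 1 g (f t).
Proof.
move=> e0 cf.
pose a := - (e / 2); pose u := e / 2.
have int : (@lebesgue_measure R).-integrable `[a, u] (EFin \o f).
  apply: continuous_compact_integrable; first exact: segment_compact.
  apply: continuous_in_subspaceT => t; rewrite inE /= in_itv /= /a /u => /andP[? ?].
  by apply: cf; rewrite ltr_norml; apply/andP; split; lra.
exists (fun x => \int[lebesgue_measure]_(t in [set` `[a, x]]) (f t))%R => t.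
rewrite ltr_norml => /andP[t1 t2].
have [//||D E] := continuous_FTC1_closed (f := f) (a := a) (x := t) t2 int.
  by apply: cf; rewrite ltr_norml; apply/andP; split; lra.
by apply: (DeriveDef D); rewrite -derive1E.
Qed.

End OneVariable.

(** * Analytic functions of one real variable *)

Section Tame.
Variable R : realType.
Implicit Types (f g : R -> R) (s t a b : R).

(** Real analyticity in terms of derivatives: the sequence D consists of f and its
    successive derivatives, and they grow at most like K^(n+1) n!. *)
Definition tame f s0 := exists (D : nat -> R -> R) (r K : R),
  [/\ 0 < r, 0 <= K, forall s, `|s - s0| < r -> D 0%N s = f s &
   forall n s, `|s - s0| < r -> is_derive s 1 (D n) (D n.+1 s) /\ `|D n s| <= K ^+ n.+1 * n`!%:R].

Lemma near_ball (P : R -> Prop) s0 r : 0 < r -> (forall s, `|s - s0| < r -> P s) ->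
  \forall s \near s0, P s.
Proof.
move=> r0 H; apply/nbhs_ballP; exists r => // s; rewrite /ball /= distrC; exact: H.
Qed.

Lemma ball_near (P : R -> Prop) s0 : (\forall s \near s0, P s) ->
  exists2 r, 0 < r & forall s, `|s - s0| < r -> P s.
Proof.
move=> /nbhs_ballP[r /= r0 H]; exists r => // s sr; apply: H.
by rewrite /ball /= distrC.
Qed.

Lemma tame_near f g s0 : (\forall s \near s0, f s = g s) -> tame f s0 -> tame g s0.
Proof.
move=> /ball_near[e e0 fg] [D [r [K [r0 K0 Df DD]]]].
exists D, (Num.min r e), K; split=> [||s|n s]; rewrite ?lt_min ?r0 // => /andP[sr se].
  by rewrite Df // fg.
exact: DD.
Qed.

Lemma tame_derive f s0 : tame f s0 ->
  exists f', [/\ \forall s \near s0, is_derive (s : R) 1 f (f' s), {for s0, continuous f'} & f' s0 = 'D_1 f s0].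
Proof.
move=> [D [r [K [r0 K0 Df DD]]]].
have H : \forall s \near s0, is_derive (s : R) 1 f (D 1%N s).
  apply: (near_ball r0) => s sr.
  have [H _] := DD 0%N s sr; move: H; apply: near_eq_is_derive.
  apply: (near_ball (r := r - `|s - s0|)); first by rewrite subr_gt0.
  move=> t ts; apply: Df; have -> : t - s0 = (t - s) + (s - s0) by ring.
  by apply: (le_lt_trans (ler_normD _ _)); rewrite -ltrBrDr.
exists (D 1%N); split=> //; last by have := nbhs_singleton H => -[_ ->].
apply: (@is_derive1_continuous _ _ _ (D 2%N s0)).
by apply: (DD 1%N s0 _).1; rewrite subrr normr0.
Qed.

Lemma tameB f g s0 : tame f s0 -> tame g s0 -> tame (fun s => f s - g s) s0.
Proof.
move=> [D [r [K [r0 K0 Df DD]]]] [E [e [M [e0 M0 Eg EE]]]].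
exists (fun n s => D n s - E n s), (Num.min r e), (K + M).
split=> [||s|n s]; rewrite ?lt_min ?r0 ?addr_ge0 // => /andP[sr se].
  by rewrite Df // Eg.
have [HD BD] := DD n s sr; have [HE BE] := EE n s se; split.
  exact: is_deriveB.
apply: (le_trans (ler_normB _ _)).
apply: (@le_trans _ _ ((K ^+ n.+1 + M ^+ n.+1) * n`!%:R)); first by rewrite mulrDl lerD.
apply: ler_wpM2r; first exact: ler0n.
elim: n {HD BD HE BE} => [|n IH]; first by rewrite !expr1.
rewrite (exprS K n.+1) (exprS M n.+1) (exprS (K + M) n.+1).
apply: le_trans (ler_wpM2l _ IH); last by rewrite addr_ge0.
have ? : 0 <= K * M ^+ n.+1 by rewrite mulr_ge0 // exprn_ge0.
have ? : 0 <= M * K ^+ n.+1 by rewrite mulr_ge0 // exprn_ge0.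
rewrite mulrDl !mulrDr; lra.
Qed.

Lemma tame_affine f s0 b e : e ^+ 2 = 1 -> tame f b -> tame (fun s => f (b + e * (s - s0))) s0.
Proof.
move=> e1 [D [r [K [r0 K0 Df DD]]]].
have en : `|e| = 1.
  by apply/eqP; rewrite -sqrp_eq1 // -normrX e1 normr1.
have nE s : `|b + e * (s - s0) - b| = `|s - s0|.
  by rewrite addrC addKr normrM en mul1r.
exists (fun n s => e ^+ n * D n (b + e * (s - s0))), r, K; split => //.
  by move=> s sr; rewrite expr0 mul1r Df // nE.
move=> n s sr; have [] := DD n (b + e * (s - s0)); first by rewrite nE.
move=> HD BD; split; last by rewrite normrM normrX en expr1n mul1r.
have H0 : is_derive s 1 (fun s => b + e * (s - s0)) e.
  apply: is_derive_eq; rewrite /GRing.scale /=; lra.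
have -> : e ^+ n.+1 * D n.+1 (b + e * (s - s0)) = e ^+ n *: (e * D n.+1 (b + e * (s - s0))).
  by rewrite exprS /GRing.scale /=; ring.
apply: is_deriveZ.
have := @is_derive1_comp _ (D n) (fun s => b + e * (s - s0)) s _ _ HD H0.
by rewrite (mulrC e (D _ _)).
Qed.

Lemma is_derive_subX s0 t n :
  is_derive t 1 (fun u => (u - s0) ^+ n.+1) (n.+1%:R * (t - s0) ^+ n).
Proof.
have H0 : is_derive t 1 (fun s => s - s0) 1.
  by apply: is_derive_eq; rewrite subr0.
have := @is_deriveX _ _ (fun s => s - s0) n.+1 t 1 1 H0.
rewrite exprfctE /GRing.scale /= mulr1.
exact.
Qed.

(** Comparison of f and -f with A (s - s0)^(m+1) by the mean value theorem. *)
Lemma deriv_pow_bound f f' A m s0 b : 0 <= A -> f s0 = 0 ->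
  (forall t, s0 - b < t < s0 + b -> is_derive t 1 f (f' t)) ->
  (forall t, s0 < t < s0 + b -> `|f' t| <= A * m.+1%:R * (t - s0) ^+ m) ->
  forall s, s0 <= s < s0 + b -> `|f s| <= A * (s - s0) ^+ m.+1.
Proof.
move=> A0 f0 H B.
have one (h h' : R -> R) : h s0 = 0 ->
    (forall t, s0 - b < t < s0 + b -> is_derive t 1 h (h' t)) ->
    (forall t, s0 < t < s0 + b -> `|h' t| <= A * m.+1%:R * (t - s0) ^+ m) ->
    forall s, s0 <= s < s0 + b -> h s <= A * (s - s0) ^+ m.+1.
  move=> h0 Hh Bh s /andP[]; rewrite le_eqVlt => /orP[/eqP <- _|s0s sb].
    by rewrite h0 subrr expr0n mulr0.
  have G t : s0 - b < t < s0 + b ->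
      is_derive t 1 (fun t => h t - A * (t - s0) ^+ m.+1) (h' t - A * (m.+1%:R * (t - s0) ^+ m)).
    move=> tb; have H1 := Hh t tb; have H2 := is_derive_subX s0 t m.
    exact: (is_deriveB H1 (is_deriveZ A H2)).
  have b0 : s0 - b < s0 by lra.
  have [c /andP[c1 c2] E] := mean_value G b0 s0s sb.
  have : h s - A * (s - s0) ^+ m.+1 <= 0; last by lra.
  have E0 : h s0 - A * (s0 - s0) ^+ m.+1 = 0 by rewrite h0 subrr expr0n mulr0 subrr.
  rewrite -[leLHS]subr0 -{1}E0 E mulr_le0_ge0 ?subr_ge0 ?(ltW s0s) //.
  have := Bh c; rewrite c1 (lt_trans c2 sb) => /(_ isT); rewrite ler_norml => /andP[_].
  by rewrite subr_le0 mulrA.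
move=> s hs; rewrite ler_norml; apply/andP; split; last exact: one f0 H B s hs.
rewrite lerNl; apply: (one (fun s => - f s) (fun s => - f' s)) => // [|t tb|t tb].
- by rewrite f0 oppr0.
- by have HH := H t tb; exact: is_deriveN.
- by rewrite normrN; exact: B.
Qed.

(** If all derivatives vanish at s0, m integrations of the bound on the m-th
    derivative give |f| <= K (K (s - s0))^m, which tends to 0 with m. *)
Lemma tame_zero_right (D : nat -> R -> R) (s0 r K : R) : 0 < r -> 0 <= K ->
  (forall n s, `|s - s0| < r -> is_derive s 1 (D n) (D n.+1 s) /\ `|D n s| <= K ^+ n.+1 * n`!%:R) ->
  (forall n, D n s0 = 0) ->
  forall s, s0 <= s -> s - s0 < r -> K * (s - s0) < 1 -> D 0%N s = 0.
Proof.
move=> r0 K0 DD D0.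
have key m n s : s0 <= s < s0 + r ->
    `|D n s| <= K ^+ (n + m).+1 * ((n + m)`!%:R / m`!%:R) * (s - s0) ^+ m.
  elim: m n s => [|m IH] n s hs.
    rewrite addn0 fact0 divr1 expr0 mulr1; apply: (DD n s _).2.
    by move: hs => /andP[? ?]; rewrite ltr_norml; apply/andP; split; lra.
  apply: (@deriv_pow_bound (D n) (D n.+1) _ m s0 r) => //.
  - by rewrite mulr_ge0 ?exprn_ge0 // divr_ge0.
  - move=> t /andP[t1 t2]; apply: (DD n t _).1.
    by rewrite ltr_norml; apply/andP; split; lra.
  - move=> t /andP[t1 t2]; have := IH n.+1 t; rewrite (ltW t1) t2 => /(_ isT) /le_trans; apply.
    apply: ler_wpM2r; first by rewrite exprn_ge0 // subr_ge0 ltW.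
    rewrite addSn addnS -[X in _ <= X]mulrA. apply: ler_wpM2l; first exact: exprn_ge0.
    rewrite (factS m) natrM -mulrA; apply: ler_wpM2l => //.
    rewrite le_eqVlt; apply/orP; left; apply/eqP.
    by field; rewrite addrC natr1 !pnatr_eq0 -lt0n fact_gt0.
move=> s s0s sr Ks.
have B m : `|D 0%N s| <= K * (K * (s - s0)) ^+ m.
  have := key m 0%N s; rewrite s0s /= -ltrBlDl sr add0n divff ?pnatr_eq0 -?lt0n ?fact_gt0 //.
  by rewrite mulr1 exprS -mulrA -exprMn; apply.
apply/eqP; rewrite -normr_le0.
have L : (fun m => K * (K * (s - s0)) ^+ m) @ \oo --> (K * 0 : R).
  apply: cvgMl_tmp; apply: cvg_expr; rewrite ger0_norm // mulr_ge0 // subr_ge0 //.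
rewrite -[X in _ <= X](mulr0 K).
apply: (cvgr_to_ge L); exact: nearW.
Qed.

(** By continuity all derivatives vanish at the limit point s0 of the open set,
    so the Taylor estimate applies on the right of s0, and on the left after a
    reflection. *)
Lemma tame_zero f s0 (O : set R) : tame f s0 -> open O -> closure O s0 ->
  (forall s, O s -> f s = 0) -> \forall s \near s0, f s = 0.
Proof.
move=> [D [r [K [r0 K0 Df DD]]]] oO cO fO.
have DO n s : O s -> `|s - s0| < r -> D n s = 0.
  elim: n s => [|n IH] s Os sr; first by rewrite Df // fO.
  have [H _] := DD n s sr.
  have Z : \forall t \near s, D n t = 0.
    near=> t; apply: IH; first by near: t; exact: open_nbhs_nbhs.
    near: t; apply: (near_ball (r := r - `|s - s0|)); first by rewrite subr_gt0.
    move=> t ts; have -> : t - s0 = (t - s) + (s - s0) by ring.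
    by apply: (le_lt_trans (ler_normD _ _)); rewrite -ltrBrDr.
  have [_ <-] := H.
  by rewrite (near_eq_derive _ (g := cst 0)) ?derive_cst.
have r00 : `|s0 - s0| < r by rewrite subrr normr0.
have D0 n : D n s0 = 0.
  have cn : {for s0, continuous (D n)} := is_derive1_continuous (DD n s0 r00).1.
  apply/eqP; rewrite -normr_le0; apply/ler_addgt0Pl => e e0; rewrite addr0.
  have [N1 N2] : (\forall s \near s0, `|D n s0 - D n s| < e) /\ \forall s \near s0, `|s - s0| < r.
    by split; [move/cvgrPdist_lt : cn; apply|by apply: (near_ball r0)].
  have [s [Os [s1 s2]]] := cO _ (filterI N1 N2).
  by move: s1; rewrite (DO n s) // subr0 => /ltW.
apply: (near_ball (r := Num.min r (K + 1)^-1)); first by rewrite lt_min r0 invr_gt0 ltr_wpDl.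
move=> s; rewrite lt_min => /andP[sr sK].
have Ks : K * `|s - s0| < 1.
  apply: (@le_lt_trans _ _ (K * (K + 1)^-1)); first by rewrite ler_wpM2l // ltW.
  by rewrite ltr_pdivrMr ?mul1r ?ltrDl // ltr_wpDl.
rewrite -Df //.
have [s0s|ss0] := leP s0 s.
  by apply: (tame_zero_right r0 K0 DD D0) => //; rewrite -(ger0_norm (x := s - s0)) ?subr_ge0.
(* to the left of s0, apply the same estimate to the reflected function *)
pose E n u := (-1) ^+ n * D n (s0 + -1 * (u - s0)).
have nE u : `|s0 + -1 * (u - s0) - s0| = `|u - s0|.
  by rewrite addrC addKr mulN1r normrN.
have EE n u : `|u - s0| < r -> is_derive u 1 (E n) (E n.+1 u) /\ `|E n u| <= K ^+ n.+1 * n`!%:R.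
  move=> ur; have [] := DD n (s0 + -1 * (u - s0)); first by rewrite nE.
  move=> HD BD; split; last by rewrite normrM normrX normrN1 expr1n mul1r.
  have H0 : is_derive u 1 (fun s => s0 + -1 * (s - s0)) (-1).
    apply: is_derive_eq; rewrite /GRing.scale /=; lra.
  have H1 := @is_derive1_comp _ (D n) (fun s => s0 + -1 * (s - s0)) u _ _ HD H0.
  have := is_deriveZ ((-1) ^+ n) H1.
  by rewrite /E exprS /GRing.scale /= (mulrC _ (-1)) mulrA (mulrC _ (-1)).
have E0 n : E n s0 = 0 by rewrite /E subrr mulr0 addr0 D0 mulr0.
have := @tame_zero_right E s0 r K r0 K0 EE E0 (s0 + (s0 - s)).
rewrite lerDl subr_ge0 (ltW ss0) addrC addKr.
have a1 : s0 - s = `|s - s0| by rewrite ltr0_norm ?subr_lt0 // opprB.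
rewrite {1 2}a1 sr Ks => /(_ isT isT isT).
by rewrite /E expr0 mul1r => <-; congr (D _ _); ring.
Unshelve. all: by end_near. Qed.

(** The set where the two functions agree locally is open, and closed in the
    interval by the previous lemma. *)
Lemma tame_unique f g (I : set R) s0 : is_interval I -> open I -> I s0 ->
  (forall s, I s -> tame f s) -> (forall s, I s -> tame g s) ->
  (\forall s \near s0, f s = g s) -> forall s, I s -> f s = g s.
Proof.
move=> /connected_intervalP cI oI Is0 tf tg fg.
pose E : set R := [set s | \forall u \near s, f u = g u].
have oE : open E.
  rewrite openE => s Es; apply: filterS (nbhs_interior Es) => u; exact.
have EI : I `&` E = I.
  apply: cI; [by exists s0|by exists E|].
  exists (closure E); first exact: closed_closure.
  apply/seteqP; split => s [Is Es]; split => //; first exact: subset_closure.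
  have Z u : E u -> f u - g u = 0 by move=> /nbhs_singleton ->; rewrite subrr.
  by apply: filterS (tame_zero (tameB (tf s Is) (tg s Is)) oE Es Z) => u /subr0_eq.
by move=> s; rewrite -EI => -[_ /nbhs_singleton].
Qed.

End Tame.

(** * Unit speed analytic curves *)

Section Curves.
Variable R : realType.
Implicit Types (f g : R -> R) (s t a b : R) (c d : R -> 'rV[R]_4).

Lemma tame_is_derive f s : tame f s -> is_derive s 1 f ('D_1 f s).
Proof.
by move=> /tame_derive[f' [/nbhs_singleton H _ _]]; apply: derivableP; case: H.
Qed.

Lemma tame_D1_continuous f s0 : tame f s0 -> {for s0, continuous ('D_1 f)}.
Proof.
move=> /tame_derive[f' [H cf' E]]; rewrite /prop_for /continuous_at /=.
have := cf'; rewrite /prop_for /continuous_at E; apply: cvg_trans.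
by apply: near_eq_cvg; apply: filterS H => s [_ ->].
Qed.

Lemma tame_continuous f s0 : tame f s0 -> {for s0, continuous f}.
Proof. by move=> /tame_is_derive/is_derive1_continuous. Qed.

Definition speed c s : 'rV[R]_4 := \row_l 'D_1 (fun t => c t 0 l) s.

Definition unit_tame c s :=
  (forall l, tame (fun t => c t 0 l) s) /\ \sum_l speed c s 0 l ^+ 2 = 1.

Lemma cont_near_gt f s0 (a : R) : {for s0, continuous f} -> a < f s0 ->
  \forall s \near s0, a < f s.
Proof.
move=> cf fa; have d0 : 0 < f s0 - a by rewrite subr_gt0.
move/cvgrPdist_lt : cf => /(_ _ d0); apply: filterS => s; rewrite ltr_norml => /andP[_]; lra.
Qed.

Lemma cont_near_dist f s0 e : {for s0, continuous f} -> 0 < e ->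
  \forall s \near s0, `|f s - f s0| < e.
Proof.
move=> cf e0; move/cvgrPdist_lt : cf => /(_ _ e0).
by apply: filterS => s; rewrite distrC.
Qed.

(** Inverting a component of d with nonzero derivative gives a differentiable
    tau with c = d o tau. Both speeds are 1, so tau' has square 1; its sign is
    constant by continuity, hence tau is affine. *)
Lemma unit_tame_transition c d s0 t0 rho : 0 < rho ->
  (forall s, `|s - s0| < rho -> unit_tame c s) ->
  (forall t, `|t - t0| < rho -> unit_tame d t) ->
  c s0 = d t0 ->
  (forall e, 0 < e -> \forall s \near s0, exists2 t, `|t - t0| < e & c s = d t) ->
  exists2 eps : R, eps ^+ 2 = 1 & \forall s \near s0, c s = d (t0 + eps * (s - s0)).
Proof.
move=> rho0 Hc Hd cd sub.
have s00 : `|s0 - s0| < rho by rewrite subrr normr0.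
have t00 : `|t0 - t0| < rho by rewrite subrr normr0.
have [l l0] : exists l, speed d t0 0 l != 0.
  apply/not_existsP => H; have := (Hd t0 t00).2; rewrite big1 => [|l _].
    by move/eqP; rewrite eq_sym oner_eq0.
  by have /negP/negPn/eqP -> := H l; rewrite expr0n.
rewrite mxE in l0.
pose dl t := d t 0 l; pose cl s := c s 0 l.
have tc s m : `|s - s0| < rho -> tame (fun t => c t 0 m) s by move=> /Hc[].
have td t m : `|t - t0| < rho -> tame (fun t => d t 0 m) t by move=> /Hd[].
pose eta := Num.sg ('D_1 dl t0).
have eta2 : eta * eta = 1 by rewrite -expr2 sqr_sg l0.
pose f t := eta * dl t; pose f' t := eta * 'D_1 dl t.
have f't0 : 0 < f' t0 by rewrite /f' /eta -normrEsg normr_gt0.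
have df t : `|t - t0| < rho -> is_derive t 1 f (f' t).
  by move=> tr; have := is_deriveZ eta (tame_is_derive (td t l tr)).
have cf' : {for t0, continuous f'}.
  by apply: cvgMl_tmp; exact: (tame_D1_continuous (td t0 l t00)).
have [e1 e10 He1] := ball_near (cont_near_gt cf' f't0).
pose e := Num.min e1 rho.
have e0 : 0 < e by rewrite lt_min e10.
have ee t : `|t - t0| < e -> `|t - t0| < e1 /\ `|t - t0| < rho by rewrite lt_min => /andP.
have [g [r [r0 g0 gE gK]]] := inverse_function (f := f) (f' := f') (t0 := t0) e0
  (fun t h => df t (ee t h).2) (fun t h => He1 t (ee t h).1).
pose tau s := g (eta * cl s).
have clc : {for s0, continuous (fun s => eta * cl s)}.
  by apply: cvgMl_tmp; exact: (tame_continuous (tc s0 l s00)).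
have ft0 : f t0 = eta * cl s0 by rewrite /f /dl /cl -cd.
have nr : \forall s \near s0, `|eta * cl s - eta * cl s0| < r := cont_near_dist clc r0.
have ctau : \forall s \near s0, c s = d (tau s).
  near=> s; have [t te E] : exists2 t, `|t - t0| < e & c s = d t.
    by near: s; exact: sub.
  have ftE : f t = eta * cl s by rewrite /f /dl /cl -E.
  rewrite E /tau -ftE gK // ftE ft0; near: s; exact: nr.
have dtau : \forall s \near s0, is_derive (s : R) 1 tau (eta * 'D_1 cl s / f' (tau s)) /\
    `|tau s - t0| < e.
  near=> s; have sr : `|s - s0| < rho by near: s; exact: (near_ball rho0).
  have [] := gE (eta * cl s); first by rewrite ft0; near: s; exact: nr.
  move=> h1 h2 h3; split => //.
  have h4 := is_deriveZ eta (tame_is_derive (tc s l sr)).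
  have := @is_derive1_comp _ g (fun s => eta * cl s) s _ _ h3 h4.
  by rewrite /tau /GRing.scale /= (mulrC (_^-1)).
have sq : \forall s \near s0, (eta * 'D_1 cl s / f' (tau s)) ^+ 2 = 1.
  near=> s; have sr : `|s - s0| < rho by near: s; exact: (near_ball rho0).
  have [D1 D2] : is_derive (s : R) 1 tau (eta * 'D_1 cl s / f' (tau s)) /\ `|tau s - t0| < e.
    by near: s.
  have tr := (ee _ D2).2.
  have cs : \forall u \near s, c u = d (tau u) by near: s; exact: nbhs_interior ctau.
  have DE m : speed c s 0 m = speed d (tau s) 0 m * (eta * 'D_1 cl s / f' (tau s)).
    rewrite !mxE; have := @is_derive1_comp _ (fun t => d t 0 m) tau s _ _
      (tame_is_derive (td _ m tr)) D1.
    move=> [_ <-]; apply: near_eq_derive; apply: filterS cs => u E /=; by rewrite E.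
  have := (Hc s sr).2; under eq_bigr do rewrite DE exprMn.
  by rewrite -mulr_suml (Hd _ tr).2 mul1r.
pose eps := eta * 'D_1 cl s0 / f' (tau s0).
have eps2 : eps ^+ 2 = 1 by have := nbhs_singleton sq.
exists eps => //.
have pos : \forall s \near s0, 0 < eps * (eta * 'D_1 cl s).
  apply: cont_near_gt.
    by do 2 apply: cvgMl_tmp; exact: (tame_D1_continuous (tc s0 l s00)).
  have [_ D2] := nbhs_singleton dtau.
  have fp := He1 _ (ee _ D2).1.
  have -> : eta * 'D_1 cl s0 = eps * f' (tau s0) by rewrite /eps divfK ?gt_eqF.
  by rewrite mulrA -expr2 eps2 mul1r.
have tE : \forall s \near s0, is_derive (s : R) 1 (fun s => tau s - eps * s) 0.
  near=> s.
  have [D1 D2] : is_derive (s : R) 1 tau (eta * 'D_1 cl s / f' (tau s)) /\ `|tau s - t0| < e.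
    by near: s.
  have fp := He1 _ (ee _ D2).1.
  have S2 : (eta * 'D_1 cl s / f' (tau s)) ^+ 2 = 1 by near: s.
  have P2 : 0 < eps * (eta * 'D_1 cl s) by near: s.
  have E : eta * 'D_1 cl s / f' (tau s) = eps.
    have P3 : 0 < eps * (eta * 'D_1 cl s / f' (tau s)) by rewrite mulrA divr_gt0.
    move: S2 P3; set y := _ / _ => S2 P3.
    have : (y - eps) * (y + eps) = 0 by rewrite -subr_sqr S2 eps2 subrr.
    move=> /eqP; rewrite mulf_eq0 => /orP[/eqP/subr0_eq//|/eqP h].
    have yE : y = - eps by lra.
    by move: P3; rewrite yE mulrN -expr2 eps2; lra.
  rewrite E in D1.
  have := is_deriveB D1 (is_deriveZ eps (is_derive_id s 1)).
  by rewrite /GRing.scale /= mulr1 subrr.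
have [r1 r10 Hr1] := ball_near tE.
have tauE : \forall s \near s0, tau s = t0 + eps * (s - s0).
  apply: (near_ball r10) => s sr.
  have H t : s0 - r1 < t < s0 + r1 -> is_derive t 1 (fun s => tau s - eps * s) 0.
    by move=> /andP[? ?]; apply: Hr1; rewrite ltr_norml; apply/andP; split; lra.
  have := deriv0_cst H (x := s) (y := s0).
  have -> : s0 - r1 < s < s0 + r1.
    by move: sr; rewrite ltr_norml => /andP[? ?]; apply/andP; split; lra.
  have -> : s0 - r1 < s0 < s0 + r1 by apply/andP; split; lra.
  have -> : tau s0 = t0 by rewrite /tau -ft0.
  by move=> /(_ isT isT); lra.
by near=> s; rewrite -(near tauE) //; near: s.
Unshelve. all: by end_near. Qed.

End Curves.

(** * Arc length along a coordinate line *)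

Section Reparam.
Variable R : realType.
Implicit Types (p h : 'rV[R]_2) (f g z : 'rV[R]_2 -> R).

(** Iterates of the vector field z d_i; along the integral curves of the field they
    are the successive derivatives of f. *)
Fixpoint iter_field z (i : 'I_2) f n : 'rV[R]_2 -> R :=
  if n is n'.+1 then fun q => z q * partial i (iter_field z i f n') q else f.

(** Cauchy's trick: each of the k steps shrinks the radius by delta / n, so n steps
    stay inside rho - delta at the cost (Z n / delta)^n, which is of factorial
    order. *)
Lemma iter_field_majorized z f p rho Z M i n k (delta : R) :
  majorized z p rho Z -> majorized f p rho M -> 0 < delta -> delta < rho ->
  (k <= n)%N ->
  majorized (iter_field z i f k) p (rho - k%:R * (delta / n%:R)) ((Z * n%:R / delta) ^+ k * M).
Proof.
move=> zZ fM d0 drho; case: n => [|n]; first by rewrite leqn0 => /eqP -> /=; rewrite mul0r subr0 expr0 mul1r.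
elim: k => [|k IH] kn; first by rewrite /= mul0r subr0 expr0 mul1r.
have step0 : 0 < delta / n.+1%:R by rewrite divr_gt0.
have rE : rho - k.+1%:R * (delta / n.+1%:R) = rho - k%:R * (delta / n.+1%:R) - delta / n.+1%:R.
  by rewrite -natr1; ring.
have r0 : 0 <= rho - k.+1%:R * (delta / n.+1%:R).
  rewrite subr_ge0 mulrA ler_pdivrMr // mulrC; apply: ler_pM => //; try exact: ltW.
  by rewrite ler_nat.
have rho0 : 0 < rho by apply: lt_trans drho.
have r1 : rho - k.+1%:R * (delta / n.+1%:R) < rho - k%:R * (delta / n.+1%:R).
  by rewrite rE ltrBlDr ltrDl.
have r2 : rho - k.+1%:R * (delta / n.+1%:R) <= rho.
  by rewrite gerBl mulr_ge0 // ltW.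
have := majorizedM r0 (majorized_sub r0 r2 (lexx Z) zZ) (majorized_deriv i r0 r1 (IH (ltnW kn))).
rewrite {2}rE subKr => H.
have -> : (Z * n.+1%:R / delta) ^+ k.+1 * M = Z * ((Z * n.+1%:R / delta) ^+ k * M / (delta / n.+1%:R)).
  have n0 : n.+1%:R != 0 :> R by rewrite pnatr_eq0.
  have dn0 : delta != 0 by rewrite gt_eqF.
  by rewrite exprS; move: n.+1%:R n0 => N n0; field; rewrite n0 dn0.
exact: H.
Qed.

(** The n-th term of the exponential series at n is below e^n. *)
Lemma expnn_le_fact n : n%:R ^+ n <= expR 1 ^+ n * n`!%:R :> R.
Proof.
case: n => [|n]; first by rewrite !expr0 mulr1.
have := @expR_ge1Dxn R n.+1%:R n (ler0n _ _).
rewrite -[in expR _](mulr1 n.+1%:R) expRM_natl => H.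
rewrite -ler_pdivrMr ?ltr0n ?fact_gt0 //; apply: le_trans H.
by rewrite lerDr.
Qed.

Lemma iter_field_bound z f p (rho : R) i : 0 < rho ->
  (exists Z, majorized z p rho Z) -> (exists M, majorized f p rho M) ->
  exists2 K : R, 0 <= K & forall n h, `|h| < rho / 2 ->
    differentiable (iter_field z i f n) (p + h) /\
    `|iter_field z i f n (p + h)| <= K ^+ n.+1 * n`!%:R.
Proof.
move=> rho0 [Z zZ] [M fM].
have Z0 := majorized_ge0 rho0 zZ; have M0 := majorized_ge0 rho0 fM.
pose d := rho / 2.
have d0 : 0 < d by rewrite /d; lra.
have dr : d < rho by rewrite /d; lra.
pose x := Z / d * expR 1.
have x0 : 0 <= x by rewrite mulr_ge0 ?expR_ge0 // divr_ge0 // ltW.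
exists (M + x); first by rewrite addr_ge0.
move=> n h hd.
have H : majorized (iter_field z i f n) p (rho / 2) ((Z * n%:R / d) ^+ n * M).
  have := iter_field_majorized i (n := n) (k := n) zZ fM d0 dr (leqnn n).
  case: n => [|n]; first by rewrite mul0r subr0; by apply: majorized_sub => //; lra.
  rewrite mulrCA divff ?pnatr_eq0 // mulr1.
  by apply: majorized_sub => //; rewrite /d; lra.
split; first exact: majorized_differentiable H hd.
apply: (le_trans (majorized_bound H hd)).
have -> : (Z * n%:R / d) ^+ n * M = (Z / d) ^+ n * M * n%:R ^+ n.
  by rewrite !exprMn; ring.
apply: (@le_trans _ _ ((Z / d) ^+ n * M * (expR 1 ^+ n * n`!%:R))).
  apply: ler_wpM2l; last exact: expnn_le_fact.
  by rewrite mulr_ge0 // exprn_ge0 // divr_ge0 // ltW.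
rewrite mulrA; apply: ler_wpM2r; first exact: ler0n.
have -> : (Z / d) ^+ n * M * expR 1 ^+ n = x ^+ n * M by rewrite /x !exprMn; ring.
rewrite exprSr; apply: ler_pM; rewrite ?exprn_ge0 //; last by rewrite lerDl.
by rewrite lerXn2r ?nnegrE ?addr_ge0 // lerDr.
Qed.

Definition along p (i : 'I_2) (t : R) : 'rV[R]_2 := p + t *: delta_mx 0 i.

Lemma norm_delta (t : R) (i : 'I_2) : `|t *: delta_mx 0 i : 'rV[R]_2| = `|t|.
Proof.
rewrite normrZ; suff -> : `|delta_mx 0 i : 'rV[R]_2| = 1 by rewrite mulr1.
apply/eqP; rewrite eq_le; apply/andP; split; last first.
  by apply: le_trans (coord_le _ i); rewrite mxE !eqxx normr1.
rewrite /Num.norm /= mx_normrE; apply: bigmax_le; first exact: ler01.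
by move=> [a b] _ /=; rewrite mxE; case: (_ && _); rewrite ?normr1 ?normr0 ?ler01.
Qed.

Lemma is_derive_along f p i t : differentiable f (along p i t) ->
  is_derive t 1 (fun t => f (along p i t)) (partial i f (along p i t)).
Proof.
move=> df.
have da : is_diff (t : R) (along p i) (fun u => u *: delta_mx 0 i).
  have := is_diffD (is_diff_cst p t) (is_diff_scalel t (delta_mx 0 i : 'rV[R]_2)).
  by rewrite add0r.
have H : differentiable (f \o along p i) t by apply: differentiable_comp => //; case: da.
have -> : partial i f (along p i t) = 'D_1 (f \o along p i) t.
  have [dal dE] := da.
  rewrite /partial (deriveE _ df) (deriveE _ H) (diff_comp dal df).
  by rewrite -[RHS]/('d f (along p i t) ('d (along p i) t 1)) dE scale1r.
by apply: derivableP; apply/derivable1_diffP.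
Qed.

End Reparam.

Section Arclength.
Variable R : realType.
Implicit Types (p h : 'rV[R]_2).

Lemma analytic_radius n (g : 'I_n -> 'rV[R]_2 -> R) p : (forall l, analytic (g l) p) ->
  exists2 rho : R, 0 < rho & forall l, exists M, majorized (g l) p rho M.
Proof.
elim: n g => [|n IH] g H; first by exists 1 => // -[].
have [r1 r10 H1] := IH (fun l => g (lift ord0 l)) (fun l => H (lift ord0 l)).
have [r2 [M2 [r20 H2]]] := H ord0.
have m0 : 0 < Num.min r1 r2 by rewrite lt_min r10.
exists (Num.min r1 r2) => // l.
case: (unliftP ord0 l) => [j ->|->].
  have [M HM] := H1 j; exists M.
  by apply: majorized_sub HM; rewrite ?ge_min ?lexx // ltW.
by exists M2; apply: majorized_sub H2; rewrite ?ge_min ?lexx ?orbT // ltW.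
Qed.

Lemma along0 p i : along p i 0 = p.
Proof. by rewrite /along scale0r addr0. Qed.

Lemma along_continuous p i t : {for t, continuous (along p i)}.
Proof.
apply: differentiable_continuous.
have := is_diffD (is_diff_cst p t) (is_diff_scalel t (delta_mx 0 i : 'rV[R]_2)).
by case.
Qed.

(** The parameter of the i-th coordinate line is changed so that the curve g has
    unit speed: phi is the inverse of a primitive of the length of d_i g. The
    derivatives in the new parameter are the iterates of the analytic field
    |d_i g|^(-1) d_i, so the bound on iterates makes the curve tame. *)
Lemma arclength_param (g : 'I_4 -> 'rV[R]_2 -> R) p i (e : R) : 0 < e ->
  (forall l, analytic (g l) p) -> 0 < \sum_l partial i (g l) p ^+ 2 ->
  exists (phi phi' : R -> R) (r : R), [/\ 0 < r, phi 0 = 0,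
    forall s, `|s| < r -> [/\ `|phi s| < e, 0 < phi' s & is_derive s 1 phi (phi' s)] &
    forall s, `|s| < r -> unit_tame (fun s => \row_l g l (along p i (phi s))) s].
Proof.
move=> e0 ga q0.
pose q x := \sum_l partial i (g l) x ^+ 2.
have qa : analytic q p.
  by apply: analytic_sum => l; apply: analyticM; exact: analytic_partial.
pose z x := (Num.sqrt (q x))^-1.
have za : analytic z p by exact: analytic_invsqrt.
have [rho rho0 gM] := analytic_radius ga.
have [rz [Z [rz0 zZ]]] := za.
have [rq [Q [rq0 qQ]]] := qa.
have cq0 : {for 0, continuous (q \o along p i)}.
  apply: continuous_comp; first exact: along_continuous.
  by rewrite along0; exact: analytic_continuous.
have [e1 e10 He1] : exists2 e1 : R, 0 < e1 & forall t : R, `|t - 0| < e1 -> 0 < q (along p i t).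
  by apply: ball_near; apply: (cont_near_gt cq0); rewrite /= along0.
pose r1 := Num.min rho rz.
have r10 : 0 < r1 by rewrite lt_min rho0.
pose d := Num.min (Num.min e1 rq) (Num.min (r1 / 2) e).
have r12 : 0 < r1 / 2 by rewrite divr_gt0.
have d0 : 0 < d by rewrite !lt_min e10 rq0 r12 e0.
have dP (t : R) : `|t| < d -> [/\ `|t| < e1, `|t| < rq, `|t| < r1 / 2 & `|t| < e].
  by rewrite !lt_min => /andP[/andP[-> ->] /andP[-> ->]].
have wc (t : R) : `|t| < d -> {for t, continuous (fun t => Num.sqrt (q (along p i t)))}.
  move=> /dP[_ tq _ _].
  apply: (@continuous_comp _ _ _ (q \o along p i) Num.sqrt); last exact: sqrt_continuous.
  apply: continuous_comp; first exact: along_continuous.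
  apply: differentiable_continuous; apply: majorized_differentiable qQ _.
  by rewrite norm_delta.
have [sg sgD] := antiderivative d0 wc.
have d2 : 0 < d / 2 by rewrite divr_gt0.
have dd (t : R) : `|t| < d / 2 -> `|t| < d by move=> h; apply: lt_trans h _; rewrite ltr_pdivrMr // ltr_pMr // ltr1n.
have wpos t : `|t| < d -> 0 < Num.sqrt (q (along p i t)).
  by move=> /dP[t1 _ _ _]; rewrite sqrtr_gt0 He1 // subr0.
have [gg [r [r0 gg0 ggE _]]] := @inverse_function _ sg (fun t => Num.sqrt (q (along p i t))) 0 (d / 2) d2
  (fun t ht => sgD t (eq_ind _ (fun x => `|x| < d / 2) ht _ (subr0 t)))
  (fun t ht => wpos t (dd t (eq_ind _ (fun x => `|x| < d / 2) ht _ (subr0 t)))).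
pose phi s := gg (s + sg 0).
pose phi' s := z (along p i (phi s)).
have phiE (s : R) : `|s| < r -> `|phi s| < d / 2 /\ is_derive s 1 phi (phi' s).
  move=> sr; have [] := ggE (s + sg 0); first by rewrite addrK.
  rewrite subr0 => h1 _ h3; split=> //.
  by have := @is_derive1_comp _ gg (shift (sg 0)) s _ _ h3 (is_derive_shift s 1 (sg 0)); rewrite mulr1.
exists phi, phi', r; split => //.
- by rewrite /phi add0r.
- move=> s /phiE[/dd h1 h2]; have [_ _ _ he] := dP _ h1; split => //.
  by rewrite invr_gt0; exact: wpos.
have gB l := @iter_field_bound _ z (g l) p r1 i r10.
have {}gB l : exists2 K : R, 0 <= K & forall n h, `|h| < r1 / 2 ->
    differentiable (iter_field z i (g l) n) (p + h) /\
    `|iter_field z i (g l) n (p + h)| <= K ^+ n.+1 * n`!%:R.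
  apply: gB.
    by exists Z; apply: majorized_sub zZ; rewrite ?ge_min ?lexx ?orbT // ltW.
  have [M HM] := gM l; exists M.
  by apply: majorized_sub HM; rewrite ?ge_min ?lexx // ltW.
have DE l n (s : R) : `|s| < r ->
    is_derive s 1 (fun s => iter_field z i (g l) n (along p i (phi s)))
      (iter_field z i (g l) n.+1 (along p i (phi s))).
  move=> sr; have [/dd/dP[_ _ h1 _] h2] := phiE s sr.
  have [K _ HK] := gB l.
  have hh : `|phi s *: delta_mx 0 i : 'rV[R]_2| < r1 / 2 by rewrite norm_delta.
  have [dif _] := HK n _ hh.
  have := @is_derive1_comp _ (fun t => iter_field z i (g l) n (along p i t)) phi s _ _
    (is_derive_along dif) h2.
  by rewrite mulrC.
move=> s sr; split.
  move=> l; have [K K0 HK] := gB l.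
  exists (fun n s => iter_field z i (g l) n (along p i (phi s))), (r - `|s|), K; split => //.
  - by rewrite subr_gt0.
  - by move=> t _; rewrite mxE.
  move=> n t ts; have tr : `|t| < r.
    have -> : t = (t - s) + s by ring.
    by apply: (le_lt_trans (ler_normD _ _)); rewrite -ltrBrDr.
  split; first exact: DE.
  have [/dd/dP[_ _ h1 _] _] := phiE t tr.
  by apply: (HK n (phi t *: delta_mx 0 i) _).2; rewrite norm_delta.
have sE l : speed (fun s => \row_l g l (along p i (phi s))) s 0 l = z (along p i (phi s)) * partial i (g l) (along p i (phi s)).
  rewrite mxE; under eq_fun do rewrite mxE.
  by have [_ ->] := DE l 0%N s sr.
under eq_bigr do rewrite sE exprMn.
have [/dd h _] := phiE s sr; have := wpos _ h; rewrite sqrtr_gt0 => q1.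
by rewrite -mulr_sumr /z exprVn sqr_sqrtr ?ltW // mulVf // gt_eqF.
Qed.

End Arclength.

(** * Functions with proportional differentials *)

Section Dependence.
Variable R : realType.
Implicit Types (p q h v : 'rV[R]_2) (f g : 'rV[R]_2 -> R) (x y t : R).

Definition pt p (i j : 'I_2) x y : 'rV[R]_2 := p + (x *: delta_mx 0 i + y *: delta_mx 0 j).

Lemma ptEi p i j x y : pt p i j x y = along (p + y *: delta_mx 0 j) i x.
Proof. by rewrite /pt /along -addrA (addrC (y *: _)). Qed.

Lemma ptEj p i j x y : pt p i j x y = along (p + x *: delta_mx 0 i) j y.
Proof. by rewrite /pt /along addrA. Qed.

Lemma pt0 p i j x : pt p i j x 0 = along p i x.
Proof. by rewrite /pt scale0r addr0. Qed.

Lemma ptD p i j x y x' y' : pt p i j x y =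
  pt p i j x' y' + ((x - x') *: delta_mx 0 i + (y - y') *: delta_mx 0 j).
Proof.
rewrite /pt -addrA; congr (_ + _); rewrite !scalerBl addrACA.
by rewrite [_ + (x *: _ - _)]addrC [_ + (y *: _ - _)]addrC !subrK.
Qed.

Lemma ord2_cases (i j k : 'I_2) : i != j -> k = i \/ k = j.
Proof.
by case: i j k => -[|[|//]] ? [[|[|//]] ?] [[|[|//]] ?] //= _; [left|right|right|left]; apply: val_inj.
Qed.

Lemma pt_coord (i j : 'I_2) q : i != j -> q = q 0 i *: delta_mx 0 i + q 0 j *: delta_mx 0 j.
Proof.
move=> ij; apply/rowP => k; rewrite !mxE !eqxx /=.
by case: (ord2_cases k ij) => ->; rewrite eqxx ?(negbTE ij) ?(eq_sym j) ?(negbTE ij) ?mulr1 ?mulr0 ?addr0 ?add0r.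
Qed.

Lemma norm_pair (i j : 'I_2) x y r : i != j -> `|x| <= r -> `|y| <= r ->
  `|x *: delta_mx 0 i + y *: delta_mx 0 j : 'rV[R]_2| <= r.
Proof.
move=> ij xr yr; have r0 := le_trans (normr_ge0 _) xr.
rewrite /Num.norm /= mx_normrE; apply: bigmax_le => // -[a k] _ /=.
rewrite (ord1 a) !mxE eqxx /=.
by case: (ord2_cases k ij) => ->; rewrite eqxx ?(negbTE ij) ?(eq_sym j) ?(negbTE ij) ?mulr1 ?mulr0 ?addr0 ?add0r.
Qed.

Lemma norm_pair_lt (i j : 'I_2) x y r : i != j -> `|x| < r -> `|y| < r ->
  `|x *: delta_mx 0 i + y *: delta_mx 0 j : 'rV[R]_2| < r.
Proof.
move=> ij xr yr; apply: (@le_lt_trans _ _ (Num.max `|x| `|y|)); last by rewrite gt_max xr.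
by apply: norm_pair; rewrite // le_max lexx ?orbT.
Qed.

Lemma is_derive0_littleo (k : R -> R) y :
  (forall e : R, 0 < e -> \forall t \near 0, `|k (y + t) - k y| <= e * `|t|) ->
  is_derive y 1 k 0.
Proof.
move=> H.
have L : (fun h : R => h^-1 *: (k (h *: 1 + y) - k y)) @ 0^' --> (0 : R).
  apply/cvgr0Pnorm_le => e e0; near=> h.
  have h0 : h != 0 by near: h; exact: nbhs_dnbhs_neq.
  have : `|k (y + h) - k y| <= e * `|h| by near: h; apply: nbhs_dnbhs; exact: H.
  by rewrite /GRing.scale /= mulr1 (addrC h) normrM normfV ler_pdivrMl ?normr_gt0 // mulrC.
by apply: DeriveDef; [apply/cvg_ex; exists 0|exact: cvg_lim].
Unshelve. all: by end_near. Qed.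

(** At q the differential of g is a multiple of that of f, so along a step that
    keeps f fixed g changes by less than any multiple of the step. *)
Lemma dependent_littleo f g q (i j : 'I_2) (e : R) : i != j ->
  differentiable f q -> differentiable g q -> partial i f q != 0 ->
  partial i f q * partial j g q = partial j f q * partial i g q -> 0 < e ->
  \forall v \near (0 : 'rV[R]_2),
    f (q + v) = f q -> `|g (q + v) - g q| <= e * `|v|.
Proof.
move=> ij Df Dg fi0 dep e0.
pose lam := partial i g q / partial i f q.
have dE v : 'd g q v = lam * 'd f q v.
  have E (h : 'rV[R]_2 -> R) : differentiable h q -> 'd h q v = v 0 i * partial i h q + v 0 j * partial j h q.
    move=> Dh; rewrite [in LHS](pt_coord v ij) linearD !linearZ /= /partial.
    by rewrite (deriveE (delta_mx 0 i) Dh) (deriveE (delta_mx 0 j) Dh).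
  have -> := E _ Df; have -> := E _ Dg.
  have -> : partial j g q = lam * partial j f q.
    apply: (mulfI fi0); rewrite dep /lam.
    by move: (partial i f q) fi0 => u u0; field.
  by rewrite /lam mulrDr; move: (partial i f q) fi0 => u u0; field.
have d0 : 0 < e / (1 + `|lam|) by rewrite divr_gt0 // ltr_pwDl.
have Hf := differentiable_littleo Df d0; have Hg := differentiable_littleo Dg d0.
apply: filterS (filterI Hf Hg) => v [hf hg] fE.
rewrite fE subrr sub0r normrN in hf.
have -> : g (q + v) - g q = (g (q + v) - g q - 'd g q v) + lam * 'd f q v.
  by rewrite dE subrK.
apply: (le_trans (ler_normD _ _)); rewrite normrM.
apply: (le_trans (lerD hg (ler_wpM2l (normr_ge0 lam) hf))).
rewrite mulrA -mulrDl le_eqVlt; apply/orP; left; apply/eqP; congr (_ * _).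
by field; rewrite gt_eqF // ltr_pwDl.
Qed.

(** Functions whose gradients are proportional to that of f are constant on the
    level curves of f. The level curve is a Lipschitz graph x = xi y, since d_i f
    is bounded below and d_j f above; along it g has derivative zero, so the value
    of g can be read off where the level curve meets the i-th coordinate line. *)
Lemma level_dependence n f (g : 'I_n -> 'rV[R]_2 -> R) p (i j : 'I_2) (rho mu L : R) :
  i != j -> 0 < rho -> 0 < mu -> 0 <= L ->
  (forall h, `|h| < rho -> [/\ differentiable f (p + h), mu <= partial i f (p + h),
     `|partial j f (p + h)| <= L &
     forall l, differentiable (g l) (p + h) /\
       partial i f (p + h) * partial j (g l) (p + h) = partial j f (p + h) * partial i (g l) (p + h)]) ->
  exists2 r : R, 0 < r <= rho & forall x y x', `|x| < r -> `|y| < r -> `|x'| < r ->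
    f (pt p i j x y) = f (along p i x') -> forall l, g l (pt p i j x y) = g l (along p i x').
Proof.
move=> ij rho0 mu0 L0 H.
have box x y : `|x| < rho -> `|y| < rho -> `|x *: delta_mx 0 i + y *: delta_mx 0 j : 'rV[R]_2| < rho.
  exact: norm_pair_lt.
have Di x y : `|x| < rho -> `|y| < rho -> is_derive x 1 (fun x => f (pt p i j x y)) (partial i f (pt p i j x y)).
  move=> xr yr; have [D _ _ _] := H _ (box x y xr yr).
  rewrite ptEi; under eq_fun do rewrite ptEi.
  by apply: is_derive_along; rewrite -ptEi.
have Dj x y : `|x| < rho -> `|y| < rho -> is_derive y 1 (fun y => f (pt p i j x y)) (partial j f (pt p i j x y)).
  move=> xr yr; have [D _ _ _] := H _ (box x y xr yr).
  rewrite ptEj; under eq_fun do rewrite ptEj.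
  by apply: is_derive_along; rewrite -ptEj.
have inb t : - rho < t < rho -> `|t| < rho by rewrite ltr_norml.
have incr x x' y : `|x| < rho -> `|x'| < rho -> `|y| < rho -> x <= x' ->
    mu * (x' - x) <= f (pt p i j x' y) - f (pt p i j x y).
  move=> xr x'r yr; rewrite le_eqVlt => /orP[/eqP ->|xx']; first by rewrite !subrr mulr0.
  have [c /andP[c1 c2] ->] := mean_value (fun t ht => Di t y (inb t ht) yr)
    (andP (etrans (esym (ltr_norml x rho)) xr)).1 xx' (andP (etrans (esym (ltr_norml x' rho)) x'r)).2.
  apply: ler_wpM2r; first by rewrite subr_ge0 ltW.
  have cr : `|c| < rho.
    by move: xr x'r; rewrite !ltr_norml => /andP[? ?] /andP[? ?]; apply/andP; split; lra.
  by have [_ M _ _] := H _ (box c y cr yr).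
have lip x y y' : `|x| < rho -> `|y| < rho -> `|y'| < rho ->
    `|f (pt p i j x y) - f (pt p i j x y')| <= L * `|y - y'|.
  move=> xr; wlog yy' : y y' / y' < y.
    move=> W yr y'r; have [h|h|->] := ltgtP y' y; first exact: W.
      by rewrite distrC (distrC y); exact: W.
    by rewrite !subrr normr0 mulr0.
  move=> yr y'r.
  have [c /andP[c1 c2] ->] := mean_value (fun t ht => Dj x t xr (inb t ht))
    (andP (etrans (esym (ltr_norml y' rho)) y'r)).1 yy' (andP (etrans (esym (ltr_norml y rho)) yr)).2.
  rewrite normrM; apply: ler_wpM2r => //.
  have cr : `|c| < rho.
    by move: yr y'r; rewrite !ltr_norml => /andP[? ?] /andP[? ?]; apply/andP; split; lra.
  by have [_ _ M _] := H _ (box x c xr cr).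
have inj x x' y : `|x| < rho -> `|x'| < rho -> `|y| < rho ->
    mu * `|x' - x| <= `|f (pt p i j x' y) - f (pt p i j x y)|.
  move=> xr x'r yr; have [h|h] := leP x x'.
    by rewrite ger0_norm ?subr_ge0 //; apply: (le_trans (incr x x' y _ _ _ _)); rewrite // ler_norm.
  rewrite distrC (distrC (f _)) ger0_norm ?subr_ge0 ?(ltW h) //.
  by apply: (le_trans (incr x' x y _ _ _ _)); rewrite ?ler_norm // ltW.
(* a bound for the slope of the level curves; r leaves room in the ball of radius
   rho for a displacement C (y - y0) *)
pose C := (L + 1) / mu.
have C0 : 0 < C by rewrite divr_gt0 // ltr_wpDl.
pose r := rho / (1 + 2 * C).
have r0 : 0 < r by rewrite divr_gt0 //; lra.
have rE : r + 2 * C * r = rho by rewrite /r; field; lra.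
have rrho : r <= rho by rewrite -rE; have := mulr_gt0 C0 r0; lra.
exists r; first by rewrite r0.
move=> x0 y0 x' x0r y0r x'r fE l.
have lt_rho t : `|t| < r -> `|t| < rho by move=> h; exact: lt_le_trans h rrho.
(* the level curve through (x0, y0) *)
have ex y : `|y| < r -> exists2 x, `|x| < rho & f (pt p i j x y) = f (pt p i j x0 y0).
  move=> yr; have [->|yy0] := eqVneq y y0; first by exists x0 => //; exact: lt_rho.
  pose dl := C * `|y - y0|.
  have dl0 : 0 < dl by rewrite mulr_gt0 // normr_gt0 subr_eq0.
  have dlr : dl < 2 * C * r.
    have : `|y - y0| < 2 * r by apply: (le_lt_trans (ler_normB _ _)); lra.
    have -> : 2 * C * r = C * (2 * r) by ring.
    by rewrite /dl ltr_pM2l.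
  have xb x : x0 - dl <= x <= x0 + dl -> `|x| < rho.
    move=> /andP[? ?]; rewrite ltr_norml; move: x0r; rewrite ltr_norml => /andP[? ?].
    by apply/andP; split; lra.
  have a1 : `|x0 - dl| < rho by apply: xb; apply/andP; split; lra.
  have a2 : `|x0 + dl| < rho by apply: xb; apply/andP; split; lra.
  have a3 : `|x0| < rho by apply: xb; apply/andP; split; lra.
  have yrho := lt_rho _ yr; have y0rho := lt_rho _ y0r.
  have i1 := incr _ _ _ a1 a3 yrho (_ : x0 - dl <= x0).
  have i2 := incr _ _ _ a3 a2 yrho (_ : x0 <= x0 + dl).
  have i3 := lip _ _ _ a3 yrho y0rho.
  have mdl : mu * dl = L * `|y - y0| + `|y - y0|.
    by rewrite /dl /C; field; rewrite gt_eqF.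
  have yp : 0 < `|y - y0| by rewrite normr_gt0 subr_eq0.
  have {}i1 : f (pt p i j (x0 - dl) y) <= f (pt p i j x0 y0).
    have /i1 : x0 - dl <= x0 by lra.
    move: i3; rewrite ler_norml => /andP[_ b2].
    have -> : x0 - (x0 - dl) = dl by ring.
    rewrite mdl; lra.
  have {}i2 : f (pt p i j x0 y0) <= f (pt p i j (x0 + dl) y).
    have /i2 : x0 <= x0 + dl by lra.
    move: i3; rewrite ler_norml => /andP[b1 _].
    have -> : x0 + dl - x0 = dl by ring.
    rewrite mdl; lra.
  have lohi : x0 - dl <= x0 + dl by lra.
  have cf : {within `[x0 - dl, x0 + dl], continuous (fun x => f (pt p i j x y))}.
    apply: continuous_in_subspaceT => t; rewrite inE /= in_itv /= => tb.
    exact: is_derive1_continuous (Di t y (xb t tb) yrho).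
  have sin : f (pt p i j x0 y0) \in `[f (pt p i j (x0 - dl) y), f (pt p i j (x0 + dl) y)].
    by rewrite in_itv /= i1.
  have [t tb tE] := segment_continuous_le_surjective lohi (le_trans i1 i2) cf sin.
  by exists t => //; apply: xb; move: tb; rewrite /= in_itv.
pose xi y := xget 0 [set x | `|x| < rho /\ f (pt p i j x y) = f (pt p i j x0 y0)].
have xiP y : `|y| < r -> `|xi y| < rho /\ f (pt p i j (xi y) y) = f (pt p i j x0 y0).
  move=> yr; rewrite /xi; case: xgetP => [u _ //|hn].
  by have [x xr xE] := ex y yr; case: (hn x).
have xiL y y' : `|y| < r -> `|y'| < r -> `|xi y - xi y'| <= C * `|y - y'|.
  move=> yr y'r; have [h1 h2] := xiP y yr; have [h3 h4] := xiP y' y'r.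
  have := inj _ _ _ h3 h1 (lt_rho _ yr); rewrite h2 -h4 => hi.
  have := lip _ _ _ h3 (lt_rho _ y'r) (lt_rho _ yr); rewrite distrC (distrC y') => hl.
  have := normr_ge0 (y - y') => yy; rewrite distrC in hl.
  rewrite /C mulrAC ler_pdivlMr // mulrC mulrDl mul1r.
  by apply: (le_trans hi); apply: (le_trans hl); rewrite lerDl.
have kD y : `|y| < r -> is_derive y 1 (fun y => g l (pt p i j (xi y) y)) 0.
  move=> yr; have [xr xE] := xiP y yr.
  have yrho := lt_rho _ yr.
  have [Df Mf _ /(_ l) [Dg dep]] := H _ (box _ _ xr yrho).
  set q := p + _ in Df Mf Dg dep.
  have qE : q = pt p i j (xi y) y by [].
  have fi0 : partial i f q != 0 by rewrite gt_eqF // (lt_le_trans mu0).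
  have C1 : 0 < C + 1 by rewrite addr_gt0.
  apply: is_derive0_littleo => e e0; have e1 : 0 < e / (C + 1) by rewrite divr_gt0.
  have /nbhs_ballP[d /= d0 Hd] := dependent_littleo ij Df Dg fi0 dep e1.
  have m0 : 0 < Num.min (d / (C + 1)) (r - `|y|) by rewrite lt_min divr_gt0 // subr_gt0.
  apply/nbhs_ballP; exists (Num.min (d / (C + 1)) (r - `|y|)) => // t.
  rewrite /ball /= sub0r normrN lt_min => /andP[td tr].
  have ytr : `|y + t| < r by apply: (le_lt_trans (ler_normD _ _)); rewrite addrC -ltrBrDr.
  have [_ xtE] := xiP _ ytr.
  pose v : 'rV[R]_2 := (xi (y + t) - xi y) *: delta_mx 0 i + (y + t - y) *: delta_mx 0 j.
  have vE : pt p i j (xi (y + t)) (y + t) = q + v by rewrite qE -ptD.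
  have vn : `|v| <= (C + 1) * `|t|.
    apply: norm_pair => //.
      apply: (le_trans (xiL _ _ ytr yr)); rewrite addrAC subrr add0r.
      by rewrite ler_wpM2r // lerDl.
    by rewrite addrAC subrr add0r ler_peMl // lerDr ltW.
  have vd : `|0 - v| < d.
    rewrite sub0r normrN; apply: (le_lt_trans vn).
    by rewrite mulrC -ltr_pdivlMr.
  have := Hd v; rewrite -ball_normE /= => /(_ vd).
  rewrite -vE xtE -xE -qE => /(_ erefl) Hv.
  apply: (le_trans Hv); apply: (@le_trans _ _ (e / (C + 1) * ((C + 1) * `|t|))).
    by apply: ler_wpM2l => //; exact: ltW.
  by rewrite mulrA divfK // gt_eqF.
have kD' y : - r < y < r -> is_derive y 1 (fun y => g l (pt p i j (xi y) y)) 0.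
  by move=> yr; apply: kD; rewrite ltr_norml.
have := deriv0_cst kD' (x := y0) (y := 0).
rewrite -ltr_norml y0r oppr_lt0 r0 => /(_ isT isT).
have same x x'' y : `|x| < rho -> `|x''| < rho -> `|y| < r ->
    f (pt p i j x y) = f (pt p i j x'' y) -> x'' = x.
  move=> xr x''r yr E; have := inj _ _ _ xr x''r (lt_rho _ yr).
  rewrite E subrr normr0 pmulr_rle0 // normr_le0 subr_eq0 => /eqP //.
have [h1 h2] := xiP y0 y0r.
have z0 : `|0 : R| < r by rewrite normr0.
have [h3 h4] := xiP 0 z0.
rewrite (same _ _ _ (lt_rho _ x0r) h1 y0r (esym h2)) => ->.
rewrite -(pt0 p i j); congr (g l (pt p i j _ 0)).
by apply: (same _ _ _ (lt_rho _ x'r) h3 z0); rewrite h4 fE (pt0 p i j).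
Qed.

End Dependence.

(** * Factoring a rank one map through a curve *)

Section Leaf.
Variable R : realType.
Implicit Types (p q h v : 'rV[R]_2) (f g : 'rV[R]_2 -> R) (x y t : R).

Lemma near_ballV (P : 'rV[R]_2 -> Prop) p : (\forall q \near p, P q) ->
  exists2 r : R, 0 < r & forall h, `|h| < r -> P (p + h).
Proof.
move=> /nbhs_ballP[r /= r0 H]; exists r => // h hr; apply: H.
by rewrite -ball_normE /= opprD addrA subrr sub0r normrN.
Qed.

Lemma other_index (i : 'I_2) : exists j : 'I_2, i != j.
Proof. by case: i => -[|[|//]] ?; [exists 1|exists 0]. Qed.

Definition open_map_at (T : topologicalType) (u : T -> R) (x : T) :=
  forall O : set T, nbhs x O -> nbhs (u x) (u @` O).

(** Already on the line through q the function is increasing, with an inverse. *)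
Lemma open_along f q i e : 0 < e ->
  (forall t, `|t| < e -> differentiable f (along q i t) /\ 0 < partial i f (along q i t)) ->
  open_map_at f q.
Proof.
move=> e0 H O.
have : {for 0, continuous (along q i)} by exact: along_continuous.
rewrite /prop_for /continuous_at along0 => ca nO.
have [e1 e10 He1] := ball_near (ca _ nO).
have m0 : 0 < Num.min e e1 by rewrite lt_min e0.
have me t : `|t - 0| < Num.min e e1 -> `|t| < e /\ `|t - 0| < e1.
  by rewrite lt_min => /andP[]; rewrite subr0.
have [g [r [r0 g0 gE _]]] := inverse_function (f := fun t => f (along q i t))
   (f' := fun t => partial i f (along q i t)) (t0 := 0) m0
   (fun t ht => is_derive_along (H t (me t ht).1).1) (fun t ht => (H t (me t ht).1).2).
rewrite along0 in gE; apply: (near_ball r0) => y yr.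
have [h1 h2 _] := gE y yr.
by exists (along q i (g y)) => //; apply: He1; exact: (me _ h1).2.
Qed.

(** The component g k has a nonzero derivative, so it serves as f in
    level_dependence and g depends on the value of g k only. The values of g are
    therefore taken on the i-th coordinate line, which is parametrised by arc
    length; u is the arc length parameter with the same value of g k. *)
Lemma rank_one_factor (g : 'I_4 -> 'rV[R]_2 -> R) p (rho0 : R) (k : 'I_4) (i : 'I_2) : 0 < rho0 ->
  (forall h, `|h| < rho0 -> forall l, analytic (g l) (p + h)) ->
  (forall h, `|h| < rho0 -> forall l m (a b : 'I_2), 
     partial a (g l) (p + h) * partial b (g m) (p + h) = partial b (g l) (p + h) * partial a (g m) (p + h)) ->
  partial i (g k) p != 0 ->
  exists (r a : R) (u : 'rV[R]_2 -> R) (c : R -> 'rV[R]_4),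
   [/\ 0 < r, 0 < a, u p = 0,
       (exists2 z : R, z != 0 & speed c 0 = z *: \row_l partial i (g l) p) /\
       forall s, `|s| < a -> unit_tame c s /\ (exists2 h, `|h| < rho0 & c s = \row_l g l (p + h)) &
       forall h, `|h| < r -> [/\ `|u (p + h)| < a, c (u (p + h)) = \row_l g l (p + h),
         {for p + h, continuous u} & open_map_at u (p + h)]].
Proof.
move=> rho00 ga rk gk0.
have [j ij] := other_index i.
have ga0 l : analytic (g l) p by rewrite -[p]addr0; apply: ga; rewrite normr0.
pose eta := Num.sg (partial i (g k) p).
have eta2 : eta * eta = 1 by rewrite -expr2 sqr_sg gk0.
pose f q := eta * g k q.
have fD h : `|h| < rho0 -> analytic f (p + h).
  by move=> hr; apply: analyticM (ga h hr k); exact: analytic_cst.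
have pf b h : `|h| < rho0 -> partial b f (p + h) = eta * partial b (g k) (p + h).
  move=> hr; rewrite /partial; have D := analytic_differentiable (ga h hr k).
  exact: (deriveZ eta (diff_derivable D)).
pose mu : R := partial i f p / 2.
have fa0 : analytic f p by rewrite -[p]addr0; apply: fD; rewrite normr0.
have fip : 0 < partial i f p.
  by rewrite -[p]addr0 pf ?normr0 // addr0 -normrEsg normr_gt0.
have mu0 : 0 < mu by rewrite divr_gt0.
pose L : R := `|partial j f p| + 1.
have L0 : 0 <= L by rewrite addr_ge0.
have [r1 r10 Hr1] : exists2 r : R, 0 < r & forall h, `|h| < r -> mu <= partial i f (p + h).
  apply: (near_ballV (P := fun q => mu <= partial i f q)); have c := analytic_continuous (analytic_partial i fa0).
  move/cvgrPdist_le : c => /(_ _ mu0); apply: filterS => q; rewrite ler_norml /mu => /andP[_]; lra.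
have [r2 r20 Hr2] : exists2 r : R, 0 < r & forall h, `|h| < r -> `|partial j f (p + h)| <= L.
  apply: (near_ballV (P := fun q => `|partial j f q| <= L)); have c := analytic_continuous (analytic_partial j fa0).
  move/cvgrPdist_le : c => /(_ _ ltr01); apply: filterS => q.
  by rewrite distrC => H; rewrite /L -lerBlDl; apply: le_trans H; exact: lerB_dist.
pose rho := Num.min rho0 (Num.min r1 r2).
have rhop : 0 < rho by rewrite !lt_min rho00 r10.
have rhoP h : `|h| < rho -> [/\ `|h| < rho0, `|h| < r1 & `|h| < r2].
  by rewrite !lt_min => /and3P.
have [|r3 /andP[r30 r3rho] dep] := @level_dependence R 4 f g p i j rho mu L ij rhop mu0 L0.
  move=> h /rhoP[h1 h2 h3]; split; [exact: analytic_differentiable (fD _ h1)|exact: Hr1|exact: Hr2|].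
  move=> l; split; first exact: analytic_differentiable (ga _ h1 l).
  by rewrite (pf i h h1) (pf j h h1) -(mulrA eta) (rk h h1 k l i j) mulrA.
have sp : 0 < \sum_l partial i (g l) p ^+ 2.
  rewrite (bigD1 k) //= ltr_pwDl ?exprn_even_gt0 //.
  by apply: sumr_ge0 => l _; exact: sqr_ge0.
have [phi [phi' [r4 [r40 phi0 phiE cT]]]] := arclength_param r30 ga0 sp.
pose c s : 'rV[R]_4 := \row_l g l (along p i (phi s)).
pose kap s := f (along p i (phi s)).
pose kap' s := partial i f (along p i (phi s)) * phi' s.
have abox (s : R) : `|s| < r4 -> `|phi s *: delta_mx 0 i : 'rV[R]_2| < rho.
  by move=> /phiE[h _ _]; rewrite norm_delta; exact: lt_le_trans h r3rho.
have kapD (s : R) : `|s - 0| < r4 -> is_derive s 1 kap (kap' s).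
  rewrite subr0 => sr; have [_ _ h2] := phiE s sr; have [h1 _ _] := rhoP _ (abox s sr).
  have D := is_derive_along (analytic_differentiable (fD _ h1)).
  exact: (@is_derive1_comp _ (fun t => f (along p i t)) phi s _ _ D h2).
have kap'0 (s : R) : `|s - 0| < r4 -> 0 < kap' s.
  rewrite subr0 => sr; have [_ h2 _] := phiE s sr; have [_ h1 _] := rhoP _ (abox s sr).
  by rewrite mulr_gt0 //; exact: lt_le_trans (Hr1 _ h1).
have [G [r5 [r50 G0 GE GK]]] := inverse_function r40 kapD kap'0.
have kapf : kap 0 = f p by rewrite /kap phi0 along0.
have [r6 r60 Hr6] : exists2 r : R, 0 < r & forall h, `|h| < r -> `|f (p + h) - kap 0| < r5.
  apply: (near_ballV (P := fun q => `|f q - kap 0| < r5)); have cf := analytic_continuous fa0.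
  by move/cvgrPdist_lt : cf => /(_ _ r50); rewrite kapf; apply: filterS => q; rewrite distrC.
pose r := Num.min r3 r6.
exists r, r4, (G \o f), c; split => //.
- by rewrite lt_min r30.
- by rewrite /= -kapf.
- split; last first.
    move=> s sr; split; first exact: cT.
    have [h1 _ _] := rhoP _ (abox s sr); exists (phi s *: delta_mx 0 i) => //.
  have [_ z0 zD] := phiE 0 (etrans (f_equal (fun x : R => x < r4) (normr0 R)) r40).
  exists (phi' 0); first by rewrite gt_eqF.
  apply/rowP => l; rewrite !mxE.
  have D := @is_derive_along _ (g l) p i (phi 0).
  rewrite phi0 along0 in D; have {}D := D (analytic_differentiable (ga0 l)).
  have {}D : is_derive (phi 0) 1 (fun t => g l (along p i t)) (partial i (g l) p) by rewrite phi0.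
  have [_ E] := @is_derive1_comp _ (fun t => g l (along p i t)) phi 0 _ _ D zD.
  have -> : (fun t => c t 0 l) = (fun t => g l (along p i (phi t))).
    by apply/funext => t; rewrite mxE.
  by rewrite mulrC; exact: E.
move=> h; rewrite lt_min => /andP[h3 h6].
have [G1 G2 G3] := GE _ (Hr6 h h6); rewrite subr0 in G1.
have [h0 h1 h2] := rhoP h (lt_le_trans h3 r3rho).
have Gc : {for f (p + h), continuous G} by exact: is_derive1_continuous G3.
have fc : {for p + h, continuous f} := analytic_continuous (fD h h0).
split => //=.
- apply/rowP => l; rewrite !mxE.
  have hE : p + h = pt p i j (h 0 i) (h 0 j) by rewrite /pt -pt_coord.
  rewrite hE; apply/esym; apply: dep.
  + exact: le_lt_trans (coord_le _ _) h3.
  + exact: le_lt_trans (coord_le _ _) h3.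
  + by have [] := phiE _ G1; rewrite hE.
  + by rewrite -hE; exact: (esym G2).
- exact: continuous_comp.
have of' : open_map_at f (p + h).
  have e0 : 0 < rho - `|h| by rewrite subr_gt0; exact: lt_le_trans h3 r3rho.
  apply: (@open_along f (p + h) i _ e0) => t tr.
  have -> : along (p + h) i t = p + (h + t *: delta_mx 0 i) by rewrite /along addrA.
  have /rhoP[? ? ?] : `|h + t *: delta_mx 0 i| < rho.
    by apply: (le_lt_trans (ler_normD _ _)); rewrite norm_delta addrC -ltrBrDr.
  split; first exact: analytic_differentiable (fD _ _).
  exact: lt_le_trans (Hr1 _ _).
move=> O nO.
have kc : {for G (f (p + h)), continuous kap}.
  by apply: is_derive1_continuous (kapD _ _); rewrite subr0.
have N1 : \forall s \near G (f (p + h)), (f @` O) (kap s).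
  by apply: kc; rewrite G2; exact: of'.
have N2 : \forall s \near G (f (p + h)), `|s| < r4.
  apply: (near_ball (r := r4 - `|G (f (p + h))|)); first by rewrite subr_gt0.
  move=> s ss; rewrite -[s](subrK (G (f (p + h)))).
  by apply: (le_lt_trans (ler_normD _ _)); rewrite -ltrBrDr.
have N3 : \forall s \near G (f (p + h)), `|kap s - kap 0| < r5.
  have d0 : 0 < r5 - `|f (p + h) - kap 0| by rewrite subr_gt0; exact: Hr6.
  have := cont_near_dist kc d0; rewrite G2; apply: filterS => s ss.
  have -> : kap s - kap 0 = (kap s - f (p + h)) + (f (p + h) - kap 0) by ring.
  by apply: (le_lt_trans (ler_normD _ _)); rewrite -ltrBrDr.
apply: filterS (filterI N1 (filterI N2 N3)) => s [[q Oq fq] [s1 s2]].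
by exists q => //=; rewrite fq GK // subr0.
Qed.

End Leaf.

(** * Quaternions *)

Section Quaternions.
Variable R : realType.
Implicit Types (u v w X N A B : 'rV[R]_4).

Definition k0 : 'I_4 := Ordinal (isT : (0 < 4)%N).
Definition k1 : 'I_4 := Ordinal (isT : (1 < 4)%N).
Definition k2 : 'I_4 := Ordinal (isT : (2 < 4)%N).
Definition k3 : 'I_4 := Ordinal (isT : (3 < 4)%N).

Definition vec4 (a b c d : R) : 'rV[R]_4 := \row_k nth 0 [:: a; b; c; d] k.

Lemma vec4E a b c d : (vec4 a b c d 0 k0 = a) * (vec4 a b c d 0 k1 = b) *
  (vec4 a b c d 0 k2 = c) * (vec4 a b c d 0 k3 = d).
Proof. by rewrite !mxE. Qed.

Lemma ord4P (P : 'I_4 -> Prop) : P k0 -> P k1 -> P k2 -> P k3 -> forall k, P k.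
Proof.
by move=> h0 h1 h2 h3 [[|[|[|[|//]]]] k]; [move: h0|move: h1|move: h2|move: h3];
  congr P; exact: val_inj.
Qed.

Lemma eq4 v w : v 0 k0 = w 0 k0 -> v 0 k1 = w 0 k1 -> v 0 k2 = w 0 k2 -> v 0 k3 = w 0 k3 -> v = w.
Proof. by move=> *; apply/rowP; exact: ord4P. Qed.

Lemma sum4 (V : zmodType) (f : 'I_4 -> V) : \sum_k f k = f k0 + f k1 + f k2 + f k3.
Proof.
rewrite !big_ord_recl big_ord0 addr0 !addrA.
by congr (f _ + f _ + f _ + f _); exact: val_inj.
Qed.

Definition dot v w : R := \sum_k v 0 k * w 0 k.

Definition qconj v : 'rV[R]_4 := vec4 (v 0 k0) (- v 0 k1) (- v 0 k2) (- v 0 k3).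

Definition qmul v w : 'rV[R]_4 := vec4
  (v 0 k0 * w 0 k0 - v 0 k1 * w 0 k1 - v 0 k2 * w 0 k2 - v 0 k3 * w 0 k3)
  (v 0 k0 * w 0 k1 + v 0 k1 * w 0 k0 + v 0 k2 * w 0 k3 - v 0 k3 * w 0 k2)
  (v 0 k0 * w 0 k2 - v 0 k1 * w 0 k3 + v 0 k2 * w 0 k0 + v 0 k3 * w 0 k1)
  (v 0 k0 * w 0 k3 + v 0 k1 * w 0 k2 - v 0 k2 * w 0 k1 + v 0 k3 * w 0 k0).

Lemma coordE : (forall u v k, (u + v) 0 k = u 0 k + v 0 k) *
  (forall u k, (- u) 0 k = - u 0 k) * (forall (a : R) u k, (a *: u) 0 k = a * u 0 k).
Proof. by do 2?split=> *; rewrite mxE. Qed.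

Lemma dotE v w : dot v w = v 0 k0 * w 0 k0 + v 0 k1 * w 0 k1 + v 0 k2 * w 0 k2 + v 0 k3 * w 0 k3.
Proof. by rewrite /dot sum4. Qed.

Lemma qconjE v : (qconj v 0 k0 = v 0 k0) * (qconj v 0 k1 = - v 0 k1) *
  (qconj v 0 k2 = - v 0 k2) * (qconj v 0 k3 = - v 0 k3).
Proof. by rewrite !vec4E. Qed.

Lemma qmulE v w :
  (qmul v w 0 k0 = v 0 k0 * w 0 k0 - v 0 k1 * w 0 k1 - v 0 k2 * w 0 k2 - v 0 k3 * w 0 k3) *
  (qmul v w 0 k1 = v 0 k0 * w 0 k1 + v 0 k1 * w 0 k0 + v 0 k2 * w 0 k3 - v 0 k3 * w 0 k2) *
  (qmul v w 0 k2 = v 0 k0 * w 0 k2 - v 0 k1 * w 0 k3 + v 0 k2 * w 0 k0 + v 0 k3 * w 0 k1) *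
  (qmul v w 0 k3 = v 0 k0 * w 0 k3 + v 0 k1 * w 0 k2 - v 0 k2 * w 0 k1 + v 0 k3 * w 0 k0).
Proof. by rewrite !vec4E. Qed.

Ltac gencoords := repeat match goal with
  |- context [fun_of_matrix ?v ?i ?k] => is_var v; move: (fun_of_matrix v i k) => ? end.
Ltac coords := rewrite ?dotE ?qmulE ?qconjE; gencoords.
Ltac vcoords := apply: eq4; rewrite ?dotE ?coordE ?qmulE ?qconjE ?coordE; gencoords.

Lemma dotC v w : dot v w = dot w v.
Proof. by apply: eq_bigr => k _; rewrite mulrC. Qed.

Lemma dotDl u v w : dot (u + v) w = dot u w + dot v w.
Proof. by rewrite /dot -big_split; apply: eq_bigr => k _; rewrite mxE mulrDl. Qed.

Lemma dotZl (a : R) v w : dot (a *: v) w = a * dot v w.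
Proof. by rewrite /dot mulr_sumr; apply: eq_bigr => k _; rewrite mxE mulrA. Qed.

Lemma dotDr u v w : dot u (v + w) = dot u v + dot u w.
Proof. by rewrite dotC dotDl !(dotC u). Qed.

Lemma dotZr (a : R) v w : dot v (a *: w) = a * dot v w.
Proof. by rewrite dotC dotZl dotC. Qed.

Lemma dotNl v w : dot (- v) w = - dot v w.
Proof. by rewrite -scaleN1r dotZl mulN1r. Qed.

Lemma dotNr v w : dot v (- w) = - dot v w.
Proof. by rewrite dotC dotNl dotC. Qed.

Lemma dotBl u v w : dot (u - v) w = dot u w - dot v w.
Proof. by rewrite dotDl dotNl. Qed.

Lemma dot0l v : dot 0 v = 0.
Proof. by rewrite -(scale0r 0) dotZl mul0r. Qed.

Lemma dot_ge0 v : 0 <= dot v v.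
Proof. by apply: sumr_ge0 => k _; rewrite -expr2 sqr_ge0. Qed.

Lemma dot_eq0 v : dot v v = 0 -> v = 0.
Proof.
move=> /eqP; rewrite psumr_eq0; last by move=> k _; rewrite -expr2 sqr_ge0.
move=> /allP H; apply/rowP => k; rewrite mxE.
by have := H k (mem_index_enum _); rewrite mulf_eq0 orbb => /eqP.
Qed.

Lemma qmulDl u v w : qmul (u + v) w = qmul u w + qmul v w.
Proof. by vcoords; ring. Qed.

Lemma qmulDr u v w : qmul u (v + w) = qmul u v + qmul u w.
Proof. by vcoords; ring. Qed.

Lemma qmulZl (a : R) v w : qmul (a *: v) w = a *: qmul v w.
Proof. by vcoords; ring. Qed.

Lemma qmulZr (a : R) v w : qmul v (a *: w) = a *: qmul v w.
Proof. by vcoords; ring. Qed.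

Lemma qmulA u v w : qmul u (qmul v w) = qmul (qmul u v) w.
Proof. by vcoords; ring. Qed.

Lemma dot_qmul v w : dot (qmul v w) (qmul v w) = dot v v * dot w w.
Proof. by coords; ring. Qed.

Lemma dot_qconj v : dot (qconj v) (qconj v) = dot v v.
Proof. by coords; ring. Qed.

(** On unit vectors, v |-> - u conj(v) u is the reflection in the hyperplane
    orthogonal to u; the next lemma is its polarisation in u. *)
Lemma qmul_sandwich u v : qmul (qmul u (qconj v)) u = (2 * dot u v) *: u - dot u u *: v.
Proof. by vcoords; ring. Qed.

Lemma qmul_sandwichD u v w :
  qmul (qmul u (qconj v)) w + qmul (qmul w (qconj v)) u =
  (2 * dot u v) *: w + (2 * dot w v) *: u - (2 * dot u w) *: v.
Proof. by vcoords; ring. Qed.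

Lemma dot_triple_last u v w : dot (qmul (qmul u (qconj v)) w) u = dot u u * dot v w.
Proof. by coords; ring. Qed.

Lemma dot_triple_first u v w : dot (qmul (qmul u (qconj v)) w) w = dot w w * dot u v.
Proof. by coords; ring. Qed.

Lemma dot_triple_mid u v w : dot (qmul (qmul u (qconj v)) w) v =
  2 * dot v w * dot u v - dot v v * dot u w.
Proof. by coords; ring. Qed.

Lemma qmul_conjl v w : qmul (qmul v (qconj v)) w = dot v v *: w.
Proof. by vcoords; ring. Qed.

Lemma qmul_conjlr v w : qmul (qconj v) (qmul v w) = dot v v *: w.
Proof. by vcoords; ring. Qed.

Lemma qmul_conjrr v w : qmul (qmul w v) (qconj v) = dot v v *: w.
Proof. by vcoords; ring. Qed.

End Quaternions.

(** * The pointwise splitting of a flat surface *)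

Section Scalars.
Variable R : realType.

Lemma det0_collinear (a b c d : R) : a * d = b * c ->
  exists u v e f : R, [/\ a = e * u, b = e * v, c = f * u & d = f * v].
Proof.
move=> H; have [a0|a0] := eqVneq a 0; last first.
  exists a, b, 1, (c / a); rewrite !mul1r divfK //; split => //.
  by apply: (mulfI a0); rewrite H; field.
have [b0|b0] := eqVneq b 0; last first.
  exists a, b, 1, (d / b); rewrite !mul1r divfK //; split => //.
  by apply: (mulfI b0); rewrite -H a0; field.
by exists c, d, 0, 1; rewrite !mul0r !mul1r.
Qed.

(** (a, b) and (c, d) are eigenvectors, for the eigenvalues 1 and - 1, of the matrix
    with rows (- y, e) and (x, y), so they are proportional only if one vanishes. *)
Lemma eigen_independent (y x e a b c d : R) :
  - y * a + e * b = a -> x * a + y * b = b ->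
  - y * c + e * d = - c -> x * c + y * d = - d ->
  a * d = b * c -> (a = 0 /\ b = 0) \/ (c = 0 /\ d = 0).
Proof.
move=> h1 h2 h3 h4 h5.
have [a0|a0] := eqVneq a 0; last first.
  right; have dE : d = b * c / a by apply: (mulfI a0); rewrite h5; field.
  have c0 : c = 0.
    have : a * (- y * c + e * d) = a * - c by rewrite h3.
    have -> : a * (- y * c + e * d) = c * (- y * a + e * b) by rewrite dE; field.
    by rewrite h1 => h; apply: (mulfI a0); nra.
  by split => //; rewrite dE c0 mulr0 mul0r.
have [b0|b0] := eqVneq b 0; first by left.
right; have c0 : c = 0 by apply: (mulfI b0); rewrite -h5 a0; ring.
split => //; apply: (mulfI b0).
have E : b = y * b by rewrite -[LHS]h2 a0; ring.
have F : d = - (y * d) by rewrite -[LHS]opprK -h4 c0; ring.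
have : b * d = (y * b) * d by rewrite -E.
have : b * d = - (b * (y * d)) by rewrite -mulrN -F.
lra.
Qed.

(** In a basis where the metric has the two coordinate vectors (1, 0) and (s, r),
    and the shape operator sends them to (x, y) and (z, w), the hypotheses are its
    symmetry and the Gauss equation det = - 1. Composed with a right angle
    rotation, such an operator becomes an involution P; the pairs in the conclusion
    are the images of the two coordinate vectors under P - 1 and under - P - 1, whose
    ranges are the eigenspaces of P. *)
Lemma planar_split (x y z w s r : R) : r != 0 -> z = x * s + y * r -> x * w - y * z = - r ->
  [/\ (y - 1) * (- z - r) = (- x) * (w - s),
      (- y - 1) * (z - r) = x * (- w - s),
      ~ [/\ y - 1 = 0, - x = 0, w - s = 0 & - z - r = 0],
      ~ [/\ - y - 1 = 0, x = 0, - w - s = 0 & z - r = 0] &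
      forall a b c d, (a = y - 1 /\ b = - x) \/ (a = w - s /\ b = - z - r) ->
        (c = - y - 1 /\ d = x) \/ (c = - w - s /\ d = z - r) ->
        a * d = b * c -> (a = 0 /\ b = 0) \/ (c = 0 /\ d = 0)].
Proof.
move=> r0 zE G; split.
- by rewrite zE in G *; lra.
- by rewrite zE in G *; lra.
- move=> [y1 x0 ws zr]; move/eqP: r0; apply.
  have {}x0 : x = 0 by lra.
  have y1' : y = 1 by lra.
  by rewrite x0 y1' in zE G; lra.
- move=> [y1 x0 ws zr]; move/eqP: r0; apply.
  have y1' : y = -1 by lra.
  by rewrite x0 y1' in zE G; lra.
move=> a b c d hab hcd; pose e := (s * y - w) / r.
have er : e * r = s * y - w by rewrite /e divfK.
have xe : x * e = 1 - y * y.
  apply: (mulfI r0); have -> : r * (x * e) = x * (e * r) by ring.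
  by rewrite er; rewrite zE in G; lra.
apply: (@eigen_independent y x e).
- case: hab => -[-> ->]; first by lra.
  have -> : e * (- z - r) = - s * (x * e) - (y + 1) * (e * r) by rewrite zE; ring.
  by rewrite er xe; ring.
- by case: hab => -[-> ->]; lra.
- case: hcd => -[-> ->]; first by lra.
  have -> : e * (z - r) = s * (x * e) + (y - 1) * (e * r) by rewrite zE; ring.
  by rewrite er xe; ring.
- by case: hcd => -[-> ->]; lra.
Qed.

End Scalars.

Section Frame.
Variable R : realType.
Implicit Types (u v w X N A B : 'rV[R]_4).

(** Left multiplication by N conj(X): a rotation by a right angle in the plane
    orthogonal to the unit vectors X and N. *)
Definition rot X N v := qmul (qmul N (qconj X)) v.

Lemma rotD X N v w : rot X N (v + w) = rot X N v + rot X N w.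
Proof. exact: qmulDr. Qed.

Lemma rotZ X N (a : R) v : rot X N (a *: v) = a *: rot X N v.
Proof. exact: qmulZr. Qed.

Lemma orthonormal_expand (e : 'I_4 -> 'rV[R]_4) :
  (forall i j, dot (e i) (e j) = (i == j)%:R) ->
  forall v, v = \sum_i dot v (e i) *: e i.
Proof.
move=> H v; pose M : 'M[R]_4 := \matrix_(i, j) e i 0 j.
have MM : M *m M^T = 1%:M.
  apply/matrixP => i j; rewrite !mxE -H; apply: eq_bigr => k _.
  by rewrite !mxE.
have -> : \sum_i dot v (e i) *: e i = v *m (M^T *m M).
  rewrite mulmxA; apply/rowP => k; rewrite mxE summxE; apply: eq_bigr => i _.
  rewrite !mxE; congr (_ * _); apply: eq_bigr => l _; by rewrite !mxE.
by rewrite (mulmx1C MM) mulmx1.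
Qed.

Section Unit.
Variables (X N : 'rV[R]_4).
Hypotheses (XX : dot X X = 1) (NN : dot N N = 1) (XN : dot X N = 0).

Definition tangent v := dot v X = 0 /\ dot v N = 0.

Let NX : dot N X = 0. Proof. by rewrite dotC. Qed.

Lemma rot_tangent v : tangent v -> tangent (rot X N v).
Proof.
move=> [vX vN]; split.
  by rewrite dot_triple_mid NX (dotC N v) vN !mulr0 subrr.
by rewrite dot_triple_last (dotC X v) vX mulr0.
Qed.

Lemma dot_rot v w : dot (rot X N v) (rot X N w) = dot v w.
Proof.
have H u : dot (rot X N u) (rot X N u) = dot u u by rewrite !dot_qmul dot_qconj XX NN !mul1r.
have := H (v + w); rewrite rotD !dotDl !dotDr !H (dotC (rot X N w)) (dotC w v); lra.
Qed.

Lemma dot_rot_self v : dot (rot X N v) v = 0.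
Proof. by rewrite dot_triple_first NX mulr0. Qed.

Lemma rot_rot v : rot X N (rot X N v) = - v.
Proof.
rewrite /rot !qmulA; have -> : qmul (qmul (qmul N (qconj X)) N) (qconj X) =
    qmul (- X) (qconj X).
  by rewrite qmul_sandwich NX NN mulr0 scale0r sub0r scale1r.
by rewrite -scaleN1r qmulZl qmulZl qmul_conjl XX scale1r scaleN1r.
Qed.

(** X, N, A / |A|, rot A / |A| is an orthonormal frame. *)
Lemma tangent_expand A v : tangent A -> A != 0 -> tangent v ->
  v = (dot v A / dot A A) *: A + (dot v (rot X N A) / dot A A) *: rot X N A.
Proof.
move=> [AX AN] A0 [vX vN].
have a0 : 0 < dot A A.
  rewrite lt_neqAle dot_ge0 andbT eq_sym.
  by apply: contra A0 => /eqP/dot_eq0 ->.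
have [RX RN] := rot_tangent (conj AX AN).
pose s := Num.sqrt (dot A A).
have s0 : 0 < s by rewrite sqrtr_gt0.
have ss : s * s = dot A A by rewrite -expr2 sqr_sqrtr // ltW.
pose e (i : 'I_4) := nth 0 [:: X; N; s^-1 *: A; s^-1 *: rot X N A] i.
have E : forall i j, dot (e i) (e j) = (i == j)%:R.
  have XA : dot X A = 0 by rewrite dotC.
  have NA : dot N A = 0 by rewrite dotC.
  have XR : dot X (rot X N A) = 0 by rewrite dotC.
  have NR : dot N (rot X N A) = 0 by rewrite dotC.
  have AR : dot A (rot X N A) = 0 by rewrite dotC dot_rot_self.
  have one : s^-1 * (s^-1 * dot A A) = 1 by rewrite -ss; field; rewrite gt_eqF.
  by apply: ord4P; apply: ord4P; rewrite /e /= ?dotZl ?dotZr ?dot_rot ?dot_rot_self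
     ?XX ?NN ?XN ?NX ?AX ?AN ?RX ?RN ?XA ?NA ?XR ?NR ?AR ?one ?mulr0.
rewrite {1}(orthonormal_expand E v) sum4 /e /= vX vN !scale0r !add0r !dotZr !scalerA.
by rewrite -ss; congr (_ *: _ + _ *: _); field; rewrite gt_eqF.
Qed.

(** Here A, B are the coordinate vectors of a surface, N0, N1 the derivatives of
    its normal, and the determinant hypothesis is the Gauss equation of a flat
    metric. The vectors tT and tF are the derivatives of the two Gauss maps, up to
    a quaternion factor: they lie in the two eigenlines of an involution, which
    meet only in 0. *)
Lemma flat_split A B N0 N1 (tT tF : 'I_2 -> 'rV[R]_4) :
  tangent A -> tangent B -> tangent N0 -> tangent N1 ->
  0 < dot A A * dot B B - dot A B ^+ 2 ->
  dot N0 B = dot N1 A ->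
  dot N0 A * dot N1 B - dot N0 B ^+ 2 = - (dot A A * dot B B - dot A B ^+ 2) ->
  tT 0 = - rot X N N0 - A -> tT 1 = - rot X N N1 - B ->
  tF 0 = rot X N N0 - A -> tF 1 = rot X N N1 - B ->
  [/\ exists w (c : 'I_2 -> R), forall i, tT i = c i *: w,
      exists w (c : 'I_2 -> R), forall i, tF i = c i *: w,
      exists i, tT i != 0, exists i, tF i != 0 &
      forall i j, tT i != 0 -> tF j != 0 -> dot (rot X N (tT i)) (tF j) != 0].
Proof.
move=> tA tB tN0 tN1 D0 sym gauss T0 T1 F0 F1.
have A0 : A != 0.
  apply/eqP => A0; move: D0; rewrite A0 !dot0l; lra.
have a0 : 0 < dot A A.
  rewrite lt_neqAle dot_ge0 andbT eq_sym.
  by apply: contra A0 => /eqP/dot_eq0 ->.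
pose pl (a b : R) : 'rV[R]_4 := a *: A + b *: rot X N A.
have plE v : tangent v -> v = pl (dot v A / dot A A) (dot v (rot X N A) / dot A A).
  exact: tangent_expand.
have rpl a b : rot X N (pl a b) = pl (- b) a.
  by rewrite /pl rotD !rotZ rot_rot scalerN scaleNr addrC.
have AK : dot A (rot X N A) = 0 by rewrite dotC dot_rot_self.
have dpl a b c d : dot (pl a b) (pl c d) = dot A A * (a * c + b * d).
  by rewrite /pl !dotDl !dotDr !dotZl !dotZr dot_rot dot_rot_self AK; ring.
have pl0 a b : pl a b = 0 -> a = 0 /\ b = 0.
  move=> h; have : dot (pl a b) (pl a b) = 0 by rewrite h dot0l.
  rewrite dpl => /eqP; rewrite mulf_eq0 gt_eqF //= -!expr2 paddr_eq0 ?sqr_ge0 //.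
  by rewrite !sqrf_eq0 => /andP[/eqP -> /eqP ->].
have sub a b c d : pl a b - pl c d = pl (a - c) (b - d).
  by rewrite /pl !scalerBl opprD addrACA.
have neg a b : - pl a b = pl (- a) (- b) by rewrite /pl !scaleNr opprD.
have scl (k a b : R) : k *: pl a b = pl (k * a) (k * b) by rewrite /pl scalerDr !scalerA.
have A1 : A = pl 1 0 by rewrite /pl scale1r scale0r addr0.
have [s [r Brs]] : exists s r : R, B = pl s r by do 2 eexists; exact: plE.
have [x [y Nxy]] : exists x y : R, N0 = pl x y by do 2 eexists; exact: plE.
have [z [w Nzw]] : exists z w : R, N1 = pl z w by do 2 eexists; exact: plE.
have AAE : forall c d, dot A (pl c d) = dot A A * c by move=> c d; rewrite {1}A1 dpl; ring.
have AEA : forall c d, dot (pl c d) A = dot A A * c by move=> c d; rewrite dotC AAE.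
rewrite Brs Nxy Nzw !dpl !AAE !AEA in D0 sym gauss.
have ne := lt0r_neq0 a0.
have r0 : r != 0 by apply/eqP => r0; move: D0; rewrite r0; lra.
have zE : z = x * s + y * r by apply: (mulfI ne); rewrite sym.
have G : x * w - y * z = - r.
  apply: (mulfI (expf_neq0 2 ne)); apply: (mulfI r0).
  move: gauss; rewrite zE => gauss; nra.
have [dT dF nT nF ind] := planar_split r0 zE G.
have eT0 : tT 0 = pl (y - 1) (- x) by rewrite T0 Nxy rpl neg A1 sub opprK subr0.
have eT1 : tT 1 = pl (w - s) (- z - r) by rewrite T1 Nzw Brs rpl neg sub opprK.
have eF0 : tF 0 = pl (- y - 1) x by rewrite F0 Nxy rpl A1 sub subr0.
have eF1 : tF 1 = pl (- w - s) (z - r) by rewrite F1 Nzw Brs rpl sub.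
have ord2 (P : 'I_2 -> Prop) : P 0 -> P 1 -> forall i, P i.
  by move=> h0 h1 [[|[|//]] i]; [move: h0|move: h1]; congr P; exact: val_inj.
split.
- have [u [v [e [f [h1 h2 h3 h4]]]]] := det0_collinear dT.
  exists (pl u v), (fun i => if i == 0 then e else f).
  by apply: ord2 => /=; rewrite scl ?eT0 ?eT1 ?h1 ?h2 ?h3 ?h4.
- have [u [v [e [f [h1 h2 h3 h4]]]]] := det0_collinear dF.
  exists (pl u v), (fun i => if i == 0 then e else f).
  by apply: ord2 => /=; rewrite scl ?eF0 ?eF1 ?h1 ?h2 ?h3 ?h4.
- apply/not_existsP => H; apply: nT.
  have := H 0; have := H 1; rewrite eT0 eT1 => /negP/negPn/eqP/pl0[? ?] /negP/negPn/eqP/pl0[? ?].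
  by [].
- apply/not_existsP => H; apply: nF.
  have := H 0; have := H 1; rewrite eF0 eF1 => /negP/negPn/eqP/pl0[? ?] /negP/negPn/eqP/pl0[? ?].
  by [].
have key a b c d : (a = y - 1 /\ b = - x) \/ (a = w - s /\ b = - z - r) ->
    (c = - y - 1 /\ d = x) \/ (c = - w - s /\ d = z - r) ->
    pl a b != 0 -> pl c d != 0 -> dot (rot X N (pl a b)) (pl c d) != 0.
  move=> h1 h2 n1 n2; rewrite rpl dpl mulf_neq0 //; apply/eqP => h3.
  have h4 : a * d = b * c by lra.
  case: (ind a b c d h1 h2 h4) => -[z1 z2].
    by move: n1; rewrite z1 z2 /pl !scale0r addr0 eqxx.
  by move: n2; rewrite z1 z2 /pl !scale0r addr0 eqxx.
by apply: (ord2 _); apply: (ord2 _); rewrite ?eT0 ?eT1 ?eF0 ?eF1; apply: key; by [left|right].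
Qed.

End Unit.

End Frame.

(** * Partial derivatives of vector valued maps *)

Section VPartial.
Variable R : realType.
Implicit Types (p q : 'rV[R]_2) (f g : 'rV[R]_2 -> R) (V W : 'rV[R]_2 -> 'rV[R]_4) (i j : 'I_2).

Lemma partial_near f g q i : (\forall u \near q, f u = g u) -> partial i f q = partial i g q.
Proof. exact: near_eq_derive. Qed.

Lemma partial_cst (a : R) q i : partial i (fun=> a) q = 0.
Proof. exact: derive_cst. Qed.

Lemma partialD f g q i : analytic f q -> analytic g q ->
  partial i (fun u => f u + g u) q = partial i f q + partial i g q.
Proof.
move=> /analytic_differentiable/diff_derivable Df /analytic_differentiable/diff_derivable Dg.
exact: deriveD.
Qed.

Lemma partialN f q i : analytic f q -> partial i (fun u => - f u) q = - partial i f q.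
Proof. by move=> /analytic_differentiable/diff_derivable Df; exact: deriveN. Qed.

Lemma partialM f g q i : analytic f q -> analytic g q ->
  partial i (fun u => f u * g u) q = partial i f q * g q + f q * partial i g q.
Proof.
move=> /analytic_differentiable/diff_derivable Df /analytic_differentiable/diff_derivable Dg.
have := deriveM (Df (delta_mx 0 i)) (Dg (delta_mx 0 i)).
by rewrite /partial /GRing.scale /= => ->; rewrite addrC mulrC.
Qed.

Definition vpartial i V q : 'rV[R]_4 := \row_k partial i (fun u => V u 0 k) q.

Definition vanalytic V q := forall k, analytic (fun u => V u 0 k) q.

Lemma vpartial_coord i V k : (fun u => vpartial i V u 0 k) = partial i (fun u => V u 0 k).
Proof. by apply/funext => u; rewrite mxE. Qed.

Lemma vanalytic_partial i V q : vanalytic V q -> vanalytic (vpartial i V) q.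
Proof. by move=> H k; rewrite vpartial_coord; exact: analytic_partial. Qed.

Lemma vpartialC V q i j : vanalytic V q ->
  vpartial i (vpartial j V) q = vpartial j (vpartial i V) q.
Proof.
move=> H; apply/rowP => k; rewrite [LHS]mxE [RHS]mxE.
by rewrite (vpartial_coord j V k) (vpartial_coord i V k); exact: partialC.
Qed.

Lemma analytic_dot V W q : vanalytic V q -> vanalytic W q -> analytic (fun u => dot (V u) (W u)) q.
Proof. by move=> HV HW; apply: analytic_sum => k; exact: analyticM. Qed.

Lemma partialB f g q i : analytic f q -> analytic g q ->
  partial i (fun u => f u - g u) q = partial i f q - partial i g q.
Proof. by move=> Hf Hg; rewrite (partialD i Hf (analyticN Hg)) (partialN i Hg). Qed.

Lemma partial_sum n (f : 'I_n -> 'rV[R]_2 -> R) q i : (forall l, analytic (f l) q) ->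
  partial i (fun u => \sum_l f l u) q = \sum_l partial i (f l) q.
Proof.
elim: n f => [|n IH] f H.
  by rewrite big_ord0; under eq_fun do rewrite big_ord0; exact: partial_cst.
under eq_fun do rewrite big_ord_recl.
rewrite big_ord_recl (partialD i (H ord0) (analytic_sum (fun l => H (lift ord0 l)))).
by rewrite (IH (fun l => f (lift ord0 l))).
Qed.

Lemma partial_dot V W q i : vanalytic V q -> vanalytic W q ->
  partial i (fun u => dot (V u) (W u)) q = dot (vpartial i V q) (W q) + dot (V q) (vpartial i W q).
Proof.
move=> HV HW; rewrite /dot.
rewrite (partial_sum i (fun k => analyticM (HV k) (HW k))) -big_split /=.
by apply: eq_bigr => k _; rewrite (partialM i (HV k) (HW k)) !mxE.
Qed.

Lemma vec4_coord (a b c d : 'rV[R]_2 -> R) q :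
  analytic a q -> analytic b q -> analytic c q -> analytic d q ->
  vanalytic (fun u => vec4 (a u) (b u) (c u) (d u)) q.
Proof.
by move=> *; apply: ord4P; under eq_fun do rewrite vec4E.
Qed.

Lemma vanalytic_qmul V W q : vanalytic V q -> vanalytic W q ->
  vanalytic (fun u => qmul (V u) (W u)) q.
Proof.
move=> HV HW; have H k l := analyticM (HV k) (HW l).
apply: vec4_coord.
- exact: analyticB (analyticB (analyticB (H k0 k0) (H k1 k1)) (H k2 k2)) (H k3 k3).
- exact: analyticB (analyticD (analyticD (H k0 k1) (H k1 k0)) (H k2 k3)) (H k3 k2).
- exact: analyticD (analyticD (analyticB (H k0 k2) (H k1 k3)) (H k2 k0)) (H k3 k1).
- exact: analyticD (analyticB (analyticD (H k0 k3) (H k1 k2)) (H k2 k1)) (H k3 k0).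
Qed.

Lemma vanalytic_qconj V q : vanalytic V q -> vanalytic (fun u => qconj (V u)) q.
Proof. by move=> HV; apply: vec4_coord; do ?[exact: HV|apply: analyticN]. Qed.

Lemma vanalyticD V W q : vanalytic V q -> vanalytic W q -> vanalytic (fun u => V u + W u) q.
Proof.
move=> HV HW k; have -> : (fun u => (V u + W u) 0 k) = (fun u => V u 0 k + W u 0 k).
  by apply/funext => u; rewrite mxE.
exact: analyticD.
Qed.

Lemma vanalyticZ f V q : analytic f q -> vanalytic V q -> vanalytic (fun u => f u *: V u) q.
Proof.
move=> Hf HV k; have -> : (fun u => (f u *: V u) 0 k) = (fun u => f u * V u 0 k).
  by apply/funext => u; rewrite mxE.
exact: analyticM.
Qed.

Lemma vpartial_qmul V W q i : vanalytic V q -> vanalytic W q ->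
  vpartial i (fun u => qmul (V u) (W u)) q =
  qmul (vpartial i V q) (W q) + qmul (V q) (vpartial i W q).
Proof.
move=> HV HW.
have H k l : analytic (fun u => V u 0 k * W u 0 l) q by exact: analyticM.
have PM k l : partial i (fun u => V u 0 k * W u 0 l) q =
    vpartial i V q 0 k * W q 0 l + V q 0 k * vpartial i W q 0 l.
  by rewrite partialM ?mxE.
apply: eq4; rewrite [LHS]mxE [RHS]mxE !vec4E; under eq_fun do rewrite vec4E.
- rewrite (partialB i (analyticB (analyticB (H k0 k0) (H k1 k1)) (H k2 k2)) (H k3 k3)).
  rewrite (partialB i (analyticB (H k0 k0) (H k1 k1)) (H k2 k2)) (partialB i (H k0 k0) (H k1 k1)).
  by rewrite !PM; ring.
- rewrite (partialB i (analyticD (analyticD (H k0 k1) (H k1 k0)) (H k2 k3)) (H k3 k2)).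
  rewrite (partialD i (analyticD (H k0 k1) (H k1 k0)) (H k2 k3)) (partialD i (H k0 k1) (H k1 k0)).
  by rewrite !PM; ring.
- rewrite (partialD i (analyticD (analyticB (H k0 k2) (H k1 k3)) (H k2 k0)) (H k3 k1)).
  rewrite (partialD i (analyticB (H k0 k2) (H k1 k3)) (H k2 k0)) (partialB i (H k0 k2) (H k1 k3)).
  by rewrite !PM; ring.
- rewrite (partialD i (analyticB (analyticD (H k0 k3) (H k1 k2)) (H k2 k1)) (H k3 k0)).
  rewrite (partialB i (analyticD (H k0 k3) (H k1 k2)) (H k2 k1)) (partialD i (H k0 k3) (H k1 k2)).
  by rewrite !PM; ring.
Qed.

Lemma vpartial_qconj V q i : vanalytic V q ->
  vpartial i (fun u => qconj (V u)) q = qconj (vpartial i V q).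
Proof.
by move=> HV; apply: eq4; rewrite [LHS]mxE vec4E; under eq_fun do rewrite vec4E;
  rewrite ?partialN ?mxE.
Qed.

End VPartial.

(** * The metric and its Christoffel symbols *)

Section Jacobian.
Variable R : realType.
Implicit Types (p q : 'rV[R]_2) (i j : 'I_2).

Lemma rowfun_differentiable m (V : 'rV[R]_2 -> 'rV[R]_m) q :
  (forall k, analytic (fun u => V u 0 k) q) -> differentiable V q.
Proof.
move=> H; have -> : V = \sum_(k < m) (fun u => V u 0 k *: (delta_mx 0 k : 'rV[R]_m)).
  apply/funext => u; rewrite fct_sumE; apply/rowP => l; rewrite summxE (bigD1 l) //= !mxE !eqxx mulr1.
  rewrite big1 ?addr0 // => k kl; rewrite !mxE eqxx /= eq_sym (negbTE kl) mulr0 //.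
apply: differentiable_sum => k; apply: differentiableZl.
exact: analytic_differentiable (H k).
Qed.

Lemma jacobianE m (V : 'rV[R]_2 -> 'rV[R]_m) q i k :
  (forall k, analytic (fun u => V u 0 k) q) -> 'J V q i k = partial i (fun u => V u 0 k) q.
Proof.
move=> H; have D := rowfun_differentiable H.
rewrite mxE -deriveE // derive_mx ?mxE //.
exact: diff_derivable.
Qed.

Lemma sum2 (W : zmodType) (f : 'I_2 -> W) : \sum_i f i = f 0 + f 1.
Proof. by rewrite !big_ord_recl big_ord0 addr0; congr (_ + f _); exact: val_inj. Qed.

(** The determinant is passed as a variable so that it can be the Gram
    determinant without unfolding. *)
Lemma invmx_sym2 (G : 'M[R]_2) (a b c d : R) :
  G 0 0 = a -> G 0 1 = b -> G 1 0 = b -> G 1 1 = c -> d = a * c - b ^+ 2 -> d != 0 ->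
  [/\ invmx G 0 0 = c / d, invmx G 0 1 = - b / d,
      invmx G 1 0 = - b / d & invmx G 1 1 = a / d].
Proof.
move=> Ga Gb Gb' Gc dE d0; pose H : 'M[R]_2 := \matrix_(i, j)
  ((if i == 0 then if j == 0 then c else - b
    else if j == 0 then - b else a) / d).
have GH : G *m H = 1%:M.
  have ord2 (P : 'I_2 -> Prop) : P 0 -> P 1 -> forall i, P i.
    by move=> h0 h1 [[|[|//]] k]; [move: h0|move: h1]; congr P; exact: val_inj.
  apply/matrixP; apply: (ord2 _); apply: (ord2 _);
    by rewrite !mxE sum2 !mxE /= ?Ga ?Gb ?Gb' ?Gc; rewrite dE in d0 *; field.
have UG : G \in unitmx by have [] := mulmx1_unit GH.
have -> : invmx G = H by rewrite -[LHS]mulmx1 -GH mulmxA mulVmx // mul1mx.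
by split; rewrite !mxE.
Qed.

End Jacobian.

Section Gauss.
Variables (R : realType) (U : set 'rV[R]_2) (X : 'rV[R]_2 -> 'rV[R]_4).
Hypotheses (oU : open U) (Xa : forall q, U q -> vanalytic X q)
  (XX : forall q, U q -> dot (X q) (X q) = 1).
Implicit Types (p q : 'rV[R]_2) (i j k l : 'I_2).

Definition X1 i := vpartial i X.
Definition X2 i j := vpartial i (vpartial j X).
Definition gm i j q := dot (X1 i q) (X1 j q).
Definition gdet q := gm 0 0 q * gm 1 1 q - gm 0 1 q ^+ 2.

Hypothesis reg : forall q, U q -> 0 < gdet q.

Lemma nearU q : U q -> \forall u \near q, U u.
Proof. by move=> Uq; exact: open_nbhs_nbhs. Qed.

Lemma X1a i q : U q -> vanalytic (X1 i) q.
Proof. by move=> /Xa; exact: vanalytic_partial. Qed.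

Lemma X2a i j q : U q -> vanalytic (X2 i j) q.
Proof. by move=> /(X1a j); exact: vanalytic_partial. Qed.

Lemma X2C i j q : U q -> X2 i j q = X2 j i q.
Proof. by move=> /Xa; exact: vpartialC. Qed.

Lemma X1X i q : U q -> dot (X1 i q) (X q) = 0.
Proof.
move=> Uq; have := partial_dot i (Xa Uq) (Xa Uq).
rewrite (@partial_near _ _ (fun=> 1)); last first.
  by apply: filterS (nearU Uq) => u /XX.
by rewrite partial_cst (dotC (X q)) -/(X1 i q) => h; lra.
Qed.

Lemma X2X i j q : U q -> dot (X2 i j q) (X q) = - gm i j q.
Proof.
move=> Uq; have := partial_dot i (X1a j Uq) (Xa Uq).
rewrite (@partial_near _ _ (fun=> 0)); last first.
  by apply: filterS (nearU Uq) => u /(X1X j).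
rewrite partial_cst -/(X1 i q) -/(X2 i j q) /gm (dotC (X1 j q)) => h; lra.
Qed.

Lemma gmC i j q : gm i j q = gm j i q.
Proof. exact: dotC. Qed.

Lemma partial_gm k i j q : U q ->
  partial k (gm i j) q = dot (X2 k i q) (X1 j q) + dot (X1 i q) (X2 k j q).
Proof. by move=> Uq; exact: (partial_dot k (X1a i Uq) (X1a j Uq)). Qed.

Lemma induced_metricE q i j : U q -> induced_metric X q i j = gm i j q.
Proof.
move=> Uq; rewrite /induced_metric mxE; apply: eq_bigr => k _.
by rewrite [('J X q)^T _ _]mxE (jacobianE i k (Xa Uq)) (jacobianE j k (Xa Uq)) /X1 !mxE.
Qed.

Lemma partial_metric k i j q : U q ->
  partial k (fun u => induced_metric X u i j) q = partial k (gm i j) q.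
Proof.
by move=> Uq; apply: partial_near; apply: filterS (nearU Uq) => u; exact: induced_metricE.
Qed.

(** Christoffel symbols of the first kind of the induced metric; see koszul. *)
Definition gam1 l i j q := dot (X2 i j q) (X1 l q).
(** The Christoffel symbols of the second kind, by Cramer's rule for the 2 by 2
    Gram matrix. *)
Definition gam2 k i j q :=
  (if k == 0 then gm 1 1 q * gam1 0 i j q - gm 0 1 q * gam1 1 i j q
   else gm 0 0 q * gam1 1 i j q - gm 0 1 q * gam1 0 i j q) / gdet q.

(** For the metric induced by X the first order terms of the Christoffel symbols
    collapse to the scalar product of d_i d_j X with d_l X. *)
Lemma koszul i j l q : U q ->
  partial i (fun u => induced_metric X u j l) q + partial j (fun u => induced_metric X u i l) q
  - partial l (fun u => induced_metric X u i j) q = 2 * gam1 l i j q.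
Proof.
move=> Uq; rewrite (partial_metric i j l Uq) (partial_metric j i l Uq) (partial_metric l i j Uq).
rewrite (partial_gm i j l Uq) (partial_gm j i l Uq) (partial_gm l i j Uq) /gam1.
rewrite (X2C j i Uq) (X2C l i Uq) (X2C l j Uq) (dotC (X1 j q)).
have E (a b c : R) : a + b + (a + c) - (b + c) = 2 * a by ring.
exact: E.
Qed.

Lemma christoffelE k i j q : U q -> christoffel (induced_metric X) k i j q = gam2 k i j q.
Proof.
move=> Uq; rewrite /christoffel sum2 (koszul i j 0 Uq) (koszul i j 1 Uq).
have d0 : gdet q != 0 by rewrite gt_eqF // reg.
have [i00 i01 i10 i11] := invmx_sym2 (induced_metricE 0 0 Uq) (induced_metricE 0 1 Uq)
  (etrans (induced_metricE 1 0 Uq) (gmC 1 0 q)) (induced_metricE 1 1 Uq) (erefl (gdet q)) d0.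
rewrite /gam2; have [->|k1] : k = 0 \/ k = 1.
- by case: k => -[|[|//]] ?; [left|right]; apply: val_inj.
- rewrite eqxx i00 i01.
  have E (a b c e d : R) : d != 0 -> 2^-1 * (c / d * (2 * a) + - e / d * (2 * b)) = (c * a - e * b) / d.
    by move=> ?; field.
  exact: E.
- rewrite k1 /= i10 i11.
  have E (a b c e d : R) : d != 0 -> 2^-1 * (- e / d * (2 * a) + c / d * (2 * b)) = (c * b - e * a) / d.
    by move=> ?; field.
  exact: E.
Qed.

Lemma gam2_gm i j l q : U q -> gam2 0 i j q * gm 0 l q + gam2 1 i j q * gm 1 l q = gam1 l i j q.
Proof.
move=> Uq; have : gdet q != 0 by rewrite gt_eqF // reg.
rewrite /gam2 /= /gdet; have [->|->] : l = 0 \/ l = 1.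
- by case: l => -[|[|//]] ?; [left|right]; apply: val_inj.
- rewrite (gmC 1 0) => d0.
  have E (a b c d e : R) : c * e - d ^+ 2 != 0 ->
    (e * a - d * b) / (c * e - d ^+ 2) * c + (c * b - d * a) / (c * e - d ^+ 2) * d = a.
    by move=> ?; field.
  exact: E.
- move=> d0.
  have E (a b c d e : R) : c * e - d ^+ 2 != 0 ->
    (e * a - d * b) / (c * e - d ^+ 2) * d + (c * b - d * a) / (c * e - d ^+ 2) * e = b.
    by move=> ?; field.
  exact: E.
Qed.

Lemma gm_analytic i j q : U q -> analytic (gm i j) q.
Proof. by move=> Uq; apply: analytic_dot; exact: X1a. Qed.

Lemma gam1_analytic l i j q : U q -> analytic (gam1 l i j) q.
Proof. by move=> Uq; apply: analytic_dot; [exact: X2a|exact: X1a]. Qed.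

Lemma gdet_analytic q : U q -> analytic gdet q.
Proof.
move=> Uq; have H i j := gm_analytic i j Uq.
have := analyticB (analyticM (H 0 0) (H 1 1)) (analyticM (H 0 1) (H 0 1)).
by congr analytic; apply/funext => u; rewrite /gdet expr2.
Qed.

Lemma analyticV_pos (f : 'rV[R]_2 -> R) q : analytic f q -> 0 < f q ->
  analytic (fun u => (f u)^-1) q.
Proof.
move=> fa f0; have h := analytic_invsqrt fa f0; apply: analytic_near (analyticM h h).
have c := analytic_continuous fa; move/cvgrPdist_lt : c => /(_ _ f0).
apply: filterS => u; rewrite ltr_norml => /andP[_ h1].
have fu : 0 < f u by lra.
by rewrite -invfM -expr2 sqr_sqrtr // ltW.
Qed.

Lemma gam2_analytic k i j q : U q -> analytic (gam2 k i j) q.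
Proof.
move=> Uq; have H a b := gm_analytic a b Uq; have G a := gam1_analytic a i j Uq.
have V := analyticV_pos (gdet_analytic Uq) (reg Uq).
rewrite /gam2; case: (k == 0).
  exact: analyticM (analyticB (analyticM (H 1 1) (G 0)) (analyticM (H 0 1) (G 1))) V.
exact: analyticM (analyticB (analyticM (H 0 0) (G 1)) (analyticM (H 0 1) (G 0))) V.
Qed.

End Gauss.

(** * The Gauss equation *)

Section GaussEquation.
Variables (R : realType) (U : set 'rV[R]_2) (X : 'rV[R]_2 -> 'rV[R]_4).
Hypotheses (oU : open U) (Xa : forall q, U q -> vanalytic X q)
  (XX : forall q, U q -> dot (X q) (X q) = 1)
  (reg : forall q, U q -> 0 < gdet X q).
Implicit Types (p q : 'rV[R]_2) (i j k l : 'I_2).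

Lemma gam2C k i j q : U q -> gam2 X k i j q = gam2 X k j i q.
Proof. by move=> Uq; rewrite /gam2 /gam1 (X2C Xa i j Uq). Qed.

Lemma partial_gam1 m l i j q : U q ->
  partial m (gam1 X l i j) q = dot (vpartial m (X2 X i j) q) (X1 X l q) + dot (X2 X i j q) (X2 X m l q).
Proof. by move=> Uq; exact: (partial_dot m (X2a Xa i j Uq) (X1a Xa l Uq)). Qed.

Lemma partial_gam2_gm m i j q : U q ->
  partial m (gam2 X 0 i j) q * gm X 0 0 q + gam2 X 0 i j q * partial m (gm X 0 0) q
  + (partial m (gam2 X 1 i j) q * gm X 1 0 q + gam2 X 1 i j q * partial m (gm X 1 0) q)
  = partial m (gam1 X 0 i j) q.
Proof.
move=> Uq.
have G k := gam2_analytic Xa reg k i j Uq; have H k l := gm_analytic Xa k l Uq.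
have h0 := partialM m (G 0) (H 0 0); have h1 := partialM m (G 1) (H 1 0).
have h := partialD m (analyticM (G 0) (H 0 0)) (analyticM (G 1) (H 1 0)).
apply: etrans (etrans (f_equal2 +%R (esym h0) (esym h1)) (esym h)) _.
apply: partial_near; apply: filterS (nearU oU Uq) => u Uu.
exact: (gam2_gm reg i j 0 Uu).
Qed.

(** The algebra of the Gauss equation. Contracting the two components of the
    curvature (first two hypotheses) with the metric and replacing derivatives of
    second kind symbols by those of first kind symbols leaves only second
    derivatives of X: the third derivatives, both equal to T, cancel. *)
Lemma gauss_scalar (a0 a1 b0 b1 c0 c1 da0 da1 db0 db1 g00 g10 T Q S P00 P01 P11 v00 v01
    x1 x2 x3 y1 y2 y3 : R) :
  da0 - db0 + ((c0 * a0 - b0 * b0) + (b0 * a1 - a0 * b1)) = 0 ->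
  da1 - db1 + ((c1 * a0 - b1 * b0) + (b1 * a1 - a1 * b1)) = 0 ->
  da0 * g00 + a0 * x1 + (da1 * g10 + a1 * x2) = x3 ->
  db0 * g00 + b0 * y1 + (db1 * g10 + b1 * y2) = y3 ->
  x1 = P00 + P00 -> x2 = P01 + v00 -> x3 = T + Q ->
  y1 = P01 + P01 -> y2 = P11 + v01 -> y3 = T + S ->
  c0 * g00 + c1 * g10 = P00 -> b0 * g00 + b1 * g10 = P01 -> a0 * g00 + a1 * g10 = P11 ->
  Q - S - (a0 * P00 + a1 * v00) + (b0 * P01 + b1 * v01) = 0.
Proof.
move=> r0 r1 da db ex1 ex2 ex3 ey1 ey2 ey3 hc hb ha.
rewrite ex1 ex2 ex3 in da; rewrite ey1 ey2 ey3 in db.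
have e0 : (da0 - db0 + ((c0 * a0 - b0 * b0) + (b0 * a1 - a0 * b1))) * g00 = 0 by rewrite r0 mul0r.
have e1 : (da1 - db1 + ((c1 * a0 - b1 * b0) + (b1 * a1 - a1 * b1))) * g10 = 0 by rewrite r1 mul0r.
move: da db; rewrite -hc -hb -ha => da db; lra.
Qed.

(** The curvature component R(d_0, d_1) d_1 lowered along d_0, in terms of second
    derivatives of X: it is <X11, X00> - <X01, X01> minus the same expression for
    the tangential parts. *)
Lemma gauss_contracted p : U p ->
  (forall l k i j, riemann (induced_metric X) l k i j p = 0) ->
  dot (X2 X 1 1 p) (X2 X 0 0 p) - dot (X2 X 0 1 p) (X2 X 0 1 p)
  - (gam2 X 0 1 1 p * dot (X2 X 0 0 p) (X1 X 0 p) + gam2 X 1 1 1 p * dot (X1 X 1 p) (X2 X 0 0 p))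
  + (gam2 X 0 0 1 p * dot (X2 X 0 1 p) (X1 X 0 p) + gam2 X 1 0 1 p * dot (X1 X 1 p) (X2 X 0 1 p)) = 0.
Proof.
move=> Up flat.
have C k i j := christoffelE oU Xa reg k i j Up.
have PC m k i j : partial m (christoffel (induced_metric X) k i j) p = partial m (gam2 X k i j) p.
  apply: partial_near; apply: filterS (nearU oU Up) => u Uu.
  exact: (christoffelE oU Xa reg k i j Uu).
have Rl l : partial 0 (gam2 X l 1 1) p - partial 1 (gam2 X l 0 1) p
    + ((gam2 X l 0 0 p * gam2 X 0 1 1 p - gam2 X l 0 1 p * gam2 X 0 0 1 p)
    + (gam2 X l 0 1 p * gam2 X 1 1 1 p - gam2 X l 1 1 p * gam2 X 1 0 1 p)) = 0.
  have := flat l 1 0 1; rewrite /riemann sum2.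
  rewrite (PC 0 l 1 1) (PC 1 l 0 1) (C l 0 0) (C 0 1 1) (C l 1 0) (C 0 0 1) (C l 0 1) (C 1 1 1) (C l 1 1) (C 1 0 1).
  by rewrite (gam2C l 1 0 Up).
have D0 := partial_gam2_gm 0 1 1 Up; have D1 := partial_gam2_gm 1 0 1 Up.
have third : vpartial 0 (X2 X 1 1) p = vpartial 1 (X2 X 0 1) p := vpartialC 0 1 (X1a Xa 1 Up).
have S10 := X2C Xa 1 0 Up.
have x1 := etrans (partial_gm Xa 0 0 0 Up) (f_equal2 +%R erefl (dotC _ _)).
have x2 := partial_gm Xa 0 1 0 Up.
have x3 := etrans (partial_gam1 0 0 1 1 Up) (f_equal2 +%R (f_equal2 (@dot R) third erefl) erefl).
have y1 := etrans (partial_gm Xa 1 0 0 Up) (f_equal2 +%R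
  (f_equal2 (@dot R) S10 erefl) (etrans (dotC _ _) (f_equal2 (@dot R) S10 erefl))).
have y2 := etrans (partial_gm Xa 1 1 0 Up) (f_equal2 +%R erefl (f_equal2 (@dot R) erefl S10)).
have y3 := etrans (partial_gam1 1 0 0 1 Up) (f_equal2 +%R erefl (f_equal2 (@dot R) erefl S10)).
have K00 := gam2_gm reg 0 0 0 Up; have K01 := gam2_gm reg 0 1 0 Up; have K11 := gam2_gm reg 1 1 0 Up.
exact: (gauss_scalar (Rl 0) (Rl 1) D0 D1 x1 x2 x3 y1 y2 y3 K00 K01 K11).
Qed.

End GaussEquation.

Section Pointwise.
Variable R : realType.
Implicit Types (x n a b v w : 'rV[R]_4).

Lemma ord2P (P : 'I_2 -> Prop) : P 0 -> P 1 -> forall i, P i.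
Proof. by move=> h0 h1 [[|[|//]] k]; [move: h0|move: h1]; congr P; exact: val_inj. Qed.

(** The cross product of a and b in the tangent space of the 3-sphere at x: the
    correction term removes the component along x. *)
Definition qcross x a b := qmul (qmul a (qconj x)) b + dot a b *: x.

Section Cross.
Variables (x a b : 'rV[R]_4).
Hypotheses (xx : dot x x = 1) (ax : dot a x = 0) (bx : dot b x = 0).
Let xa : dot x a = 0. Proof. by rewrite dotC. Qed.
Let xb : dot x b = 0. Proof. by rewrite dotC. Qed.

Lemma qcross_x : dot (qcross x a b) x = 0.
Proof. by rewrite dotDl dotZl dot_triple_mid xx xb ax; ring. Qed.

Lemma qcross_a : dot (qcross x a b) a = 0.
Proof. by rewrite dotDl dotZl dot_triple_last xb xa !mulr0 addr0. Qed.

Lemma qcross_b : dot (qcross x a b) b = 0.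
Proof. by rewrite dotDl dotZl dot_triple_first ax xb !mulr0 addr0. Qed.

Lemma qcross_norm : dot (qcross x a b) (qcross x a b) = dot a a * dot b b - dot a b ^+ 2.
Proof.
(* by qcross_x only the first term of the right factor contributes *)
rewrite {2}/qcross dotDr (dotZr _ _ x) qcross_x mulr0 addr0 /qcross dotDl dotZl.
rewrite !dot_qmul dot_qconj xx (dotC x) dot_triple_mid xx xb ax; ring.
Qed.

Lemma qcross_self u : dot u x = 0 -> qcross x u u = 0.
Proof.
move=> ux; rewrite /qcross qmul_sandwich ux mulr0 scale0r sub0r; exact: addNr.
Qed.

Lemma qcrossDl u v w : qcross x (u + v) w = qcross x u w + qcross x v w.
Proof. by rewrite /qcross !qmulDl dotDl scalerDl addrACA. Qed.

Lemma qcrossDr u v w : qcross x u (v + w) = qcross x u v + qcross x u w.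
Proof. by rewrite /qcross !qmulDr dotDr scalerDl addrACA. Qed.

Lemma qcrossZl (k : R) u v : qcross x (k *: u) v = k *: qcross x u v.
Proof. by rewrite /qcross !qmulZl dotZl scalerDr scalerA. Qed.

Lemma qcrossZr (k : R) u v : qcross x u (k *: v) = k *: qcross x u v.
Proof. by rewrite /qcross !qmulZr dotZr scalerDr scalerA. Qed.

Lemma qcross_swap : qcross x b a = - qcross x a b.
Proof.
have abx : dot (a + b) x = 0 by rewrite dotDl ax bx addr0.
have := qcross_self abx; rewrite qcrossDl !qcrossDr (qcross_self ax) (qcross_self bx) add0r addr0.
by rewrite addrC => /eqP; rewrite addr_eq0 => /eqP.
Qed.

(** Bilinear and alternating, hence multiplied by the determinant. *)
Lemma qcross_basechange (c00 c01 c10 c11 : R) :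
  qcross x (c00 *: a + c01 *: b) (c10 *: a + c11 *: b) = (c00 * c11 - c01 * c10) *: qcross x a b.
Proof.
rewrite qcrossDl !qcrossDr !qcrossZl !qcrossZr (qcross_self ax) (qcross_self bx) qcross_swap.
by rewrite !scaler0 add0r addr0 !scalerN !scalerA -scaleNr -scalerDl; congr (_ *: _); ring.
Qed.
End Cross.

Lemma normal_expand x n a b v : dot x x = 1 -> dot n n = 1 -> dot x n = 0 ->
  tangent x n a -> tangent x n b -> 0 < dot a a * dot b b - dot a b ^+ 2 ->
  dot v a = 0 -> dot v b = 0 -> v = dot v x *: x + dot v n *: n.
Proof.
move=> xx nn xn ta tb D0 va vb.
have nx : dot n x = 0 by rewrite dotC.
pose w := v - (dot v x *: x + dot v n *: n).
have a0 : a != 0 by apply/eqP => a0; move: D0; rewrite a0 !dot0l; lra.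
have aa0 : dot a a != 0 by apply: contra a0 => /eqP/dot_eq0 ->.
have tw : tangent x n w.
  by split; rewrite dotBl dotDl !dotZl ?xx ?nn ?xn ?nx; ring.
have [ax an] := ta; have [bx bn] := tb.
have wa : dot w a = 0 by rewrite dotBl dotDl !dotZl va (dotC x) (dotC n) ax an; ring.
have wb : dot w b = 0 by rewrite dotBl dotDl !dotZl vb (dotC x) (dotC n) bx bn; ring.
have wE := tangent_expand xx nn xn ta a0 tw.
rewrite wa mul0r scale0r add0r in wE.
have bE := tangent_expand xx nn xn ta a0 tb.
have {wE} [om wE] : exists om : R, w = om *: rot x n a by eexists; exact: wE.
have {bE} [al [be bE]] : exists al be : R, b = al *: a + be *: rot x n a by do 2 eexists; exact: bE.
have om0 : om = 0.
  have := wb; rewrite bE wE dotZl dotDr !dotZr (dot_rot_self xn) (dot_rot xx nn) mulr0 add0r.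
  move=> /eqP; rewrite !mulf_eq0 (negbTE aa0) orbF => /orP[/eqP//|/eqP be0].
  by move: D0; rewrite bE be0 scale0r addr0 !dotZl !dotZr => h; exfalso; lra.
apply/eqP; rewrite -subr_eq0 -/w wE om0 scale0r //.
Qed.

(** The second derivatives minus their tangential parts are combinations of x and
    n. Their components along x are given by the metric and contribute its
    determinant, so the components along n, which form the second fundamental
    form, have determinant minus that of the metric. *)
Lemma gauss_pointwise x n a b v00 v01 v11 (c0 c1 b0 b1 : R) :
  dot x x = 1 -> dot n n = 1 -> dot x n = 0 ->
  tangent x n a -> tangent x n b -> 0 < dot a a * dot b b - dot a b ^+ 2 ->
  dot v00 x = - dot a a -> dot v01 x = - dot a b -> dot v11 x = - dot b b ->
  dot (v11 - (c0 *: a + c1 *: b)) a = 0 -> dot (v11 - (c0 *: a + c1 *: b)) b = 0 ->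
  dot (v01 - (b0 *: a + b1 *: b)) a = 0 -> dot (v01 - (b0 *: a + b1 *: b)) b = 0 ->
  dot v11 v00 - dot v01 v01 - (c0 * dot v00 a + c1 * dot b v00)
    + (b0 * dot v01 a + b1 * dot b v01) = 0 ->
  dot v00 n * dot v11 n - dot v01 n ^+ 2 = - (dot a a * dot b b - dot a b ^+ 2).
Proof.
move=> xx nn xn ta tb D0 h00 h01 h11 p1 p2 p3 p4 G.
have [ax an] := ta; have [bx bn] := tb.
have E1 := normal_expand xx nn xn ta tb D0 p1 p2.
have E2 := normal_expand xx nn xn ta tb D0 p3 p4.
have X1 : dot (v11 - (c0 *: a + c1 *: b)) v00 = dot v11 x * dot v00 x + dot v11 n * dot v00 n.
  rewrite E1 !(dotDl, dotNl, dotZl) ax bx an bn (dotC x) (dotC n); ring.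
have X2 : dot (v01 - (b0 *: a + b1 *: b)) v01 = dot v01 x * dot v01 x + dot v01 n * dot v01 n.
  rewrite E2 !(dotDl, dotNl, dotZl) ax bx an bn (dotC x) (dotC n); ring.
rewrite dotBl dotDl !dotZl h11 h00 (dotC a) in X1.
rewrite dotBl dotDl !dotZl h01 (dotC a) in X2.
move: (dot v11 v00) (dot v01 v01) (dot v00 a) (dot b v00) (dot v01 a) (dot b v01) (dot v11 n) (dot v00 n) (dot v01 n)
  (dot a a) (dot b b) (dot a b) G X1 X2 => *; lra.
Qed.

End Pointwise.

(** * The two Gauss maps *)

Section GaussMaps.
Variable R : realType.
Implicit Types (x n v w : 'rV[R]_4).

(** The two Gauss maps: for orthogonal unit quaternions both products are imaginary
    of norm one. *)
Definition nmap (b : bool) x n := if b then qmul n (qconj x) else qmul (qconj x) n.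

(** Multiplication by n on the side that brings the derivative of the Gauss map b
    back to the tangent plane of the surface. *)
Definition tmap (b : bool) n v := if b then qmul v n else qmul n v.

(** The orientation of the plane given by the ordered pair of tangent vectors that
    correspond to velocities v, w of the two Gauss maps: the scalar product of the
    second with the rotated first. *)
Definition sigma x n v w := dot (rot x n (tmap true n v)) (tmap false n w).

Definition tinv (b : bool) n v := if b then qmul v (qconj n) else qmul (qconj n) v.

Lemma tmapK b n v : dot n n = 1 -> tinv b n (tmap b n v) = v.
Proof. by move=> nn; case: b; rewrite /= ?qmul_conjrr ?qmul_conjlr nn scale1r. Qed.

Lemma tinvZ b n (k : R) v : tinv b n (k *: v) = k *: tinv b n v.
Proof. by case: b; rewrite /= ?qmulZl ?qmulZr. Qed.

Lemma tmapZ b n (k : R) v : tmap b n (k *: v) = k *: tmap b n v.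
Proof. by case: b; rewrite /= ?qmulZl ?qmulZr. Qed.

Lemma tinv0 b n : tinv b n 0 = 0.
Proof. by rewrite -[X in tinv _ _ X](scale0r n) tinvZ scale0r. Qed.

Lemma tmap0 b n : tmap b n 0 = 0.
Proof. by rewrite -[X in tmap _ _ X](scale0r n) tmapZ scale0r. Qed.

Lemma tmapN b n v : tmap b (- n) v = - tmap b n v.
Proof. by rewrite -scaleN1r; case: b; rewrite /= ?qmulZl ?qmulZr scaleN1r. Qed.

Lemma sigmaZ x n (k l : R) v w : sigma x n (k *: v) (l *: w) = k * l * sigma x n v w.
Proof. by rewrite /sigma !tmapZ rotZ dotZl dotZr mulrA. Qed.

(** The normal enters three times, twice through the identification of velocities
    with tangent vectors and once through the rotation. *)
Lemma sigmaN x n v w : sigma x (- n) v w = - sigma x n v w.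
Proof.
have rN u : rot x (- n) u = - rot x n u by rewrite -scaleN1r /rot !qmulZl scaleN1r.
have rN' u : rot x n (- u) = - rot x n u by rewrite -scaleN1r rotZ scaleN1r.
by rewrite /sigma !tmapN rN rN' opprK dotNr.
Qed.

End GaussMaps.

Section ChartSplit.
Variables (R : realType) (U : set 'rV[R]_2) (X : 'rV[R]_2 -> 'rV[R]_4).
Hypotheses (oU : open U) (Xa : forall q, U q -> vanalytic X q)
  (XX : forall q, U q -> dot (X q) (X q) = 1)
  (reg : forall q, U q -> 0 < gdet X q)
  (flat : flat_metric_on (induced_metric X) U).
Implicit Types (p q : 'rV[R]_2) (i j k l : 'I_2).

(** A normal field which, unlike its normalisation, is multiplied by the Jacobian
    determinant under a change of chart. *)
Definition ncross q := qcross (X q) (X1 X 0 q) (X1 X 1 q).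
Definition normal q := (Num.sqrt (gdet X q))^-1 *: ncross q.
Definition gauss_map b q := nmap b (X q) (normal q).

Lemma normal_analytic q : U q -> vanalytic normal q.
Proof.
move=> Uq; apply: vanalyticZ; first exact: analytic_invsqrt (gdet_analytic Xa Uq) (reg Uq).
apply: vanalyticD; last exact: vanalyticZ (gm_analytic Xa 0 1 Uq) (Xa Uq).
apply: vanalytic_qmul (X1a Xa 1 Uq); apply: vanalytic_qmul (X1a Xa 0 Uq) _.
exact: vanalytic_qconj (Xa Uq).
Qed.

Lemma gauss_map_analytic b q : U q -> vanalytic (gauss_map b) q.
Proof.
move=> Uq; have H1 := normal_analytic Uq; have H2 := vanalytic_qconj (Xa Uq).
by case: b; [exact: (vanalytic_qmul H1 H2)|exact: (vanalytic_qmul H2 H1)].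
Qed.

Lemma normal_unit q : U q -> dot (normal q) (normal q) = 1.
Proof.
move=> Uq; have g0 := reg Uq.
rewrite /normal dotZl dotZr (qcross_norm (XX Uq) (X1X oU Xa XX 0 Uq) (X1X oU Xa XX 1 Uq)).
rewrite -[_ * _ - _]/(gdet X q) mulrA -invfM -expr2 sqr_sqrtr ?ltW // mulVf // gt_eqF //.
Qed.

Lemma normalX q : U q -> dot (X q) (normal q) = 0.
Proof.
move=> Uq; rewrite dotC /normal dotZl.
by rewrite (qcross_x (XX Uq) (X1X oU Xa XX 0 Uq) (X1X oU Xa XX 1 Uq)) mulr0.
Qed.

Lemma normalX1 i q : U q -> dot (X1 X i q) (normal q) = 0.
Proof.
move=> Uq; have h0 := X1X oU Xa XX 0 Uq; have h1 := X1X oU Xa XX 1 Uq.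
rewrite dotC /normal dotZl; move: i; apply: (ord2P _).
  by rewrite (qcross_a h0 h1) mulr0.
by rewrite (qcross_b h0 h1) mulr0.
Qed.

Lemma X1_tangent i q : U q -> tangent (X q) (normal q) (X1 X i q).
Proof. by move=> Uq; split; [exact: (X1X oU Xa XX i Uq)|exact: normalX1]. Qed.

Definition N1 i := vpartial i normal.

Lemma N1_X1 i j q : U q -> dot (N1 i q) (X1 X j q) = - dot (X2 X i j q) (normal q).
Proof.
move=> Uq; have := partial_dot i (X1a Xa j Uq) (normal_analytic Uq).
rewrite (@partial_near _ _ (fun=> 0)); last first.
  by apply: filterS (nearU oU Uq) => u /(normalX1 j).
rewrite partial_cst => h; rewrite (dotC (N1 i q)).
by apply/eqP; rewrite -addr_eq0 addrC; apply/eqP; exact: (esym h).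
Qed.

Lemma N1_tangent i q : U q -> tangent (X q) (normal q) (N1 i q).
Proof.
move=> Uq; split.
  have := partial_dot i (Xa Uq) (normal_analytic Uq).
  rewrite (@partial_near _ _ (fun=> 0)); last first.
    by apply: filterS (nearU oU Uq) => u /normalX.
  rewrite partial_cst -/(X1 X i q) (normalX1 i Uq) add0r (dotC (X q)) => h; exact: (esym h).
have := partial_dot i (normal_analytic Uq) (normal_analytic Uq).
rewrite (@partial_near _ _ (fun=> 1)); last first.
  by apply: filterS (nearU oU Uq) => u /normal_unit.
rewrite partial_cst (dotC (normal q)) -/(N1 i q) => h; lra.
Qed.

Lemma gauss_normal q : U q ->
  dot (X2 X 0 0 q) (normal q) * dot (X2 X 1 1 q) (normal q) - dot (X2 X 0 1 q) (normal q) ^+ 2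
  = - gdet X q.
Proof.
move=> Uq; have G := gauss_contracted oU Xa reg Uq (flat Uq).
have P l i j : dot (X2 X i j q - (gam2 X 0 i j q *: X1 X 0 q + gam2 X 1 i j q *: X1 X 1 q)) (X1 X l q) = 0.
  have E (v a b w : 'rV[R]_4) (c d : R) : c * dot a w + d * dot b w = dot v w ->
      dot (v - (c *: a + d *: b)) w = 0.
    by rewrite dotBl dotDl !dotZl => ->; rewrite subrr.
  exact: E (gam2_gm reg i j l Uq).
exact: (gauss_pointwise (XX Uq) (normal_unit Uq) (normalX Uq) (X1_tangent 0 Uq) (X1_tangent 1 Uq)
  (reg Uq) (X2X oU Xa XX 0 0 Uq) (X2X oU Xa XX 0 1 Uq) (X2X oU Xa XX 1 1 Uq)
  (P 0 1 1) (P 1 1 1) (P 0 0 1) (P 1 0 1) G).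
Qed.

(** By the sandwich identities the derivative of the normal turns into its rotation,
    with a sign depending on the side, and that of X into - X1. *)
Lemma tmap_gauss_map b i q : U q -> tmap b (normal q) (vpartial i (gauss_map b) q) =
  (if b then - rot (X q) (normal q) (N1 i q) else rot (X q) (normal q) (N1 i q)) - X1 X i q.
Proof.
move=> Uq; have Ha := normal_analytic Uq; have Xc := vanalytic_qconj (Xa Uq).
have Ci := vpartial_qconj i (Xa Uq).
have s1 : qmul (qmul (normal q) (qconj (X1 X i q))) (normal q) = - X1 X i q.
  by rewrite qmul_sandwich (normal_unit Uq) (dotC (normal q)) (normalX1 i Uq) mulr0 scale0r sub0r scale1r.
have [t1 t2] := N1_tangent i Uq.
have s2 : qmul (qmul (normal q) (qconj (X q))) (N1 i q) + qmul (qmul (N1 i q) (qconj (X q))) (normal q) = 0.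
  rewrite qmul_sandwichD (dotC (normal q)) (normalX Uq) t1 (dotC (normal q)) t2 !mulr0 !scale0r.
  by rewrite addr0 subrr.
case: b; rewrite /tmap /=.
  rewrite (vpartial_qmul i Ha Xc) Ci qmulDl; congr (_ + _); last exact: s1.
  by move: s2 => /eqP; rewrite addrC addr_eq0 => /eqP.
rewrite (vpartial_qmul i Xc Ha) Ci qmulDr !qmulA addrC; congr (_ + _); exact: s1.
Qed.

(** Both Gauss maps have rank exactly one, and their images pull back to two
    independent directions of the surface. *)
Lemma chart_split q : U q ->
  [/\ forall b, exists w (c : 'I_2 -> R), forall i, vpartial i (gauss_map b) q = c i *: w,
      forall b, exists i, vpartial i (gauss_map b) q != 0 &
      forall i j, vpartial i (gauss_map true) q != 0 -> vpartial j (gauss_map false) q != 0 ->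
        sigma (X q) (normal q) (vpartial i (gauss_map true) q) (vpartial j (gauss_map false) q) != 0].
Proof.
move=> Uq; have nn := normal_unit Uq.
pose T b i := tmap b (normal q) (vpartial i (gauss_map b) q).
have TK b i : vpartial i (gauss_map b) q = tinv b (normal q) (T b i) by rewrite tmapK.
have T0 b v : tinv b (normal q) v != 0 -> v != 0.
  by apply: contra => /eqP ->; rewrite tinv0.
have T1 b v : tmap b (normal q) v != 0 -> v != 0.
  by apply: contra => /eqP ->; rewrite tmap0.
have e01 : dot (N1 0 q) (X1 X 1 q) = dot (N1 1 q) (X1 X 0 q).
  apply: etrans (N1_X1 0 1 Uq) (etrans _ (esym (N1_X1 1 0 Uq))).
  exact: (f_equal (fun v => - dot v (normal q)) (X2C Xa 0 1 Uq)).
have G : dot (N1 0 q) (X1 X 0 q) * dot (N1 1 q) (X1 X 1 q) - dot (N1 0 q) (X1 X 1 q) ^+ 2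
    = - gdet X q.
  have E (a b c x y z d : R) : a = - x -> b = - y -> c = - z -> x * y - z ^+ 2 = d ->
      a * b - c ^+ 2 = d by move=> -> -> ->; rewrite mulrNN sqrrN.
  exact: E (N1_X1 0 0 Uq) (N1_X1 1 1 Uq) (N1_X1 0 1 Uq) (gauss_normal Uq).
have tE i : T true i = - rot (X q) (normal q) (N1 i q) - X1 X i q := tmap_gauss_map true i Uq.
have fE i : T false i = rot (X q) (normal q) (N1 i q) - X1 X i q := tmap_gauss_map false i Uq.
have [c1 c2 n1 n2 ind] := flat_split (XX Uq) nn (normalX Uq) (X1_tangent 0 Uq) (X1_tangent 1 Uq)
  (N1_tangent 0 Uq) (N1_tangent 1 Uq) (reg Uq) e01 G (tE 0) (tE 1) (fE 0) (fE 1).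
split.
- move=> b; have [w [c H]] : exists w (c : 'I_2 -> R), forall i, T b i = c i *: w by case: b.
  by exists (tinv b (normal q) w), c => i; rewrite TK H tinvZ.
- move=> b; have [i H] : exists i, T b i != 0 by case: b.
  by exists i; apply: T1 H.
- move=> i j h1 h2; apply: ind; [move: h1|move: h2]; rewrite TK; exact: T0.
Qed.

End ChartSplit.

(** * Analytic curves in the sphere *)

Section SphereCurves.
Variable R : realType.
Implicit Types (s t : R) (c d : R -> 'rV[R]_4) (I J : set R).

Lemma tameZ_sign (f : R -> R) s (e : R) : e ^+ 2 = 1 -> tame f s -> tame (fun t => e * f t) s.
Proof.
move=> e1 [D [r [K [r0 K0 Df DD]]]].
have en : `|e| = 1 by apply/eqP; rewrite -sqrp_eq1 // -normrX e1 normr1.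
exists (fun n t => e * D n t), r, K; split => // [t tr|n t tr]; first by rewrite Df.
have [HD BD] := DD n t tr; split; last by rewrite normrM en mul1r.
exact: (is_deriveZ e HD).
Qed.

Lemma speed_near c d s : (\forall t \near s, c t = d t) -> speed c s = speed d s.
Proof.
move=> H; apply/rowP => l; rewrite !mxE; apply: near_eq_derive.
by apply: filterS H => t ->.
Qed.

Lemma unit_tame_near c d s : (\forall t \near s, c t = d t) -> unit_tame c s -> unit_tame d s.
Proof.
move=> H [tc sc]; split; last by rewrite -(speed_near H).
by move=> l; apply: tame_near (tc l); apply: filterS H => t ->.
Qed.

Lemma affine_continuous (a b e : R) s : {for s, continuous (fun t => b + e * (t - a) : R)}.
Proof.
apply: (@is_derive1_continuous _ _ _ e).
by apply: is_derive_eq; rewrite /GRing.scale /=; lra.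
Qed.

Definition reparam (eta eps s0 t0 : R) c s : 'rV[R]_4 := eta *: c (t0 + eps * (s - s0)).

Lemma speed_reparam eta eps s0 t0 c s : (forall l, tame (fun t => c t 0 l) (t0 + eps * (s - s0))) ->
  speed (reparam eta eps s0 t0 c) s = (eta * eps) *: speed c (t0 + eps * (s - s0)).
Proof.
move=> tc; apply/rowP => l; rewrite !mxE.
have -> : (fun t => reparam eta eps s0 t0 c t 0 l) = (fun t => eta * c (t0 + eps * (t - s0)) 0 l).
  by apply/funext => t; rewrite mxE.
have H0 : is_derive s 1 (fun t => t0 + eps * (t - s0)) eps.
  apply: is_derive_eq; rewrite /GRing.scale /=; lra.
have H1 := @is_derive1_comp _ (fun t => c t 0 l) (fun t => t0 + eps * (t - s0)) s _ _
  (tame_is_derive (tc l)) H0.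
have [_ H2] := is_deriveZ eta H1.
by apply: etrans H2 _; rewrite /GRing.scale /=; ring.
Qed.

Lemma unit_tame_reparam eta eps s0 t0 c s : eta ^+ 2 = 1 -> eps ^+ 2 = 1 ->
  unit_tame c (t0 + eps * (s - s0)) -> unit_tame (reparam eta eps s0 t0 c) s.
Proof.
move=> eta1 eps1 [tc sc]; split.
  move=> l; have -> : (fun t => reparam eta eps s0 t0 c t 0 l) =
      (fun t => eta * c (t0 + eps * (s - s0) + eps * (t - s)) 0 l).
    by apply/funext => t; rewrite mxE; congr (_ * c _ 0 l); ring.
  exact: tameZ_sign eta1 (tame_affine s eps1 (tc l)).
rewrite speed_reparam //; under eq_bigr do rewrite mxE exprMn.
by rewrite -mulr_sumr sc mulr1 exprMn eta1 eps1 mulr1.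
Qed.

Definition sphere_curve I c :=
  [/\ open I, is_interval I & forall s, I s -> unit_tame c s /\ dot (c s) (c s) = 1].

Lemma is_intervalI I J : is_interval I -> is_interval J -> is_interval (I `&` J).
Proof. by move=> iI iJ x y [xI xJ] [yI yJ] z zz; split; [exact: (iI _ _ xI yI)|exact: (iJ _ _ xJ yJ)]. Qed.

Lemma is_intervalU I J s : is_interval I -> is_interval J -> I s -> J s -> is_interval (I `|` J).
Proof.
move=> iI iJ sI sJ.
suff H K L : is_interval K -> is_interval L -> K s -> L s -> forall x y, K x -> L y ->
    forall z, (x <= z <= y) || (y <= z <= x) -> (K `|` L) z.
  move=> x y [xI|xJ] [yI|yJ] z zz.
  - by left; exact: (iI _ _ xI yI).
  - by apply: (H _ _ iI iJ sI sJ _ _ xI yJ); rewrite zz.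
  - by rewrite setUC; apply: (H _ _ iJ iI sJ sI _ _ xJ yI); rewrite zz.
  - by right; exact: (iJ _ _ xJ yJ).
move=> iK iL sK sL x y xK yL z /orP[] /andP[h1 h2].
  by have [zs|sz] := leP z s; [left; apply: iK xK sK _ _; rewrite h1|right; apply: iL sL yL _ _; rewrite h2 ltW].
have [zs|sz] := leP z s; first by right; apply: iL yL sL _ _; rewrite h1.
by left; apply: iK sK xK _ _; rewrite h2 ltW.
Qed.

Lemma sphere_curve_unique I J c d s0 : sphere_curve I c -> sphere_curve J d -> I s0 -> J s0 ->
  (\forall s \near s0, c s = d s) -> forall s, I s -> J s -> c s = d s.
Proof.
move=> [oI iI cI] [oJ iJ dJ] s0I s0J cd s sI sJ; apply/rowP => l.
apply: (@tame_unique _ (fun s => c s 0 l) (fun s => d s 0 l) (I `&` J) s0) => //.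
- exact: is_intervalI.
- exact: openI.
- by move=> t [/cI[[]]].
- by move=> t [_ /dJ[[]]].
- by apply: filterS cd => t ->.
Qed.

Definition glue I c d s := if `[< I s >] then c s else d s.

Lemma glue_l I c d s : I s -> glue I c d s = c s.
Proof. by move=> Is; rewrite /glue asboolT. Qed.

(** Two continuations of a germ agree on the intersection of their intervals, so
    they are restrictions of a curve on the union. *)
Lemma sphere_curve_glue I J c d s0 : sphere_curve I c -> sphere_curve J d -> I s0 -> J s0 ->
  (\forall s \near s0, c s = d s) ->
  sphere_curve (I `|` J) (glue I c d) /\ forall s, J s -> glue I c d s = d s.
Proof.
move=> cI dJ s0I s0J cd; have gJ s : J s -> glue I c d s = d s.
  move=> sJ; rewrite /glue; case: asboolP => // sI.
  exact: (sphere_curve_unique cI dJ s0I s0J cd).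
split => //; have [oI iI HI] := cI; have [oJ iJ HJ] := dJ; split.
- exact: openU.
- exact: is_intervalU iI iJ s0I s0J.
move=> s [sI|sJ].
  rewrite (glue_l _ _ sI); have [h1 h2] := HI s sI; split => //; apply: unit_tame_near h1.
  by apply: filterS (open_nbhs_nbhs (conj oI sI)) => t tI; rewrite glue_l.
rewrite (gJ s sJ); have [h1 h2] := HJ s sJ; split => //; apply: unit_tame_near h1.
by apply: filterS (open_nbhs_nbhs (conj oJ sJ)) => t tJ; rewrite gJ.
Qed.

Definition preaff (eps s0 t0 : R) I : set R := [set s | I (t0 + eps * (s - s0))].

Lemma sphere_curve_reparam eta eps s0 t0 I c : eta ^+ 2 = 1 -> eps ^+ 2 = 1 ->
  sphere_curve I c -> sphere_curve (preaff eps s0 t0 I) (reparam eta eps s0 t0 c).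
Proof.
move=> eta1 eps1 [oI iI HI]; split.
- have -> : preaff eps s0 t0 I = (fun s => t0 + eps * (s - s0)) @^-1` I by [].
  by apply: open_comp => // s _; exact: affine_continuous.
- have /orP[/eqP ->|/eqP ->] : (eps == 1) || (eps == -1) by rewrite -sqrf_eq1 eps1.
    by move=> x y Ix Iy z /andP[h1 h2]; apply: (iI _ _ Ix Iy); apply/andP; split; lra.
  by move=> x y Ix Iy z /andP[h1 h2]; apply: (iI _ _ Iy Ix); apply/andP; split; lra.
move=> s sI; have [h1 h2] := HI _ sI; split; first exact: unit_tame_reparam.
by rewrite dotZl dotZr h2 mulr1 -expr2.
Qed.

(** The reflection of the parameter that exchanges s0 and t0 has their midpoint m as
    a fixed point. By uniqueness the relation holds all along the interval; at m it
    reads c m = - c m, impossible on the unit sphere. *)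
Lemma no_antipodal_reflection I c s0 t0 : sphere_curve I c -> I s0 -> I t0 ->
  ~ \forall s \near s0, c s = reparam (-1) (-1) s0 t0 c s.
Proof.
move=> cI Is0 It0 H.
have e1 : (-1) ^+ 2 = 1 :> R by rewrite sqrrN expr1n.
have {}cJ := sphere_curve_reparam s0 t0 e1 e1 cI.
have J s : preaff (-1) s0 t0 I s = I (t0 + -1 * (s - s0)) by [].
pose m := (s0 + t0) / 2.
have Im : I m.
  have [_ iI _] := cI; have [h|h] := leP s0 t0.
    by apply: (iI _ _ Is0 It0); rewrite /m; apply/andP; split; lra.
  by apply: (iI _ _ It0 Is0); rewrite /m; apply/andP; split; lra.
have mm : t0 + -1 * (m - s0) = m by rewrite /m; lra.
have := sphere_curve_unique cI cJ Is0 _ H Im.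
rewrite !J subrr mulr0 addr0 mm => /(_ It0 Im) E.
have [_ _ /(_ m Im)[_]] := cI.
have : dot (c m) (c m) = - dot (c m) (c m) by rewrite {2}E /reparam mm scaleN1r dotNr.
move=> h1 h2; lra.
Qed.

End SphereCurves.

(** * Continuing the normal over the surface *)

Section GlobalNormal.
Variables (R : realType) (T : topologicalType) (F : T -> 'rV[R]_4).
Variable Nrm : T -> 'rV[R]_4 -> Prop.
Implicit Types (x y z : T) (N : T -> 'rV[R]_4) (W : set T).

(** A local factorisation of the two Gauss maps over W through sphere curves c b
    with parameters u b, whose velocities are positively ordered for the normal N.
    Openness of u b makes the curve part of the data determined by W and N, up to
    an isometry of the parameter. *)
Definition split_chart W N (u : bool -> T -> R) (c : bool -> R -> 'rV[R]_4) (I : bool -> set R) :=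
  [/\ open W, forall b, sphere_curve (I b) (c b) &
   forall y, W y -> [/\ Nrm y (N y), {for y, continuous N},
     forall b, [/\ {for y, continuous (u b)}, open_map_at (u b) y, I b (u b y) &
       c b (u b y) = nmap b (F y) (N y)] &
     0 < sigma (F y) (N y) (speed (c true) (u true y)) (speed (c false) (u false y))]].

Hypothesis Nsign : forall x n m, Nrm x n -> Nrm x m -> exists2 eta : R, eta ^+ 2 = 1 & m = eta *: n.
Hypothesis Nopp : forall x n, Nrm x n -> Nrm x (- n).
Hypothesis Nunit : forall x n, Nrm x n -> dot n n = 1.

Lemma sign_case (eta : R) : eta ^+ 2 = 1 -> eta = 1 \/ eta = - 1.
Proof. by move=> /eqP; rewrite sqrf_eq1 => /orP[] /eqP; [left|right]. Qed.

Lemma nmapZ b (x n : 'rV[R]_4) (k : R) : nmap b x (k *: n) = k *: nmap b x n.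
Proof. by case: b; rewrite /nmap ?qmulZl ?qmulZr. Qed.

Lemma dot_continuous N M y : {for y, continuous N} -> {for y, continuous M} ->
  {for y, continuous (fun z => dot (N z) (M z) : R)}.
Proof.
move=> cN cM; rewrite /dot.
have cc (V : T -> 'rV[R]_4) k : {for y, continuous V} -> {for y, continuous (fun z => V z 0 k)}.
  by move=> cV; apply: (@continuous_comp _ _ _ V (fun v : 'rV[R]_4 => v 0 k)) => //; exact: coord_continuous.
by apply: cvg_big => [|k _]; [exact: add_continuous|apply: cvgM; exact: cc].
Qed.

(** The scalar product of the two normals is 1 or -1 and continuous. *)
Lemma normal_sign_near W N u c I W' N' u' c' I' y (eta : R) : split_chart W N u c I ->
  split_chart W' N' u' c' I' -> W y -> W' y -> eta ^+ 2 = 1 -> N' y = eta *: N y ->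
  \forall z \near y, [/\ W z, W' z & N' z = eta *: N z].
Proof.
move=> [oW _ H] [oW' _ H'] Wy Wy' eta1 Ny.
have [Hy cN _ _] := H y Wy; have [_ cN' _ _] := H' y Wy'.
have cd : {for y, continuous (fun z => eta * dot (N z) (N' z))} by apply: cvgMl_tmp; exact: dot_continuous.
have d0 : 0 < eta * dot (N y) (N' y).
  by rewrite Ny dotZr (Nunit Hy) mulr1 -expr2 eta1.
have P : \forall z \near y, 0 < eta * dot (N z) (N' z).
  have /cvgrPdist_lt /(_ _ d0) := cd; apply: filterS => z /=.
  rewrite ltr_norml => /andP[_]; lra.
have Wn := open_nbhs_nbhs (conj oW Wy); have Wn' := open_nbhs_nbhs (conj oW' Wy').
near=> z.
have Wz : W z by near: z.
have Wz' : W' z by near: z.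
have Pz : 0 < eta * dot (N z) (N' z) by near: z.
split => //; have [Hz _ _ _] := H z Wz; have [Hz' _ _ _] := H' z Wz'.
have [eta' eta'1 E] := Nsign Hz Hz'.
suff -> : eta = eta' by [].
move: Pz; rewrite E dotZr (Nunit Hz) mulr1.
by case: (sign_case eta1) => ->; case: (sign_case eta'1) => ->; lra.
Unshelve. all: by end_near. Qed.

(** The value sets of the curves near y coincide with those of the Gauss maps, so
    the curves differ by isometries of the parameter, with slopes eps. The last
    relation compares the two positive values of sigma, which is linear in both
    velocities and odd in the normal. *)
Lemma split_transition W N u c I W' N' u' c' I' y (eta : R) : split_chart W N u c I ->
  split_chart W' N' u' c' I' -> W y -> W' y -> eta ^+ 2 = 1 -> N' y = eta *: N y ->
  exists eps : bool -> R, [/\ forall b, eps b ^+ 2 = 1,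
    forall b, \forall t \near u' b y, c' b t = reparam eta (eps b) (u' b y) (u b y) (c b) t &
    eta * eps true * eps false = 1].
Proof.
move=> D D' Wy Wy' eta1 Ny; have nb := normal_sign_near D D' Wy Wy' eta1 Ny.
have [oW sc H] := D; have [oW' sc' H'] := D'.
have [Hy cN L sg] := H y Wy; have [_ cN' L' sg'] := H' y Wy'.
have K b : exists2 e : R, e ^+ 2 = 1 &
    \forall t \near u' b y, c' b t = reparam eta e (u' b y) (u b y) (c b) t.
  have [cu ou Iu cE] := L b; have [cu' ou' Iu' cE'] := L' b.
  have e1 : 1 ^+ 2 = 1 :> R by rewrite expr1n.
  have [oI iI HI] := sphere_curve_reparam 0 0 eta1 e1 (sc b); have [oI' iI' HI'] := sc' b.
  have E t : reparam eta 1 0 0 (c b) t = eta *: c b t by rewrite /reparam add0r mul1r subr0.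
  have Iu2 : preaff 1 0 0 (I b) (u b y) by rewrite /preaff /= add0r mul1r subr0.
  have [r1 r10 Hr1] := ball_near (open_nbhs_nbhs (conj oI Iu2)).
  have [r2 r20 Hr2] := ball_near (open_nbhs_nbhs (conj oI' Iu')).
  pose rho := Num.min r1 r2.
  have rho0 : 0 < rho by rewrite lt_min r10.
  have [||||e e2 He] := @unit_tame_transition _ (c' b) (reparam eta 1 0 0 (c b)) (u' b y) (u b y) rho rho0.
  - by move=> s; rewrite lt_min => /andP[_ /Hr2 /HI'[]].
  - by move=> s; rewrite lt_min => /andP[/Hr1 /HI[]].
  - by rewrite E cE' cE Ny nmapZ.
  - move=> e e0.
    have : nbhs y [set z | [/\ W z, W' z & N' z = eta *: N z] /\ `|u b z - u b y| < e].
      apply: filterI => //; move/cvgrPdist_lt: cu => /(_ _ e0).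
      by apply: filterS => z; rewrite distrC.
    move=> /ou'; apply: filterS => s [z [[Wz Wz' Nz] ze] <-]; exists (u b z) => //.
    have [_ _ Lz' _] := H' z Wz'; have [_ _ _ ->] := Lz' b.
    have [_ _ Lz _] := H z Wz; have [_ _ _ cz] := Lz b.
    by rewrite E cz Nz nmapZ.
  - by exists e => //; apply: filterS He => t ->; rewrite E.
have [et et1 et2] := K true; have [ef ef1 ef2] := K false.
pose eps b := if b then et else ef.
have eps1 b : eps b ^+ 2 = 1 by case: b.
have eps2 b : \forall t \near u' b y, c' b t = reparam eta (eps b) (u' b y) (u b y) (c b) t by case: b.
exists eps; split => //.
have S b : speed (c' b) (u' b y) = (eta * eps b) *: speed (c b) (u b y).
  have [_ _ Iu _] := L b; have [_ _ HI] := sc b.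
  rewrite (speed_near (eps2 b)) speed_reparam subrr mulr0 addr0 //.
  by case: (HI _ Iu) => [[]].
move: sg'; rewrite !S Ny sigmaZ.
have -> v w : sigma (F y) (eta *: N y) v w = eta * sigma (F y) (N y) v w.
  by case: (sign_case eta1) => ->; rewrite ?scale1r ?mul1r // scaleN1r sigmaN mulN1r.
move: sg (eps1 true) (eps1 false) => sg.
by case: (sign_case eta1) => ->; case/sign_case => ->; case/sign_case => ->; lra.
Qed.

Section Based.
Variables (s0 : bool -> R) (c0 : bool -> R -> 'rV[R]_4).

Definition admissible x n := exists W N u c I, [/\ split_chart W N u c I, W x, N x = n &
  forall b, I b (s0 b) /\ \forall s \near s0 b, c b s = c0 b s].

Lemma admissible_Nrm x n : admissible x n -> Nrm x n.
Proof. by move=> [W [N [u [c [I [[_ _ H] Wx <- _]]]]]]; case: (H x Wx). Qed.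

(** By split_transition for eta = -1 one of the two slopes is -1. Both curves with
    that index continue the same germ, so they are parts of one curve, and this
    curve is carried to its antipode by a reflection. *)
Lemma admissible_not_opp x n : admissible x n -> ~ admissible x (- n).
Proof.
move=> [W [N [u [c [I [D Wx Nx B]]]]]] [W' [N' [u' [c' [I' [D' Wx' Nx' B']]]]]].
have m1 : (-1) ^+ 2 = 1 :> R by rewrite sqrrN expr1n.
have Ny : N' x = -1 *: N x by rewrite Nx' Nx scaleN1r.
have [eps [eps1 tr sg]] := split_transition D D' Wx Wx' m1 Ny.
(* for eta = -1 the product of the two slopes is -1 *)
have [b epsb] : exists b, eps b = -1.
  case: (sign_case (eps1 true)) => h1; last by exists true.
  case: (sign_case (eps1 false)) => h2; last by exists false.
  by exfalso; move: sg; rewrite h1 h2; lra.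
have [_ sc H] := D; have [_ sc' H'] := D'.
have [_ _ L _] := H x Wx; have [_ _ L' _] := H' x Wx'.
have [_ _ Iu _] := L b; have [_ _ Iu' _] := L' b.
have [Ib cb] := B b; have [Ib' cb'] := B' b.
have cc' : \forall s \near s0 b, c b s = c' b s.
  by near=> s; rewrite (near cb s) ?(near cb' s).
have [G gr] := sphere_curve_glue (sc b) (sc' b) Ib Ib' cc'.
apply: (@no_antipodal_reflection _ _ _ (u' b x) (u b x) G); [by right|by left|].
have [oI _ _] := sc b; have [oI' _ _] := sc' b.
have n1 := open_nbhs_nbhs (conj oI' Iu').
have n2 : \forall s \near u' b x, I b (u b x + -1 * (s - u' b x)).
  have : {for u' b x, continuous (fun s => u b x + -1 * (s - u' b x) : R)}.
    exact: affine_continuous.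
  rewrite /prop_for /continuous_at subrr mulr0 addr0; apply.
  exact: open_nbhs_nbhs.
have n3 := tr b; rewrite epsb in n3.
near=> s.
have h1 : I' b s by near: s.
have h2 : I b (u b x + -1 * (s - u' b x)) by near: s.
rewrite (gr s h1) /reparam (glue_l _ _ h2).
by near: s.
Unshelve. all: by end_near. Qed.

(** The chart over W is re-parametrised so that its curves, glued to those of the
    given chart at y, continue the base germs. *)
Lemma admissible_spread W N u c I y n : split_chart W N u c I -> W y -> admissible y n ->
  exists2 eta : R, eta ^+ 2 = 1 & n = eta *: N y /\ forall z, W z -> admissible z (eta *: N z).
Proof.
move=> D Wy [W' [N' [u' [c' [I' [D' Wy' Ny' B']]]]]].
have [oW sc H] := D; have [oW' sc' H'] := D'.
have [Hy cN L sg] := H y Wy; have [Hy' cN' L' sg'] := H' y Wy'.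
have [eta eta1 E] := Nsign Hy Hy'.
exists eta => //; split => [|z Wz]; first by rewrite -Ny'.
have [eps [eps1 tr sgn]] := split_transition D D' Wy Wy' eta1 E.
(* the curves over W, moved so as to coincide with those of the other chart at y *)
pose cr b := reparam eta (eps b) (u' b y) (u b y) (c b).
pose Ir b := preaff (eps b) (u' b y) (u b y) (I b).
pose v b z := u' b y + eps b * (u b z - u b y).
have scr b : sphere_curve (Ir b) (cr b) by apply: sphere_curve_reparam.
have vK b w : u b y + eps b * (v b w - u' b y) = u b w.
  by rewrite /v; case: (sign_case (eps1 b)) => ->; ring.
have Iry b : Ir b (u' b y).
  by rewrite /Ir /preaff /= subrr mulr0 addr0; have [_ _] := L b.
have Iy' b : I' b (u' b y) by have [_ _] := L' b.
have G b := sphere_curve_glue (sc' b) (scr b) (Iy' b) (Iry b) (tr b).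
exists W, (fun w => eta *: N w), v, (fun b => glue (I' b) (c' b) (cr b)), (fun b => I' b `|` Ir b).
split; [|exact: Wz|by []|]; last first.
  move=> b; have [h1 h2] := B' b; have [oI' _ _] := sc' b; split; first by left.
  near=> s; rewrite glue_l; first by near: s.
  by near: s; exact: open_nbhs_nbhs.
split; [exact: oW|by move=> b; case: (G b)|] => w Ww.
have [Hw cNw Lw sw] := H w Ww.
have Iv b : Ir b (v b w) by rewrite /Ir /preaff /= vK; have [_ _] := Lw b.
have gv b : glue (I' b) (c' b) (cr b) (v b w) = cr b (v b w) by case: (G b) => _ ->.
split.
- by case: (sign_case eta1) => ->; rewrite ?scale1r // scaleN1r; exact: Nopp.
- by apply: cvgZ; [exact: cvg_cst|exact: cNw].
- move=> b; have [cu ou Iu cE] := Lw b; split.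
  + apply: cvgD; first exact: cvg_cst.
    by apply: cvgMl_tmp; apply: cvgB; [exact: cu|exact: cvg_cst].
  + move=> O /ou nO.
    have : {for v b w, continuous (fun s => u b y + eps b * (s - u' b y) : R)}.
      exact: affine_continuous.
    rewrite /prop_for /continuous_at vK => /(_ _ nO).
    apply: (@filterS _ (nbhs (v b w))) => s [q Oq qs]; exists q => //.
    by rewrite /v qs; case: (sign_case (eps1 b)) => ->; ring.
  + by right.
  + by rewrite gv /cr /reparam vK cE nmapZ.
- have S b : speed (glue (I' b) (c' b) (cr b)) (v b w) = (eta * eps b) *: speed (c b) (u b w).
    rewrite (@speed_near _ _ (cr b)).
      have [_ _ Iu _] := Lw b; have [_ _ HI] := sc b.
      by rewrite speed_reparam vK //; case: (HI _ Iu) => [[]].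
    have [oIr _ _] := scr b.
    by apply: filterS (open_nbhs_nbhs (conj oIr (Iv b))) => s; case: (G b) => _; apply.
  rewrite !S sigmaZ.
  have -> (a b : 'rV[R]_4) : sigma (F w) (eta *: N w) a b = eta * sigma (F w) (N w) a b.
    by case: (sign_case eta1) => ->; rewrite ?scale1r ?mul1r // scaleN1r sigmaN mulN1r.
  rewrite mulrA.
  have -> : eta * eps true * (eta * eps false) * eta = eta ^+ 2 * (eta * eps true * eps false) by ring.
  by rewrite sgn eta1 !mul1r.
Unshelve. all: by end_near. Qed.

End Based.

Hypothesis boxes : forall x, exists W N u c I, split_chart W N u c I /\ W x.

(** Having an admissible normal is an open and closed condition, by
    admissible_spread. By admissible_not_opp it is unique, so on the domain of a
    split chart it is a fixed sign times the normal of that chart. *)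
Lemma global_normal : connected [set: T] ->
  exists2 N : T -> 'rV[R]_4, continuous N & forall x, Nrm x (N x).
Proof.
move=> conn; have [[x0 _]|T0] := pselect (exists x : T, True); last first.
  by exists (fun=> 0) => x; exfalso; apply: T0; exists x.
have [W0 [N0 [u0 [c0 [I0 [D0 Wx0]]]]]] := boxes x0.
pose adm := admissible (fun b => u0 b x0) c0.
have adm0 : adm x0 (N0 x0).
  exists W0, N0, u0, c0, I0; split; [exact: D0|exact: Wx0|by []|] => b; split; last by apply: filterE.
  by have [_ _ H] := D0; have [_ _ /(_ b)[]] := H x0 Wx0.
pose S : set T := [set x | exists n, adm x n].
have spread x W N u c I : split_chart W N u c I -> S x -> W x -> W `<=` S.
  move=> D [n xn] Wx z Wz; have [eta _ [_ H]] := admissible_spread D Wx xn.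
  by exists (eta *: N z); exact: H.
have nW x W N u c I : split_chart W N u c I -> W x -> nbhs x W.
  by move=> [oW _ _] Wx; exact: open_nbhs_nbhs.
have ST : S = [set: T].
  apply: conn; first by exists x0, (N0 x0).
    exists S; rewrite ?setTI //; rewrite openE => x Sx.
    have [W [N [u [c [I [D Wx]]]]]] := boxes x.
    exact: filterS (spread _ _ _ _ _ _ D Sx Wx) (nW _ _ _ _ _ _ D Wx).
  exists S; rewrite ?setTI // => x clx.
  have [W [N [u [c [I [D Wx]]]]]] := boxes x.
  have [y [Sy Wy]] := clx _ (nW _ _ _ _ _ _ D Wx).
  exact: (spread _ _ _ _ _ _ D Sy Wy).
have ex x : exists n, adm x n by have : S x by rewrite ST.
have [N HN] := choice ex.
exists N => [x|x]; last exact: admissible_Nrm (HN x).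
have [W [M [u [c [I [D Wx]]]]]] := boxes x.
have [eta eta1 [Nx H]] := admissible_spread D Wx (HN x).
have E : \forall z \near x, eta *: M z = N z.
  apply: filterS (nW _ _ _ _ _ _ D Wx) => z Wz.
  have [e e1 Ee] := Nsign (admissible_Nrm (H z Wz)) (admissible_Nrm (HN z)).
  case: (sign_case e1) => h; rewrite Ee h ?scale1r //.
  by exfalso; apply: (admissible_not_opp (H z Wz)); rewrite -scaleN1r -h -Ee; exact: HN.
have [_ _ /(_ x Wx)[_ cM _ _]] := D.
rewrite /continuous_at Nx; apply: cvg_trans (near_eq_cvg E) _.
by apply: cvgZ; [exact: cvg_cst|exact: cM].
Qed.

End GlobalNormal.

(** * Immersed charts *)

Section Coordinates.
Variables (R : realType) (T : topologicalType).
Implicit Types (V W : T -> 'rV[R]_4).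

Definition ccont V y := forall k, {for y, continuous (fun z => V z 0 k : R)}.

Lemma ccontP V y : {for y, continuous V} <-> ccont V y.
Proof.
split=> [cV k|H].
  by apply: (@continuous_comp _ _ _ V (fun v : 'rV[R]_4 => v 0 k)) => //; exact: coord_continuous.
have -> : V = (fun z => \sum_(k < 4) V z 0 k *: (delta_mx 0 k : 'rV[R]_4)).
  by apply/funext => z; exact: row_sum_delta.
apply: cvg_big => [|k _]; [exact: add_continuous|].
by apply: cvgZ; [exact: H|exact: cvg_cst].
Qed.

Lemma ccont_vec4 (a b c d : T -> R) y : {for y, continuous a} -> {for y, continuous b} ->
  {for y, continuous c} -> {for y, continuous d} -> ccont (fun z => vec4 (a z) (b z) (c z) (d z)) y.
Proof.
by move=> ha hb hc hd; apply: ord4P; rewrite /prop_for /continuous_at; under eq_fun do rewrite vec4E;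
  rewrite vec4E.
Qed.

Lemma ccont_qmul V W y : ccont V y -> ccont W y -> ccont (fun z => qmul (V z) (W z)) y.
Proof.
move=> HV HW.
have M k l : {for y, continuous (fun z => V z 0 k * W z 0 l)} by apply: cvgM; [exact: HV|exact: HW].
have D (f g : T -> R) : {for y, continuous f} -> {for y, continuous g} -> {for y, continuous (fun z => f z + g z)}.
  by move=> hf hg; apply: cvgD.
have B (f g : T -> R) : {for y, continuous f} -> {for y, continuous g} -> {for y, continuous (fun z => f z - g z)}.
  by move=> hf hg; apply: cvgB.
apply: ccont_vec4.
- exact: B (B _ _ (B _ _ (M k0 k0) (M k1 k1)) (M k2 k2)) (M k3 k3).
- exact: B (D _ _ (D _ _ (M k0 k1) (M k1 k0)) (M k2 k3)) (M k3 k2).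
- exact: D (D _ _ (B _ _ (M k0 k2) (M k1 k3)) (M k2 k0)) (M k3 k1).
- exact: D (B _ _ (D _ _ (M k0 k3) (M k1 k2)) (M k2 k1)) (M k3 k0).
Qed.

Lemma ccont_qconj V y : ccont V y -> ccont (fun z => qconj (V z)) y.
Proof.
by move=> HV; apply: ccont_vec4; do ?[exact: HV|apply: cvgN].
Qed.

Lemma sigma_continuous (X N V W : T -> 'rV[R]_4) y :
  ccont X y -> ccont N y -> ccont V y -> ccont W y ->
  {for y, continuous (fun z => sigma (X z) (N z) (V z) (W z))}.
Proof.
move=> cX cN cV cW; apply: dot_continuous; apply/ccontP.
  exact: ccont_qmul (ccont_qmul cN (ccont_qconj cX)) (ccont_qmul cV cN).
exact: ccont_qmul cN cW.
Qed.

End Coordinates.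

Lemma det2 (R : comNzRingType) (M : 'M[R]_2) : \det M = M 0 0 * M 1 1 - M 0 1 * M 1 0.
Proof.
rewrite (expand_det_row _ 0) !big_ord_recl big_ord0 addr0 /cofactor !det_mx11 !mxE.
rewrite /= expr0 expr1 mul1r mulN1r mulrN.
by congr (M _ _ * M _ _ - M _ _ * M _ _); exact: val_inj.
Qed.

Section Charts.
Variables (R : realType) (T : topologicalType).
Implicit Types (c d : chart R T) (x : T).

Lemma cmap_continuous_at c x : cdom c x -> {for x, continuous (cmap c)}.
Proof.
move=> cx; have := @cmap_continuous _ _ c.
by rewrite continuous_open_subspace; [move/(_ x (mem_set cx))|exact: open_cdom].
Qed.

Lemma cinv_continuous_at c p : cimg c p -> {for p, continuous (cinv c)}.
Proof.
move=> cp; have := @cinv_continuous _ _ c.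
by rewrite continuous_open_subspace; [move/(_ p (mem_set cp))|exact: open_cimg].
Qed.

Lemma cimg_cmap c x : cdom c x -> cimg c (cmap c x).
Proof. by exists x. Qed.

Lemma cinvK c p : cimg c p -> cdom c (cinv c p) /\ cmap c (cinv c p) = p.
Proof. by move=> [x cx <-]; rewrite cmapK. Qed.

Lemma near_cdom c x : cdom c x -> \forall y \near x, cdom c y.
Proof. by move=> cx; exact: open_nbhs_nbhs (conj (@open_cdom _ _ c) cx). Qed.

Lemma near_cimg c x (P : T -> Prop) : cdom c x -> (\forall y \near x, P y) ->
  \forall q \near cmap c x, cimg c q /\ P (cinv c q).
Proof.
move=> cx nP; have ip := cimg_cmap cx.
have := cinv_continuous_at ip; rewrite /prop_for /continuous_at cmapK // => /(_ _ nP) h.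
by near=> q; split; near: q => //; exact: open_nbhs_nbhs (conj (@open_cimg _ _ c) ip).
Unshelve. all: by end_near. Qed.

Variable F : T -> 'rV[R]_4.
Hypothesis FS : forall x, sphere3 (F x).

Lemma sphere_dot x : dot (F x) (F x) = 1.
Proof. by rewrite -(FS x); apply: eq_bigr => k _; rewrite expr2. Qed.

Definition surf c := F \o cinv c.
Definition good c := forall q, cimg c q -> vanalytic (surf c) q.

Lemma surf_cmap c x : cdom c x -> surf c (cmap c x) = F x.
Proof. by move=> cx; rewrite /surf /= cmapK. Qed.

Lemma surf_unit c q : dot (surf c q) (surf c q) = 1.
Proof. exact: sphere_dot. Qed.

(** Chain rule for the two local expressions of F. *)
Lemma surf_transition c d x i : good d -> cdom c x -> cdom d x ->
  analytic_at (transition c d) (cmap c x) ->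
  X1 (surf c) i (cmap c x) = \sum_k 'J (transition c d) (cmap c x) i k *: X1 (surf d) k (cmap d x).
Proof.
move=> gd cx dx ta.
have H := analytic_atP ta; have Dt := rowfun_differentiable H.
have tx : transition c d (cmap c x) = cmap d x by rewrite /transition /= cmapK.
apply/rowP => l; rewrite mxE.
have gl : analytic (fun u => surf d u 0 l) (transition c d (cmap c x)).
  by rewrite tx; exact: (gd _ (cimg_cmap dx) l).
have Dl := analytic_differentiable gl.
have E : \forall q \near cmap c x, surf c q 0 l = ((fun u => surf d u 0 l) \o transition c d) q.
  apply: filterS (near_cimg cx (near_cdom dx)) => q [_ dq].
  by rewrite /surf /transition /= cmapK.
rewrite (partial_near _ E) /partial deriveE; last exact: differentiable_comp.
rewrite diff_comp //=.
have -> : 'd (transition c d) (cmap c x) (delta_mx 0 i) =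
    \sum_k 'J (transition c d) (cmap c x) i k *: (delta_mx 0 k : 'rV[R]_2).
  rewrite -(deriveE _ Dt) (deriveEjacobian _ Dt) -rowE [LHS]row_sum_delta.
  by apply: eq_bigr => k _; rewrite mxE.
rewrite raddf_sum summxE; apply: eq_bigr => k _.
apply: etrans (linearZ _ _) _; rewrite [RHS]mxE mxE -(deriveE _ Dl) tx [X1 _ _ _ _ _]mxE; reflexivity.
Qed.

Lemma ncross_transition c d x : good d -> cdom c x -> cdom d x ->
  analytic_at (transition c d) (cmap c x) ->
  ncross (surf c) (cmap c x) = \det ('J (transition c d) (cmap c x)) *: ncross (surf d) (cmap d x).
Proof.
move=> gd cx dx ta; have ix := cimg_cmap dx.
have tg i := X1X (@open_cimg _ _ d) gd (fun q _ => surf_unit d q) i ix.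
rewrite /ncross !(surf_transition _ gd cx dx ta) !sum2 !surf_cmap //.
rewrite qcross_basechange -1?(surf_cmap dx) ?tg //.
by rewrite det2.
Qed.

Section Immersed.
Variable c : chart R T.
Hypotheses (ga : analytic_on (surf c) (cimg c))
  (im : forall p, cimg c p -> injective ('d (surf c) p)).

Lemma surf_good : good c.
Proof. by move=> q iq k; exact: analytic_atP (ga iq) k. Qed.

(** If the Gram determinant vanished, the vector g01 d_0 X - g00 d_1 X, of square
    norm g00 times the determinant, would be a relation between the partial
    derivatives. *)
Lemma surf_regular q : cimg c q -> 0 < gdet (surf c) q.
Proof.
move=> iq; have D := rowfun_differentiable (surf_good iq).
have dE i : 'd (surf c) q (delta_mx 0 i) = X1 (surf c) i q.
  rewrite -(deriveE _ D) (deriveEjacobian _ D) -rowE; apply/rowP => k.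
  by rewrite mxE (jacobianE _ _ (surf_good iq)) [RHS]mxE.
have nz (a b : R) : a *: X1 (surf c) 0 q + b *: X1 (surf c) 1 q = 0 -> a = 0 /\ b = 0.
  move=> h; have /(im iq) : 'd (surf c) q (a *: delta_mx 0 0 + b *: delta_mx 0 1) = 'd (surf c) q 0.
    by rewrite linearD !linearZ /= !dE h linear0.
  by move=> /rowP E; split; [have := E 0|have := E 1]; rewrite !mxE /=; lra.
have g0 : 0 < gm (surf c) 0 0 q.
  rewrite /gm lt_neqAle dot_ge0 andbT eq_sym; apply/eqP => /dot_eq0 h.
  have [] := nz 1 0; first by rewrite h scaler0 scale0r addr0.
  by move/eqP; rewrite oner_eq0.
pose v := gm (surf c) 0 1 q *: X1 (surf c) 0 q + (- gm (surf c) 0 0 q) *: X1 (surf c) 1 q.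
have vv : dot v v = gm (surf c) 0 0 q * gdet (surf c) q.
  have E (a b : 'rV[R]_4) (s t : R) : dot (s *: a + t *: b) (s *: a + t *: b) =
      s ^+ 2 * dot a a + 2 * s * t * dot a b + t ^+ 2 * dot b b.
    by rewrite !dotDl !dotDr !dotZl !dotZr (dotC b a); ring.
  have K (x y z : R) : y ^+ 2 * x + 2 * y * (- x) * y + (- x) ^+ 2 * z = x * (x * z - y ^+ 2) by ring.
  exact: etrans (E _ _ _ _) (K _ _ _).
have v0 : 0 < dot v v.
  rewrite lt_neqAle dot_ge0 andbT eq_sym; apply/eqP => /dot_eq0/nz[_ h]; lra.
by move: v0; rewrite vv pmulr_rgt0.
Qed.

End Immersed.

End Charts.

(** * Local factorisation of the Gauss maps *)

Section ChartFactor.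
Variables (R : realType) (U : set 'rV[R]_2) (X : 'rV[R]_2 -> 'rV[R]_4).
Hypotheses (oU : open U) (Xa : forall q, U q -> vanalytic X q)
  (XX : forall q, U q -> dot (X q) (X q) = 1)
  (reg : forall q, U q -> 0 < gdet X q)
  (flat : flat_metric_on (induced_metric X) U).

Lemma gauss_map_unit b q : U q -> dot (gauss_map X b q) (gauss_map X b q) = 1.
Proof.
move=> Uq; have n1 := normal_unit oU Xa XX reg Uq; have x1 := XX Uq.
by rewrite /gauss_map /nmap; case: b; rewrite dot_qmul dot_qconj n1 x1 mulr1.
Qed.

Lemma gauss_map_factor b p : U p ->
  exists (i : 'I_2) (r a : R) (u : 'rV[R]_2 -> R) (c : R -> 'rV[R]_4),
   [/\ vpartial i (gauss_map X b) p != 0, 0 < r, u p = 0 /\ sphere_curve [set s | `|s| < a] c,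
       exists2 z : R, z != 0 & speed c 0 = z *: vpartial i (gauss_map X b) p &
       forall h, `|h| < r -> [/\ `|u (p + h)| < a, c (u (p + h)) = gauss_map X b (p + h),
         {for p + h, continuous u} & open_map_at u (p + h)]].
Proof.
move=> Up; have [_ /(_ b)[i vi] _] := chart_split oU Xa XX reg flat Up.
have [k gk] : exists k, partial i (fun q => gauss_map X b q 0 k) p != 0.
  apply/not_existsP => H; move/eqP: vi; apply; apply/rowP => k; rewrite !mxE.
  by have /negP/negPn/eqP := H k.
have [rho rho0 Hrho] := near_ballV (open_nbhs_nbhs (conj oU Up)).
pose g (l : 'I_4) q := gauss_map X b q 0 l.
have gE q : \row_l g l q = gauss_map X b q by apply/rowP => l; rewrite mxE.
have [|||r [a [u [c [r0 a0 u0 [[z z0 cz] Hc] Hu]]]]] := @rank_one_factor _ g p rho k i rho0.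
- by move=> h hr l; exact: (gauss_map_analytic Xa reg b (Hrho h hr) l).
- move=> h hr l m a' b'.
  have [/(_ b)[w [c H]] _ _] := chart_split oU Xa XX reg flat (Hrho h hr).
  have E j n : partial j (g n) (p + h) = c j * w 0 n.
    by have /rowP/(_ n) := H j; rewrite !mxE.
  by rewrite !E; ring.
- exact: gk.
exists i, r, a, u, c; split => //.
- split => //; split.
  + have -> : [set s : R | `|s| < a] = ball (0 : R) a.
      by apply/seteqP; split => s; rewrite /ball /= sub0r normrN.
    exact: ball_open.
  + move=> x y /=; rewrite !ltr_norml => /andP[x1 x2] /andP[y1 y2] s /andP[s1 s2].
    by rewrite /= ltr_norml; apply/andP; split; lra.
  + move=> s /= sa; have [h1 [h hr ->]] := Hc s sa; split => //.
    by rewrite gE; apply: gauss_map_unit; exact: Hrho.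
- by exists z => //; rewrite cz; congr (_ *: _).
- by move=> h hr; have [h1 h2 h3 h4] := Hu h hr; rewrite -gE.
Qed.

End ChartFactor.

Section Boxes.
Variables (R : realType) (T : topologicalType) (A : set (chart R T)) (F : T -> 'rV[R]_4).
Hypotheses (FS : forall x, sphere3 (F x))
  (cov : forall x, exists2 c, A c & cdom c x)
  (compat : forall c d, A c -> A d -> analytically_compatible c d)
  (im : forall c, A c -> analytic_on (F \o cinv c) (cimg c) /\
    forall p, cimg c p -> injective ('d (F \o cinv c) p))
  (flatF : flat_immersion A F).
Implicit Types (c d : chart R T) (x y : T).

Let ga c : A c -> good F c.
Proof. by move=> /im[h _]; exact: surf_good h. Qed.

Let rg c : A c -> forall q, cimg c q -> 0 < gdet (surf F c) q.
Proof. by move=> /im[h1 h2] q iq; exact: surf_regular h1 h2 q iq. Qed.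

Definition chart_normal c x := normal (surf F c) (cmap c x).

Lemma chart_normal_unit c x : A c -> cdom c x -> dot (chart_normal c x) (chart_normal c x) = 1.
Proof.
move=> Ac cx; exact: (normal_unit (@open_cimg _ _ c) (ga Ac) (fun q _ => surf_unit FS c q) (rg Ac)
  (cimg_cmap cx)).
Qed.

Lemma chart_normal_change c d x : A c -> A d -> cdom c x -> cdom d x ->
  exists2 eta : R, eta ^+ 2 = 1 & chart_normal d x = eta *: chart_normal c x.
Proof.
move=> Ac Ad cx dx; have [H _] := compat Ad Ac.
have ta : analytic_at (transition d c) (cmap d x) by apply: H; exists x.
have E := ncross_transition FS (ga Ac) dx cx ta.
have g0 := rg Ac (cimg_cmap cx).
have [k K] : exists k : R, chart_normal d x = k *: chart_normal c x.
  exists ((Num.sqrt (gdet (surf F d) (cmap d x)))^-1 * \det ('J (transition d c) (cmap d x)) *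
    Num.sqrt (gdet (surf F c) (cmap c x))).
  have K (v w : 'rV[R]_4) (a b s : R) : 0 < s -> v = b *: w -> a *: v = (a * b * s) *: (s^-1 *: w).
    by move=> s0 ->; rewrite !scalerA mulfK // gt_eqF.
  by apply: K E; rewrite sqrtr_gt0.
exists k => //; have := chart_normal_unit Ad dx.
by rewrite K dotZl dotZr (chart_normal_unit Ac cx) mulr1 -expr2.
Qed.

(** The unit normals of the surface at x, as seen in any chart of the atlas. *)
Definition unit_normal x n := exists c (eta : R), [/\ A c, cdom c x, eta ^+ 2 = 1 &
  n = eta *: chart_normal c x].

Lemma unit_normal_sign x n m : unit_normal x n -> unit_normal x m ->
  exists2 eta : R, eta ^+ 2 = 1 & m = eta *: n.
Proof.
move=> [c [e [Ac cx e1 ->]]] [d [e' [Ad dx e1' ->]]].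
have [k k1 ->] := chart_normal_change Ac Ad cx dx.
exists (e' * k * e); first by rewrite !exprMn e1 e1' k1 !mulr1.
rewrite (scalerA e' k) (scalerA _ e); congr (_ *: _).
transitivity (e' * k * e ^+ 2); first by rewrite e1 mulr1.
by rewrite expr2 !mulrA.
Qed.

Lemma unit_normal_opp x n : unit_normal x n -> unit_normal x (- n).
Proof.
move=> [c [e [Ac cx e1 ->]]]; exists c, (- e); split => //; first by rewrite sqrrN.
by rewrite scaleNr.
Qed.

Lemma unit_normal_unit x n : unit_normal x n -> dot n n = 1.
Proof.
move=> [c [e [Ac cx e1 ->]]].
by rewrite dotZl dotZr (chart_normal_unit Ac cx) mulr1 -expr2.
Qed.

Lemma chart_normal_continuous c x : A c -> cdom c x -> {for x, continuous (chart_normal c)}.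
Proof.
move=> Ac cx; apply: continuous_comp; first exact: cmap_continuous_at.
apply: differentiable_continuous; apply: rowfun_differentiable.
exact: (normal_analytic (ga Ac) (rg Ac) (cimg_cmap cx)).
Qed.

(** Both Gauss maps are factored in one chart. If the velocities at x are
    negatively ordered, the parameter of the first curve is reversed (the sign
    tau); positivity then persists near x by continuity. *)
Lemma surface_boxes x : exists W N u (c : bool -> R -> 'rV[R]_4) I, split_chart F unit_normal W N u c I /\ W x.
Proof.
have [c Ac cx] := cov x; have px := cimg_cmap cx; set p := cmap c x in px.
pose X := surf F c; have Xa := ga Ac; have XX q (_ : cimg c q) := surf_unit FS c q.
have oU := @open_cimg _ _ c; have reg := rg Ac; have flat := flatF Ac.
have [it [rt [at_ [ut [ct [vt rt0 [ut0 sct] [zt zt0 st] Ht]]]]]] :=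
  gauss_map_factor oU Xa XX reg flat true px.
have [jf [rf [af [uf [cf [vf rf0 [uf0 scf] [zf zf0 sf] Hf]]]]]] :=
  gauss_map_factor oU Xa XX reg flat false px.
have [_ _ /(_ it jf vt vf) sg0] := chart_split oU Xa XX reg flat px.
have sg1 : sigma (F x) (chart_normal c x) (speed ct 0) (speed cf 0) != 0.
  rewrite st sf sigmaZ mulf_neq0 //; first exact: mulf_neq0.
  by rewrite -(surf_cmap F cx).
pose r := Num.min rt rf.
pose tau := Num.sg (sigma (F x) (chart_normal c x) (speed ct 0) (speed cf 0)).
have tau1 : tau ^+ 2 = 1 by rewrite sqr_sg sg1.
pose e (b : bool) := if b then tau else 1.
have e1 b : e b ^+ 2 = 1 by case: b; rewrite /e // expr1n.
pose u0 (b : bool) := if b then ut else uf.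
pose c0 (b : bool) := if b then ct else cf.
pose I0 (b : bool) := if b then [set s : R | `|s| < at_] else [set s | `|s| < af].
have u00 b : u0 b p = 0 by case: b.
have sc0 b : sphere_curve (I0 b) (c0 b) by case: b.
have P h : `|h| < r -> forall b, [/\ I0 b (u0 b (p + h)), c0 b (u0 b (p + h)) = gauss_map X b (p + h),
    {for p + h, continuous (u0 b)} & open_map_at (u0 b) (p + h)].
  by rewrite lt_min => /andP[h1 h2] [|]; [exact: Ht|exact: Hf].
have ne : e true * sigma (F x) (chart_normal c x) (speed ct 0) (speed cf 0) =
    `|sigma (F x) (chart_normal c x) (speed ct 0) (speed cf 0)| by rewrite -normrEsg.
pose v b y := e b * u0 b (cmap c y).
pose cv b := reparam 1 (e b) 0 0 (c0 b).
pose Iv b := preaff (e b) 0 0 (I0 b).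
have vK b y : 0 + e b * (v b y - 0) = u0 b (cmap c y).
  by rewrite add0r subr0 /v mulrA -expr2 e1 mul1r.
have scv b : sphere_curve (Iv b) (cv b) by apply: sphere_curve_reparam => //; rewrite expr1n.
have sv b y : I0 b (u0 b (cmap c y)) -> speed (cv b) (v b y) = e b *: speed (c0 b) (u0 b (cmap c y)).
  move=> Iy; have [_ _ HI] := sc0 b.
  by rewrite speed_reparam vK ?mul1r //; case: (HI _ Iy) => [[]].
pose sg y := sigma (F y) (chart_normal c y) (speed (cv true) (v true y)) (speed (cv false) (v false y)).
have rp : \forall y \near x, `|cmap c y - p| < r.
  have r0 : 0 < r by rewrite lt_min rt0.
  have /cvgrPdist_lt/(_ _ r0) := cmap_continuous_at cx.
  by apply: filterS => y; rewrite distrC.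
have Q y : `|cmap c y - p| < r -> forall b, [/\ I0 b (u0 b (cmap c y)),
    c0 b (u0 b (cmap c y)) = gauss_map X b (cmap c y),
    {for cmap c y, continuous (u0 b)} & open_map_at (u0 b) (cmap c y)].
  by move=> yr b; rewrite -(subrKC p (cmap c y)); exact: P.
have cv_ b y : cdom c y -> `|cmap c y - p| < r -> {for y, continuous (v b)}.
  move=> cy yr; have [_ _ cu _] := Q y yr b.
  apply: cvgMl_tmp; apply: (@continuous_comp _ _ _ (cmap c) (u0 b)) => //.
  exact: cmap_continuous_at.
have x0 : `|cmap c x - p| < r by rewrite subrr normr0 lt_min rt0.
have nsg : \forall y \near x, 0 < sg y.
  have csg : {for x, continuous sg}.
    have csp b : ccont (fun y => speed (cv b) (v b y)) x.
      move=> k; rewrite /prop_for /continuous_at; under eq_fun do rewrite mxE.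
      rewrite mxE; apply: (@continuous_comp _ _ _ (v b) ('D_1 (fun t => cv b t 0 k))); first exact: cv_.
      apply: tame_D1_continuous; have [_ _ HI] := scv b.
      have [[tc _] _] : unit_tame (cv b) (v b x) /\ dot (cv b (v b x)) (cv b (v b x)) = 1.
        by apply: HI; rewrite /Iv /preaff /= vK; have [] := Q x x0 b.
      exact: tc.
    apply: sigma_continuous => //; last by apply/ccontP; exact: chart_normal_continuous.
    apply/ccontP; rewrite /prop_for /continuous_at -(surf_cmap F cx).
    have : {for x, continuous (surf F c \o cmap c)}.
      apply: continuous_comp; first exact: cmap_continuous_at.
      exact: differentiable_continuous (rowfun_differentiable (ga Ac px)).
    apply: cvg_trans; apply: near_eq_cvg.
    by apply: filterS (near_cdom cx) => y cy; rewrite /= surf_cmap.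
  have sgx : 0 < sg x.
    have Ix b : I0 b (u0 b (cmap c x)) by have [] := Q x x0 b.
    rewrite /sg !sv // -/p !u00 sigmaZ mulr1 ne normr_gt0; exact: sg1.
  have /cvgrPdist_lt/(_ _ sgx) := csg; apply: filterS => y.
  have E (a b : R) : `|a - b| < a -> 0 < b by rewrite ltr_norml => /andP[_]; lra.
  exact: E.
pose W := interior [set y | [/\ cdom c y, `|cmap c y - p| < r & 0 < sg y]].
have Wx : W x by have nd := near_cdom cx; near=> y; split; near: y.
exists W, (chart_normal c), v, cv, Iv; split; last exact: Wx.
split; [exact: open_interior|exact: scv|] => y Wy.
have [cy yr sy] := interior_subset Wy; have iy := cimg_cmap cy.
split; last exact: sy.
- exists c, 1; split; [exact: Ac|exact: cy|exact: expr1n|by rewrite (scale1r (chart_normal c y))].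
- exact: chart_normal_continuous.
move=> b; have [h1 h2 h3 h4] := Q y yr b; split.
- exact: cv_.
- move=> O nO.
  have nO' : nbhs (cmap c y) [set q | cimg c q /\ O (cinv c q)] by exact: near_cimg cy nO.
  have : {for v b y, continuous (fun s => 0 + e b * (s - 0) : R)}.
    exact: affine_continuous.
  rewrite /prop_for /continuous_at vK => /(_ _ (h4 _ nO')).
  apply: (@filterS _ (nbhs (v b y))) => s [q [iq Oq] qs]; exists (cinv c q) => //.
  by have [_ qK] := cinvK iq; rewrite /v qK qs add0r subr0 mulrA -expr2 e1 mul1r.
- by rewrite /Iv /preaff /= vK.
- by rewrite /cv /reparam vK scale1r h2 /gauss_map /X surf_cmap.
Unshelve. all: by end_near. Qed.

End Boxes.

(** * The oriented atlas *)

Section Flip.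
Variable R : realType.
Implicit Types (p q h : 'rV[R]_2) (e : R).

(** For e = -1 a reflection of the plane, for e = 1 the identity: one formula for
    charts that are kept and charts that are reversed. *)
Definition flip e q : 'rV[R]_2 := \row_i ((if i == 0 then e else 1) * q 0 i).

Lemma flipK e q : e ^+ 2 = 1 -> flip e (flip e q) = q.
Proof.
by move=> e1; apply/rowP => i; rewrite !mxE mulrA; case: ifP => _; rewrite ?mul1r // -expr2 e1 mul1r.
Qed.

Lemma flip1 q : flip 1 q = q.
Proof. by apply/rowP => i; rewrite mxE if_same mul1r. Qed.

Lemma flip_continuous e q : {for q, continuous (flip e)}.
Proof.
have -> : flip e = (fun q => (e * q 0 0) *: (delta_mx 0 0 : 'rV[R]_2) + q 0 1 *: delta_mx 0 1).
  by apply/funext => u; rewrite [LHS]row_sum_delta sum2 !mxE /= mul1r.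
apply: differentiable_continuous; apply: differentiableD; apply: differentiableZl.
  by apply: differentiableZ; exact: differentiable_coord.
exact: differentiable_coord.
Qed.

Lemma partial_coordZ (a : R) i k p : partial i (fun q => a * q 0 k) p = a * (i == k)%:R.
Proof.
rewrite /partial /derive; apply: cvg_lim; first exact: norm_hausdorff.
have E : \forall h \near (0 : R)^', a * (i == k)%:R =
    h^-1 *: (a * (h *: (delta_mx 0 i : 'rV[R]_2) + p) 0 k - a * p 0 k).
  near=> h; have h0 : h != 0 by near: h; exact: nbhs_dnbhs_neq.
  rewrite !mxE eqxx /= mulrDr addrK /GRing.scale /= (eq_sym i).
  by move: (_%:R) => d; field.
by apply: cvg_trans (near_eq_cvg E) _; exact: cvg_cst.
Unshelve. all: by end_near. Qed.

Lemma analytic_at_flipr m (f : 'rV[R]_2 -> 'rV[R]_m) e p :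
  analytic_at f (flip e p) -> analytic_at (f \o flip e) p.
Proof.
move=> H k; have [c Hc] := H k; exists (fun i j => c i j * e ^+ i).
have N : \forall q \near p, power_series2_sum c (flip e q - flip e p) (f (flip e q) 0 k).
  exact: (flip_continuous Hc).
apply: filterS N => q.
have E i j : c i j * (flip e q - flip e p) 0 0 ^+ i * (flip e q - flip e p) 0 1 ^+ j =
    c i j * e ^+ i * (q - p) 0 0 ^+ i * (q - p) 0 1 ^+ j.
  by rewrite !mxE /= -!mulrBr exprMn mul1r mulrA.
have S (g : R -> R) : (fun n => \sum_(i < n) \sum_(j < n)
      g (c i j * (flip e q - flip e p) 0 0 ^+ i * (flip e q - flip e p) 0 1 ^+ j)) =
    (fun n => \sum_(i < n) \sum_(j < n) g (c i j * e ^+ i * (q - p) 0 0 ^+ i * (q - p) 0 1 ^+ j)).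
  by apply/funext => n; apply: eq_bigr => i _; apply: eq_bigr => j _; rewrite E.
by move=> [cv lm]; split; rewrite -?(S Num.norm) // -(S id).
Qed.

Lemma analytic_at_flipl (f : 'rV[R]_2 -> 'rV[R]_2) e p :
  analytic_at f p -> analytic_at (flip e \o f) p.
Proof.
move=> H k; have [c Hc] := H k; pose a : R := if k == 0 then e else 1.
exists (fun i j => a * c i j); apply: filterS Hc => q [cv lm].
rewrite /= mxE -/a; split.
  have -> : (fun n => \sum_(i < n) \sum_(j < n) `|a * c i j * (q - p) 0 0 ^+ i * (q - p) 0 1 ^+ j|) =
      (fun n => `|a| * \sum_(i < n) \sum_(j < n) `|c i j * (q - p) 0 0 ^+ i * (q - p) 0 1 ^+ j|).
    apply/funext => n; rewrite mulr_sumr; apply: eq_bigr => i _.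
    by rewrite mulr_sumr; apply: eq_bigr => j _; rewrite -normrM !mulrA.
  exact: is_cvgMl_tmp.
have -> : (fun n => \sum_(i < n) \sum_(j < n) a * c i j * (q - p) 0 0 ^+ i * (q - p) 0 1 ^+ j) =
    (fun n => a * \sum_(i < n) \sum_(j < n) c i j * (q - p) 0 0 ^+ i * (q - p) 0 1 ^+ j).
  apply/funext => n; rewrite mulr_sumr; apply: eq_bigr => i _.
  by rewrite mulr_sumr; apply: eq_bigr => j _; rewrite !mulrA.
exact: cvgMl_tmp.
Qed.

End Flip.

Section FlippedCharts.
Variables (R : realType) (T : topologicalType).
Implicit Types (b c d : chart R T) (x : T) (e : R).

Definition flipped e c b := [/\ cdom b `<=` cdom c, cmap b = flip e \o cmap c &
  cinv b = cinv c \o flip e].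

Lemma flipped_refl c : flipped 1 c c.
Proof.
by split => //; apply/funext => x; rewrite /= flip1.
Qed.

Lemma flipped_exists e c (D : set T) : e ^+ 2 = 1 -> open D -> D `<=` cdom c ->
  exists2 b, flipped e c b & cdom b = D.
Proof.
move=> e1 oD Dc; pose m := flip e \o cmap c; pose i := cinv c \o flip e.
have mD : m @` D = flip e @^-1` [set q | cimg c q /\ D (cinv c q)].
  apply/seteqP; split => [q [x Dx <-]|q [iq Dq]] /=.
    by rewrite flipK // cmapK; [split => //; exact/cimg_cmap/Dc|exact: Dc].
  by exists (cinv c (flip e q)) => //; rewrite /m /= (cinvK iq).2 flipK.
have oi : open (m @` D).
  rewrite mD; apply: open_comp => [q _|]; first exact: flip_continuous.
  rewrite openE => q [iq Dq]; have [cq E] := cinvK iq.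
  have := near_cimg cq (open_nbhs_nbhs (conj oD Dq)); rewrite E; exact.
have K x : D x -> i (m x) = x by move=> /Dc cx; rewrite /i /m /= flipK // cmapK.
have cm : {within D, continuous m}.
  rewrite continuous_open_subspace // => x /set_mem/Dc cx.
  by apply: continuous_comp; [exact: cmap_continuous_at|exact: flip_continuous].
have ci : {within m @` D, continuous i}.
  rewrite continuous_open_subspace // => q /set_mem; rewrite mD => -[iq _].
  by apply: continuous_comp; [exact: flip_continuous|exact: cinv_continuous_at].
by exists (Chart oD oi K cm ci).
Qed.

Lemma flipped_compatible e e' c d b b' : e ^+ 2 = 1 -> analytic_on (transition c d) (transition_dom c d) ->
  flipped e c b -> flipped e' d b' -> analytic_on (transition b b') (transition_dom b b').
Proof.
move=> e1 H [bc mb ib] [bd mb' ib'] p [x [bx bx'] <-].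
have -> : transition b b' = flip e' \o (transition c d \o flip e).
  by rewrite /transition mb' ib.
apply: analytic_at_flipl; apply: analytic_at_flipr; rewrite mb /= flipK //.
by apply: H; exists x => //; split; [exact: bc|exact: bd].
Qed.

Lemma flipped_jacobian e c b x : e ^+ 2 = 1 -> analytic_on (transition c c) (transition_dom c c) ->
  flipped e c b -> cdom b x -> \det ('J (transition b c) (cmap b x)) = e.
Proof.
move=> e1 H fb bx; have [bc mb ib] := fb; have cx := bc _ bx.
have ta : analytic_at (transition b c) (cmap b x).
  by apply: (flipped_compatible e1 H fb (flipped_refl c)); exists x.
have N : \forall q \near cmap b x, transition b c q = flip e q.
  have n0 : \forall q \near flip e (cmap b x), cimg c q.
    rewrite mb /= flipK //.
    exact: open_nbhs_nbhs (conj (@open_cimg _ _ c) (cimg_cmap cx)).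
  have n1 : \forall q \near cmap b x, cimg c (flip e q) := flip_continuous n0.
  by apply: filterS n1 => q iq; rewrite /transition ib /= (cinvK iq).2.
have E i k : 'J (transition b c) (cmap b x) i k = (if k == 0 then e else 1) * (i == k)%:R.
  rewrite (jacobianE _ _ (analytic_atP ta)) -(partial_coordZ _ _ _ (cmap b x)).
  by apply: partial_near; apply: filterS N => q ->; rewrite mxE.
by rewrite det2 !E /= !mulr1 !mulr0 subr0.
Qed.

End FlippedCharts.

Section Orientation.
Variables (R : realType) (T : topologicalType) (A : set (chart R T)) (F : T -> 'rV[R]_4).
Hypotheses (FS : forall x, sphere3 (F x))
  (cov : forall x, exists2 c, A c & cdom c x)
  (compat : forall c d, A c -> A d -> analytically_compatible c d)
  (im : forall c, A c -> analytic_on (F \o cinv c) (cimg c) /\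
    forall p, cimg c p -> injective ('d (F \o cinv c) p)).
Variable N : T -> 'rV[R]_4.
Hypotheses (cN : continuous N) (Nn : forall x, unit_normal A F x (N x)).
Implicit Types (b c d : chart R T) (x : T).

(** The domain of a chart may be disconnected, so the chart may agree with the global
    normal at some points and disagree at others; it is therefore first cut down to
    an open set on which the sign e is constant. *)
Definition oriented_charts : set (chart R T) := [set b | exists c e,
  [/\ A c, e ^+ 2 = 1, flipped e c b & forall x, cdom b x -> 0 < e * dot (chart_normal F c x) (N x)]].

Lemma oriented_charts_cover x : exists2 b, oriented_charts b & cdom b x.
Proof.
have [c Ac cx] := cov x.
have xn : unit_normal A F x (chart_normal F c x).
  by exists c, 1; split; [exact: Ac|exact: cx|exact: expr1n|rewrite (scale1r (chart_normal F c x))].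
have [eta eta1 E] := unit_normal_sign FS compat im xn (Nn x).
have dE : dot (chart_normal F c x) (N x) = eta.
  by rewrite E dotZr (unit_normal_unit FS im xn) mulr1.
pose D := [set y | cdom c y /\ 0 < eta * dot (chart_normal F c y) (N y)].
have Dx : D x by split => //; rewrite dE -expr2 eta1.
have oD : open D.
  rewrite openE => y [cy py].
  have cd : {for y, continuous (fun z => eta * dot (chart_normal F c z) (N z))}.
    apply: cvgMl_tmp; apply: dot_continuous; last exact: cN.
    exact: (chart_normal_continuous im).
  have P : \forall z \near y, 0 < eta * dot (chart_normal F c z) (N z).
    have K (a b : R) : `|a - b| < a -> 0 < b by rewrite ltr_norml => /andP[_]; lra.
    by have /cvgrPdist_lt/(_ _ py) := cd; apply: filterS => z; exact: K.
  by apply: filterI; [exact: near_cdom|exact: P].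
have Dc : D `<=` cdom c by move=> y [].
have [b fb bD] := flipped_exists eta1 oD Dc.
exists b; last by rewrite bD.
by exists c, eta; split => // y; rewrite bD => -[].
Qed.

Lemma oriented_charts_compatible b c : oriented_charts b -> A c -> analytically_compatible b c.
Proof.
move=> [d [e [Ad e1 fb _]]] Ac; have [H1 H2] := compat Ad Ac.
split; first exact: (flipped_compatible e1 H1 fb (flipped_refl c)).
exact: (flipped_compatible (expr1n _ _) H2 (flipped_refl c) fb).
Qed.

Lemma oriented_charts_good b : oriented_charts b -> good F b.
Proof.
move=> [c [e [Ac e1 [bc mb ib] _]]] q [x bx <-] k.
have [ga _] := im Ac; rewrite /surf ib.
apply: (@analytic_atP _ _ ((F \o cinv c) \o flip e)); apply: analytic_at_flipr.
rewrite mb /= flipK //; apply: ga; exact/cimg_cmap/bc.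
Qed.

(** Reversing the chart multiplies the cross product of the coordinate vectors by
    the Jacobian determinant e. *)
Lemma oriented_charts_positive b x : oriented_charts b -> cdom b x ->
  0 < dot (ncross (surf F b) (cmap b x)) (N x).
Proof.
move=> ob bx; have [c [e [Ac e1 fb /(_ x bx) pos]]] := ob.
have [bc mb ib] := fb; have cx := bc _ bx; have [ga ga'] := im Ac.
have [H _] := compat Ac Ac.
have ta : analytic_at (transition b c) (cmap b x).
  by apply: (flipped_compatible e1 H fb (flipped_refl c)); exists x.
rewrite (ncross_transition FS (surf_good ga) bx cx ta) (flipped_jacobian e1 H fb bx) dotZl.
have g0 := surf_regular ga ga' (cimg_cmap cx).
have K (v w : 'rV[R]_4) (s : R) : 0 < s -> 0 < e * dot (s^-1 *: v) w -> 0 < e * dot v w.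
  by move=> s0; rewrite dotZl mulrCA pmulr_rgt0 // invr_gt0.
by apply: K pos; rewrite sqrtr_gt0.
Qed.

(** The Jacobian determinant of a transition is the ratio of two cross products
    that are both positive multiples of the global normal. *)
Lemma orientable_of_normal : orientable A.
Proof.
exists oriented_charts; split; first split.
- exact: oriented_charts_cover.
- move=> b b' [c [e [Ac e1 fb _]]] [c' [e' [Ac' e1' fb' _]]].
  have [H1 H2] := compat Ac Ac'.
  by split; [exact: flipped_compatible e1 H1 fb fb'|exact: flipped_compatible e1' H2 fb' fb].
- exact: oriented_charts_compatible.
move=> b b' ob ob' p [x [bx bx'] <-].
have := oriented_charts_positive ob bx; have := oriented_charts_positive ob' bx'.
have [c [e [Ac e1 fb _]]] := ob; have [c' [e' [Ac' e1' fb' _]]] := ob'.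
have [H _] := compat Ac Ac'.
have ta : analytic_at (transition b b') (cmap b x).
  by apply: (flipped_compatible e1 H fb fb'); exists x.
rewrite (ncross_transition FS (oriented_charts_good ob') bx bx' ta) dotZl => h.
by rewrite pmulr_lgt0.
Qed.

End Orientation.

Theorem corollary10 (R : realType) (T : topologicalType)
    (A : set (chart R T)) (F : T -> 'rV[R]_4)
    (surfT : analytic_surface A)
    (connT : connected [set: T])
    (immF : analytic_immersion_S3 A F)
    (flatF : flat_immersion A F) :
  orientable A.
Proof.
have [_ _ [cov compat]] := surfT; have [FS im] := immF.
have [N cN Nn] := @global_normal _ _ F (unit_normal A F) (unit_normal_sign FS compat im)
  (@unit_normal_opp _ _ A F) (unit_normal_unit FS im) (surface_boxes FS cov im flatF) connT.
exact: orientable_of_normal FS cov compat im _ cN Nn.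
Qed.
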